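(* For all real numbers $p,q$ with $0<p<1$, $0<q<1$ and $0<p+q<1$, let $G_3(p,q):=p\,\delta_0+q\,\delta_{\pi/3}+(1-p-q)\,\delta_{2\pi/3}$, and let $p_3(G_3(p,q))$ be the probability that the typical cell of the stationary Poisson line tessellation with intensity $1$ and directional distribution $G_3(p,q)$ is a triangle. Then $$ p_3(G_3(p,q)) = \frac{2pq(1-p-q)}{p+q-p^2-q^2-pq}. $$ Moreover, the maximal value of $p_3(G_3(p,q))$ over all $p,q\in(0,1)$ with $0<p+q<1$ is attained precisely if $p=q=1/3$, and it is given by $$ \max_{0<p+q<1}p_3(G_3(p,q)) = p_3(G_3(1/3,1/3)) = \frac{2}{9}. $$
   Context: Lines in the plane are parametrized by pairs $(\theta,d)$, where $\theta\in[0,\pi)$ is the orientation angle the line makes with the (eastern) horizontal axis and $d\in\mathbb{R}$ is its signed distance to the origin. Let $G$ be a probability measure on $[0,\pi)$ (the directional distribution) which is non-degenerate, i.e. $G(\{\theta\})<1$ for every $\theta\in[0,\pi)$, and let $\gamma>0$. The stationary Poisson line process $X=X(\gamma,G)$ with intensity $\gamma$ and directional distribution $G$ is the Poisson process of lines whose intensity measure, in the coordinates $(\theta,d)$, is $\gamma\, G\otimes \mathrm{Leb}$ on $[0,\pi)\times\mathbb{R}$. Almost surely, the lines of $X$ decompose the plane into random convex polygons (cells), which form the Poisson line tessellation. The typical cell $Z=Z(\gamma,G)$ is the random polygon with distribution $$ P_Z(\,\cdot\,) := \frac{1}{\mathbb{E}\sum_{c:\,m(c)\in[0,1]^2}1}\;\mathbb{E}\sum_{c:\,m(c)\in[0,1]^2}\mathbf{1}\{c-m(c)\in\,\cdot\,\},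 $$ where the sums run over all cells $c$ of the tessellation whose lexicographically smallest vertex $m(c)$ lies in $[0,1]^2$. One takes $\gamma=1$, writes $Z(G):=Z(1,G)$, and defines the triangle probability $p_3(G):=\mathbb{P}[\,Z(G)\text{ is a triangle}\,]$. Here $\delta_x$ denotes the Dirac measure at $x$. *)

(* Defs.v *)
From HB Require Import structures.
From mathcomp Require Import all_boot all_order all_algebra.
From mathcomp Require Import all_classical all_reals all_analysis.
From mathcomp Require Import measurable_realfun.
From mathcomp Require Import ring lra.

Set Implicit Arguments.
Unset Strict Implicit.
Unset Printing Implicit Defensive.

Import Order.TTheory GRing.Theory Num.Theory.
Import numFieldNormedType.Exports.

Local Open Scope classical_set_scope.
Local Open Scope ring_scope.

(* A simple point process is a random set of points X : T -> set E. This loses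
   no generality below, where the intensity measure has no atoms. *)
Definition npoints (R : realType) (T : Type) (E : choiceType) (X : T -> set E)
  (B : set E) (w : T) : \bar R := counting (X w `&` B).
Arguments npoints {R T E}.

Record poisson_process (R : realType) (d d' : measure_display)
    (T : measurableType d) (E : measurableType d') (P : probability T R)
    (Lambda : {measure set E -> \bar R}) (X : T -> set E) : Prop := {
  npoints_measurable : forall B, measurable B ->
    measurable_fun setT (npoints X B : T -> \bar R) ;
  (* poisson_pmf 0 k is 1 for every k, instead of 0 for k > 0 *)
  npoints_poisson : forall B (k : nat), measurable B ->
    (Lambda B < +oo)%E ->
    P [set w | npoints X B w = k%:R%:E :> \bar R] =
      (fine (Lambda B) ^+ k / k`!%:R * expR (- fine (Lambda B)))%:E ;
  npoints_infinite : forall B, measurable B -> Lambda B = +oo%E ->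
    P [set w | npoints X B w = +oo%E :> \bar R] = 1%E ;
  npoints_independent : forall (n : nat) (B : 'I_n -> set E)
      (A : 'I_n -> set (\bar R)),
    (forall i, measurable (B i)) -> trivIset setT B ->
    (forall i, measurable (A i)) ->
    P (\bigcap_(i in setT) [set w | A i (npoints X (B i) w)]) =
      (\prod_(i < n) P [set w | A i (npoints X (B i) w)])%E }.

Definition angles (R : realType) : set R := [set theta | 0 <= theta < pi].

(* Probability measures on [0, pi[ are probability measures on the real line
   giving it full mass. *)
Record directional_distribution (R : realType)
    (G : probability (measurableTypeR R) R) : Prop := {
  directional_support : G (@angles R) = 1%E ;
  directional_nondegenerate : forall theta, angles theta -> (G [set theta] < 1)%E }.

Definition line_intensity (R : realType) (gamma : {posnum R})
    (G : probability (measurableTypeR R) R) :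
    {measure set (measurableTypeR R * measurableTypeR R) -> \bar R} :=
  mscale gamma%:num%:nng (G \x (@lebesgue_measure R))%E.

(* X w is the set of the coordinates (theta, d) of the lines. *)
Record poisson_line_process (R : realType) (dT : measure_display)
    (T : measurableType dT) (P : probability T R) (gamma : {posnum R})
    (G : probability (measurableTypeR R) R)
    (X : T -> set (measurableTypeR R * measurableTypeR R)) : Prop := {
  line_directional : directional_distribution G ;
  line_coordinates : forall w, X w `<=` @angles R `*` setT ;
  line_poisson : poisson_process P (line_intensity gamma G) X }.

(* The line with direction (cos theta, sin theta) at signed distance d from the
   origin, d being measured along the unit normal (- sin theta, cos theta). *)
Definition line (R : realType) (l : R * R) : set (R * R) :=
  [set z | - sin l.1 * z.1 + cos l.1 * z.2 = l.2].

(* The cells are taken closed. *)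
Definition cells (R : realType) (L : set (R * R)) : set (set (R * R)) :=
  let U := ~` \bigcup_(l in L) line l in
  [set closure (connected_component U x) | x in U].

(* The vertices of a convex polygon are its extreme points. *)
Definition vertex (R : realType) (c : set (R * R)) (z : R * R) : Prop :=
  c z /\ forall x y (t : R), c x -> c y -> 0 < t < 1 ->
    z = t *: x + (1 - t) *: y -> x = y.

Definition lex_le (R : realType) (x y : R * R) : bool :=
  (x.1 < y.1) || (x.1 == y.1) && (x.2 <= y.2).

Definition lexmin_vertex (R : realType) (c : set (R * R)) (m : R * R) : Prop :=
  vertex c m /\ forall z, vertex c z -> lex_le m z.

Definition triangle (R : realType) (c : set (R * R)) : Prop :=
  exists x y z : R * R,
    (y.1 - x.1) * (z.2 - x.2) != (y.2 - x.2) * (z.1 - x.1) /\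
    c = [set u | exists r s t : R, [/\ 0 <= r, 0 <= s, 0 <= t, r + s + t = 1
                                     & u = r *: x + s *: y + t *: z]].

(* The cells c with m(c) in the unit square and c - m(c) in A. *)
Definition marked_cells (R : realType) (L : set (R * R))
    (A : set (set (R * R))) : set (set (R * R)) :=
  [set c | cells L c /\ exists m, [/\ lexmin_vertex c m,
     0 <= m.1 <= 1, 0 <= m.2 <= 1 & A [set z - m | z in c]]].

(* The integral of a nonnegative function is a supremum over the simple functions
   below it, so that it is meaningful although the number of marked cells is
   only almost everywhere equal to a measurable function. *)
Definition mean_cells (R : realType) (dT : measure_display)
    (T : measurableType dT) (P : probability T R) (X : T -> set (R * R))
    (A : set (set (R * R))) : \bar R :=
  (\int[P]_w counting (marked_cells (X w) A))%E.

(* The probability that the typical cell belongs to A. *)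
Definition typical_cell (R : realType) (dT : measure_display)
    (T : measurableType dT) (P : probability T R) (X : T -> set (R * R))
    (A : set (set (R * R))) : R :=
  fine (mean_cells P X A) / fine (mean_cells P X setT).

Definition triangle_probability (R : realType) (dT : measure_display)
    (T : measurableType dT) (P : probability T R) (X : T -> set (R * R)) : R :=
  typical_cell P X (@triangle R).

Definition admissible (R : realType) (p q : R) : bool :=
  [&& 0 < p < 1, 0 < q < 1 & 0 < p + q < 1].

(* The proof argument only serves to attach the probability structure. *)
Definition G3 (R : realType) (p q : R) (_ : admissible p q)
    (A : set (measurableTypeR R)) : \bar R :=
  (p%:E * dirac (0%R : measurableTypeR R) A +
   q%:E * dirac ((pi / 3)%R : measurableTypeR R) A +
   (1 - p - q)%:E * dirac ((2 * pi / 3)%R : measurableTypeR R) A)%E.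

Section G3_theory.
Context (R : realType) (p q : R) (pq : admissible p q).

Let p_ge0 : 0 <= p. Proof. by case/and3P: pq => /andP[/ltW]. Qed.
Let q_ge0 : 0 <= q. Proof. by case/and3P: pq => _ /andP[/ltW]. Qed.
Let r_ge0 : 0 <= 1 - p - q.
Proof. by case/and3P: pq => _ _ /andP[_ /ltW]; lra. Qed.

Let mu1 : {measure set (measurableTypeR R) -> \bar R} := measure_add (mscale (NngNum p_ge0) (dirac (0 : measurableTypeR R)))
  (mscale (NngNum q_ge0) (dirac (pi / 3 : measurableTypeR R))).
Let mu : {measure set (measurableTypeR R) -> \bar R} := measure_add mu1
  (mscale (NngNum r_ge0) (dirac (2 * pi / 3 : measurableTypeR R))).

Let G3mu : G3 pq = mu.
Proof.
apply/funext => A; rewrite [RHS]measure_addE.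
by congr (_ + _)%E; rewrite [RHS]measure_addE.
Qed.

Let G3_0 : G3 pq set0 = 0%E. Proof. by rewrite G3mu measure0. Qed.
Let G3_ge0 A : (0 <= G3 pq A)%E. Proof. by rewrite G3mu measure_ge0. Qed.
Let G3_sigma_additive : semi_sigma_additive (G3 pq).
Proof. by rewrite G3mu; exact: measure_semi_sigma_additive. Qed.

HB.instance Definition _ := isMeasure.Build _ _ _ (G3 pq)
  G3_0 G3_ge0 G3_sigma_additive.

Let G3_setT : G3 pq setT = 1%E.
Proof. by rewrite /G3 !diracT !mule1 -!EFinD; congr (_%:E); ring. Qed.

HB.instance Definition _ :=
  Measure_isProbability.Build _ _ _ (G3 pq) G3_setT.

Lemma G3_directional : directional_distribution (G3 pq).
Proof.
have [/andP[p0 p1] /andP[q0 q1] /andP[_ pq1]] := and3P pq.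
have pi0 : 0 < pi :> R := pi_gt0 R.
have mem (t : measurableTypeR R) : 0 <= (t : R) -> (t : R) < pi ->
    dirac t (@angles R) = 1%E :> \bar R.
  by move=> t0 tpi; rewrite diracE mem_set//= /angles/= t0 tpi.
split => [|t _].
  rewrite /= /G3 !mem ?mule1 -?EFinD; [|lra..].
  by congr (_%:E); ring.
have ind (x : R) : ((x : measurableTypeR R) \in [set t]) = (x == t).
  by apply/idP/eqP => [/set_mem //|->]; exact/mem_set.
rewrite /= /G3 !diracE -!EFinM -!EFinD lte_fin !ind.
case: eqVneq => [<-|_]; case: eqVneq => /= ht; case: eqVneq => /= ht'; lra.
Qed.

End G3_theory.

(* Main.v *)
(* Up to sign, the distances of a point to the three lines through the origin in
   the given directions are linear forms a, b and c = a + b, and the lines of the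
   process are level sets of these forms at the points of independent Poisson
   processes of rates p, q and r = 1 - p - q. No line is vertical, so every
   crossing of two lines is the leftmost vertex of exactly one cell, and counting
   cells amounts to counting crossings in the unit square. Their mean number is
   s (p q + p r + q r) with s = sin (pi / 3), since every pair of directions turns
   the square into a parallelogram of area s in the two distances. The cell of a
   crossing of directions 0 and pi / 3 (resp. 0 and 2 pi / 3) is a triangle iff the
   next line of the third direction comes before the next lines of the first two;
   the three waiting times are independent exponentials of rates summing to 1, so
   that this has probability r (resp. q). The cell of a crossing of directions
   pi / 3 and 2 pi / 3 is never a triangle. Hence
   p3 = 2 p q r / (p q + p r + q r).

   The numbers of cells are not known to be measurable, so they are squeezed
   between measurable functions: the crossings are bounded above by products of
   numbers of points in thin strips, and the triangles and the other cells are
   bounded below by indicators of explicit events on a grid of mesh 1 / n. As the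
   lower bounds for the triangles and for the other cells add up to the upper
   bound, up to O(1 / n), no upper bound for triangles alone is needed. *)

Require Import Defs.
From HB Require Import structures.
From mathcomp Require Import all_boot all_order all_algebra.
From mathcomp Require Import all_classical all_reals all_analysis.
From mathcomp Require Import measurable_realfun finmap zify ring lra.

Set Implicit Arguments.
Unset Strict Implicit.
Unset Printing Implicit Defensive.

Import Order.TTheory GRing.Theory Num.Theory.
Import numFieldNormedType.Exports.

Local Open Scope classical_set_scope.
Local Open Scope ring_scope.

(** * Cells of a set of lines *)

Section Cells.
Context {R : realType}.
Implicit Types (L : set (R * R)) (x z : R * R).

(** [mean_cells] is a lower integral: monotone, but for nonmeasurable counts additivity survives
    only as an inequality. If [k + f <= g] almost everywhere with [k] and [g] measurable, then the
    integrals satisfy the same inequality, whatever [f] is. With [k] a minorant of the nontriangles,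
    [f] the number of triangles and [g] a majorant of all cells, this yields the upper bound for
    triangles. The geometry is deterministic on the almost sure event [good], where each cell is an
    explicit set attached to its leftmost vertex. Beyond [good], the Poisson law enters only through
    the probabilities that disjoint strips are hit or empty, and through the mean of a product of
    two independent counts. Triple crossings require no null-set argument: the upper bound counts
    them, and the lower bounds only use crossings kept off the third direction by an empty strip. *)

Definition offset (l z : R * R) : R := - sin l.1 * z.1 + cos l.1 * z.2 - l.2.

Lemma offset_conv l x z (t : R) :
  offset l (t *: x + (1 - t) *: z) = t * offset l x + (1 - t) * offset l z.
Proof.
case: x z => [x1 x2] [z1 z2]; rewrite /offset /=.
rewrite -![_ *: _]/(_ * _).
ring.
Qed.

Lemma offset_continuous l : continuous (offset l).
Proof.
move=> z; apply: cvgB; last exact: cvg_cst.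
by apply: cvgD; apply: cvgM; [exact: cvg_cst|exact: cvg_fst|exact: cvg_cst|exact: cvg_snd].
Qed.

Lemma segment_continuous x z : continuous (fun t : R => t *: x + (1 - t) *: z).
Proof.
move=> t; apply: cvgD; first exact: scalel_continuous.
apply: cvgZr_tmp; apply: cvgB; [exact: cvg_cst|exact: cvg_id].
Qed.

(** Products of offsets compare signs without orienting the lines. This is the open cell of [x] as
    an intersection of open half-planes; [csameside] is the closed version. *)
Definition sameside L x : set (R * R) :=
  [set z | forall l, L l -> 0 < offset l z * offset l x].

Definition csameside L x : set (R * R) :=
  [set z | forall l, L l -> 0 <= offset l z * offset l x].

Lemma conv_gt0 (a b t : R) : 0 <= a -> 0 < b -> 0 <= t < 1 -> 0 < t * a + (1 - t) * b.
Proof.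
move=> a0 b0 /andP[t0 t1]; apply: ltr_wpDl; first exact: mulr_ge0.
by apply: mulr_gt0 => //; lra.
Qed.

(** The set is star-shaped about [x]: it is the union of the segments joining its points to [x]. *)
Lemma connected_sameside L x : (forall l, L l -> offset l x != 0) ->
  connected (sameside L x).
Proof.
move=> xL.
have -> : sameside L x = \bigcup_(z in sameside L x)
    ((fun t : R => t *: z + (1 - t) *: x) @` `[0, 1]).
  apply/seteqP; split=> [z Sz|_ [z Sz [t t01 <-]] l Ll].
    exists z => //; exists 1; first by rewrite /= in_itv /= ler01 lexx.
    by rewrite subrr scale0r addr0 scale1r.
  move: t01; rewrite /= in_itv /= => /andP[t0 t1]; rewrite offset_conv mulrDl -!mulrA.
  have [->|tn1] := eqVneq t 1.
    by rewrite mul1r subrr mul0r addr0; exact: Sz.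
  apply: conv_gt0; [exact/ltW/Sz|by rewrite -expr2 exprn_even_gt0 //= xL|].
  by rewrite t0 lt_neqAle tn1.
apply: bigcup_connected.
  exists x => z _; exists 0; first by rewrite /= in_itv /= ler01 lexx.
  by rewrite scale0r add0r subr0 scale1r.
move=> z _; apply: connected_continuous_connected.
  exact: segment_connected.
exact/continuous_subspaceT/segment_continuous.
Qed.

(** The image of a connected set under [offset l] is an interval, so a connected set with points on
    both sides of a line meets the line. Conversely [sameside L x] is connected and avoids all
    lines. *)
Lemma component_sameside L x : (forall l, L l -> offset l x != 0) ->
  connected_component (~` \bigcup_(l in L) line l) x = sameside L x.
Proof.
move=> xL.
have lineE l z : line l z <-> offset l z = 0.
  rewrite /line /= /offset; split=> [->|/eqP]; first exact: subrr.
  by rewrite subr_eq0 => /eqP.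
apply/seteqP; split.
  move=> z [B [Bx BU cB] Bz] l Ll; rewrite ltNge; apply/negP => zx.
  have : is_interval (offset l @` B).
    apply/connected_intervalP/connected_continuous_connected => //.
    exact/continuous_subspaceT/offset_continuous.
  have Ez : (offset l @` B) (offset l z) by exists z.
  have Ex : (offset l @` B) (offset l x) by exists x.
  move=> iB; have : (offset l @` B) 0.
    have [z0|z0] := leP 0 (offset l z); have [x0|x0] := leP 0 (offset l x).
    - apply: contrapT => _; move: (xL _ Ll) => /negP; apply.
      have [zp|zp] := ltP 0 (offset l z).
        by rewrite eq_le x0 andbT; move: zx; rewrite pmulr_rle0.
      by case: (BU _ Bz); exists l => //; apply/lineE/eqP; rewrite eq_le z0 zp.
    - by apply: (iB _ _ Ex Ez); rewrite z0 ltW.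
    - by apply: (iB _ _ Ez Ex); rewrite x0 ltW.
    - by move: zx; rewrite leNgt nmulr_rgt0 // x0.
  by case=> y By /lineE y0; apply: (BU _ By); exists l.
apply: connected_component_max.
- by move=> l Ll; rewrite -expr2 exprn_even_gt0 //= xL.
- by move=> z Sz [l Ll /lineE z0]; have := Sz _ Ll; rewrite z0 mul0r ltxx.
- exact: connected_sameside.
Qed.

(** A point [z] of the closed cell is the limit of [t *: x + (1 - t) *: z] as [t] tends to 0 from
    the right, and for [0 < t <= 1] these points are strictly on the side of [x] for all lines at
    once. *)
Lemma closure_sameside L x : (forall l, L l -> offset l x != 0) ->
  closure (sameside L x) = csameside L x.
Proof.
move=> xL; apply/seteqP; split.
  have : closed (csameside L x).
    have -> : csameside L x =
        \bigcap_(l in L) (fun z => offset l z * offset l x) @^-1` [set y | 0 <= y].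
      by apply/seteqP; split.
    apply: closed_bigI => l _; apply: preimage_closed; last exact: closed_ge.
    move=> z _; apply: cvgM; [exact: offset_continuous|exact: cvg_cst].
  move=> /closure_id ->; apply: closureS => z Sz l Ll; exact/ltW/Sz.
move=> z Cz V Vz.
have c0 : (fun t : R => t *: x + (1 - t) *: z) @ 0^'+ --> z.
  have := @segment_continuous x z 0.
  rewrite /continuous_at scale0r add0r subr0 scale1r.
  exact: cvg_at_right_filter.
have : \forall t \near (0:R)^'+, [/\ V (t *: x + (1 - t) *: z), 0 < t & t <= 1].
  near=> t; split.
  - near: t; exact: c0.
  - by near: t; exact: nbhs_right_gt.
  - by near: t; exact: nbhs_right_le.
case/filter_ex => t [Vt t0 t1]; exists (t *: x + (1 - t) *: z); split => // l Ll.
rewrite offset_conv mulrDl -!mulrA addrC -{2}(subKr 1 t).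
apply: conv_gt0; first exact: Cz.
  by rewrite -expr2 exprn_even_gt0 //= xL.
by lra.
Unshelve. all: end_near. Qed.

Lemma cellsP L c : cells L c <->
  exists2 x, (forall l, L l -> offset l x != 0) & c = csameside L x.
Proof.
have UE x : (~` \bigcup_(l in L) line l) x <-> forall l, L l -> offset l x != 0.
  split=> [Ux l Ll|xL [l Ll]].
    apply/eqP => x0; apply: Ux; exists l => //.
    by apply/eqP; rewrite -subr_eq0 -/(offset l x) x0.
  by rewrite /line /= => lx; have := xL _ Ll; rewrite /offset lx subrr eqxx.
split=> [[x /UE xL <-]|[x xL ->]].
  by exists x => //; rewrite component_sameside // closure_sameside.
by exists x; [exact/UE|rewrite component_sameside // closure_sameside].
Qed.

End Cells.

(** * Cells with a given leftmost vertex *)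

Section Spread.
Context {R : realType}.
Implicit Types D : set R.

(** Locally finite and unbounded on both sides, which provides next and previous points; almost
    surely this holds for the lines of each direction. *)
Definition spread D := (forall N : nat, finite_set (D `&` `[- N%:R, N%:R])) /\
  forall N : nat, (exists2 d, D d & N%:R < d) /\ (exists2 d, D d & d < - N%:R).

Lemma spreadN D : spread D -> spread [set x | D (- x)].
Proof.
move=> [Df Du]; split=> N.
  have -> : [set x | D (- x)] `&` `[- N%:R, N%:R] = -%R @` (D `&` `[- N%:R, N%:R]).
    apply/seteqP; split=> [x [Dx xN]|_ [x [Dx xN] <-]]; move: xN; rewrite /= !in_itv /= => xN.
      by exists (- x); rewrite ?opprK //; split => //; rewrite in_itv /=; lra.
    by rewrite opprK; split => //; lra.
  exact/finite_image/Df.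
have [[d Dd dN] [e De eN]] := Du N.
by split; [exists (- e)|exists (- d)]; rewrite /= ?opprK //; lra.
Qed.

Lemma finite_min (A : set R) : finite_set A -> A !=set0 ->
  exists2 m, A m & forall x, A x -> m <= x.
Proof.
move=> /finite_seqP [s ->]; elim: s => [[x //]|a s IH _].
have [s0|] := pselect ([set` s] !=set0).
  have [m ms mle] := IH s0; have [am|/ltW ma] := leP a m.
    exists a => [/=|x]; first by rewrite mem_head.
    by rewrite /= inE => /predU1P[->//|/mle]; exact: le_trans.
  exists m => [/=|x]; first by rewrite inE ms orbT.
  by rewrite /= inE => /predU1P[->//|/mle].
move=> s0; exists a => [/=|x]; first by rewrite mem_head.
by rewrite /= inE => /predU1P[->//|xs]; case: s0; exists x.
Qed.

Lemma spread_next D (t : R) : spread D ->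
  exists d, [/\ D d, t < d & forall e, D e -> t < e -> d <= e].
Proof.
move=> [Df Du].
have [N tN] : exists N : nat, `|t| < N%:R.
  by exists (Num.truncn `|t|).+1; exact: truncnS_gt.
have [[d0 Dd0 Nd0] _] := Du N.
have [M dM] : exists M : nat, `|d0| < M%:R.
  by exists (Num.truncn `|d0|).+1; exact: truncnS_gt.
have [||d [Dd [td dd0]] dmin] := @finite_min (D `&` [set x : R | t < x /\ x <= d0]).
- apply: sub_finite_set (Df M) => x /= [Dx [tx xd0]]; split => //.
  by rewrite in_itv /=; move: tN dM; rewrite !ltr_norml; lra.
- exists d0; split => //; split; last exact: lexx.
  by move: tN; rewrite ltr_norml; lra.
exists d; split => // e De te; have [ed0|d0e] := leP e d0; first exact: dmin.
exact: (le_trans dd0 (ltW d0e)).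
Qed.

Lemma spread_prev D (t : R) : spread D ->
  exists d, [/\ D d, d < t & forall e, D e -> e < t -> e <= d].
Proof.
move=> /spreadN /(spread_next (- t)) [d [Dd td dmin]].
exists (- d); split => //; first by rewrite ltrNl.
by move=> e De et; rewrite lerNr; apply: dmin; rewrite /= ?opprK // ltrN2.
Qed.

(** [a] is the predecessor of [b], so that [a = t] when [t] lies in [D]; where [t] is known to be
    outside [D], the bound [a <= t] becomes strict. *)
Lemma spread_gap D (t : R) : spread D ->
  exists a b, [/\ D a, D b, a <= t, t < b & forall e, D e -> e <= a \/ b <= e].
Proof.
move=> sD; have [b [Db tb bmin]] := spread_next t sD.
have [a [Da ab amax]] := spread_prev b sD.
exists a, b; split => //.
  by rewrite leNgt; apply/negP => /(bmin _ Da); rewrite leNgt ab.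
by move=> e De; have [/(amax _ De)|] := ltP e b; [left|right].
Qed.

End Spread.

Lemma conv_min (R : realFieldType) (a x y t : R) : a <= x -> a <= y -> 0 < t < 1 ->
  a = t * x + (1 - t) * y -> x = a /\ y = a.
Proof.
move=> ax ay /andP[t0 t1] E; have s0 : 0 < 1 - t by rewrite subr_gt0.
have x0 : 0 <= t * (x - a) by rewrite mulr_ge0 ?subr_ge0 // ltW.
have y0 : 0 <= (1 - t) * (y - a) by rewrite mulr_ge0 ?subr_ge0 // ltW.
have xE : t * (x - a) = 0 by nra.
have yE : (1 - t) * (y - a) = 0 by nra.
move/eqP: xE; rewrite mulf_eq0 gt_eqF //= subr_eq0 => /eqP ->.
by move/eqP: yE; rewrite mulf_eq0 gt_eqF //= subr_eq0 => /eqP ->.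
Qed.

(** * Extreme points of a triangle *)

Section Triangle.
Context {R : realType}.
Implicit Types (c : set (R * R)) (w : R * R).

Lemma triangle_translate c w : triangle c -> triangle [set z + w | z in c].
Proof.
move=> [x [y [z [xyz ->]]]]; exists (x + w), (y + w), (z + w); split.
  case: x y z w xyz => [? ?] [? ?] [? ?] [? ?] /=; apply: contra_neq => E.
  by lra.
have E r s t : r + s + t = 1 ->
    r *: (x + w) + s *: (y + w) + t *: (z + w) = r *: x + s *: y + t *: z + w.
  move=> rst; have -> : r = 1 - s - t by lra.
  case: x y z w {xyz} => [? ?] [? ?] [? ?] [? ?].
  by congr pair => /=; rewrite -![_ *: _]/(_ * _); ring.
apply/seteqP; split=> [_ [u [r [s [t [r0 s0 t0 rst ->]]]] <-]|u].
  by exists r, s, t; split => //; rewrite E.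
move=> [r [s [t [r0 s0 t0 rst ->]]]].
exists (r *: x + s *: y + t *: z); last by rewrite E.
by exists r, s, t.
Qed.

(** A barycentric coordinate strictly between 0 and 1 places the extreme point inside a segment of
    the triangle that starts at a corner; extremality collapses the segment to that corner. So four
    distinct vertices exclude a triangle. *)
Lemma triangle_vertices c : triangle c ->
  exists x y z, forall e, vertex c e -> [\/ e = x, e = y | e = z].
Proof.
move=> [x [y [z [_ cE]]]]; exists x, y, z => e [ce ve].
have vE : forall a b t, c a -> c b -> 0 < t < 1 -> e = t *: a + (1 - t) *: b -> a = b.
  by move=> a b t; exact: ve.
have cx : c x by rewrite cE; exists 1, 0, 0; rewrite ?scale1r ?scale0r ?addr0; split => //; lra.
have cy : c y by rewrite cE; exists 0, 1, 0; rewrite ?scale1r ?scale0r ?addr0 ?add0r; split => //; lra.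
have cz : c z by rewrite cE; exists 0, 0, 1; rewrite ?scale1r ?scale0r ?addr0 ?add0r; split => //; lra.
move: ce; rewrite {1}cE => -[r [s [t [r0 s0 t0 rst eE]]]].
have [r1|r1] := eqVneq r 1.
  have s00 : s = 0 by lra.
  have t00 : t = 0 by lra.
  by constructor 1; rewrite eE r1 s00 t00 !scale0r !addr0 scale1r.
have [rz|rz] := eqVneq r 0.
  have [sz|sz] := eqVneq s 0.
    by constructor 3; rewrite eE rz sz !scale0r !add0r (_ : t = 1) ?scale1r //; lra.
  have [s1|s1] := eqVneq s 1.
    by constructor 2; rewrite eE rz s1 (_ : t = 0) ?scale1r ?scale0r ?add0r ?addr0 //; lra.
  have tE : t = 1 - s by lra.
  have s01 : 0 < s < 1 by rewrite !lt_neqAle s0 eq_sym sz s1 /=; lra.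
  have E : e = s *: y + (1 - s) *: z by rewrite eE rz scale0r add0r tE.
  constructor 2; rewrite E; have -> := vE _ _ _ cy cz s01 E.
  by rewrite -scalerDl addrC subrK scale1r.
have r01 : 0 < r < 1 by rewrite !lt_neqAle r0 eq_sym rz r1 /=; lra.
have r'0 : 1 - r != 0 by apply/eqP; lra.
(* The point of the side opposite to [x] such that [e] lies between it and [x]. *)
pose y' := (s / (1 - r)) *: y + (t / (1 - r)) *: z.
have cy' : c y'.
  rewrite cE; exists 0, (s / (1 - r)), (t / (1 - r)); split; rewrite ?scale0r ?add0r //.
  - by rewrite divr_ge0 //; lra.
  - by rewrite divr_ge0 //; lra.
  - by rewrite -mulrDl (_ : s + t = 1 - r) ?divff //; lra.
have E : e = r *: x + (1 - r) *: y'.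
  by rewrite eE /y' scalerDr !scalerA !(mulrC (1 - r)) !divfK // addrA.
constructor 1; rewrite E -(vE _ _ _ cx cy' r01 E).
by rewrite -scalerDl addrC subrK scale1r.
Qed.

Lemma four_vertices_not_triangle c e1 e2 e3 e4 : uniq [:: e1; e2; e3; e4] ->
  vertex c e1 -> vertex c e2 -> vertex c e3 -> vertex c e4 -> ~ triangle c.
Proof.
move=> e14 v1 v2 v3 v4 /triangle_vertices[x [y [z H]]].
have mem e : vertex c e -> e \in [:: x; y; z].
  by move=> /H[] ->; rewrite !inE eqxx ?orbT.
have := @uniq_leq_size _ [:: e1; e2; e3; e4] [:: x; y; z] e14.
have sub e : e \in [:: e1; e2; e3; e4] -> e \in [:: x; y; z].
  by move=> ein; apply: mem; move: ein; rewrite !inE => /or4P[] /eqP ->.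
by move=> /(_ sub).
Qed.

End Triangle.

(** * The cell to the right of a crossing *)

Section Corner.
Context {R : realType}.
Variables (f g h : R * R -> R) (F G H : set R).
Variables (rho tau rho' tau' lam mu : R).

(* The abscissa is rho * f + tau * g with rho, tau > 0, so the wedge u <= f,
   v <= g opens to the right: corner_pt u v is the leftmost point of
   corner_cell u v, whether or not the latter is a cell. *)
Definition corner_pt (u v : R) : R * R := (rho * u + tau * v, rho' * u + tau' * v).

Hypothesis f_pt : forall u v, f (corner_pt u v) = u.
Hypothesis g_pt : forall u v, g (corner_pt u v) = v.
Hypothesis pt_fg : forall z, corner_pt (f z) (g z) = z.
Hypothesis hE : forall z, h z = lam * f z + mu * g z.
Hypothesis rho_gt0 : 0 < rho.
Hypothesis tau_gt0 : 0 < tau.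

(** The side of a line of [H] is read off from the value of [h] at the corner, and a line of [H]
    through the corner counts as lying below. With this convention even a cell whose corner is a
    triple crossing has this form, as the upper bound requires. *)
Definition corner_cell (u v : R) : set (R * R) :=
  [set z | [/\ u <= f z, v <= g z,
     forall d, F d -> u < d -> f z <= d, forall d, G d -> v < d -> g z <= d &
     forall d, H d -> (lam * u + mu * v < d -> h z <= d) /\
                      (d <= lam * u + mu * v -> d <= h z)]].

Lemma corner_pt_conv t u v u' v' :
  t *: corner_pt u v + (1 - t) *: corner_pt u' v' =
  corner_pt (t * u + (1 - t) * u') (t * v + (1 - t) * v').
Proof. by rewrite /corner_pt; congr pair => /=; rewrite -![_ *: _]/(_ * _); ring. Qed.

Lemma fg_conv t x y :
  f (t *: x + (1 - t) *: y) = t * f x + (1 - t) * f y /\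
  g (t *: x + (1 - t) *: y) = t * g x + (1 - t) * g y.
Proof. by rewrite -{1 3}(pt_fg x) -{1 3}(pt_fg y) corner_pt_conv f_pt g_pt. Qed.

Lemma corner_cell_pt u v : corner_cell u v (corner_pt u v).
Proof.
split; rewrite ?f_pt ?g_pt //; [by move=> d _ /ltW|by move=> d _ /ltW|].
by move=> d _; rewrite hE f_pt g_pt; split => [/ltW|].
Qed.

Lemma fg_inj x y : f x = f y -> g x = g y -> x = y.
Proof. by move=> fxy gxy; rewrite -(pt_fg x) -(pt_fg y) fxy gxy. Qed.

Lemma corner_cell_lexmin u v : lexmin_vertex (corner_cell u v) (corner_pt u v).
Proof.
split; first split.
- exact: corner_cell_pt.
- move=> x y t [ux vx _ _ _] [uy vy _ _ _] t01 E.
  have [] := fg_conv t x y; rewrite -E f_pt g_pt => Ef Eg.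
  have [fx fy] := conv_min ux uy t01 Ef.
  have [gx gy] := conv_min vx vy t01 Eg.
  by apply: fg_inj; rewrite ?fx ?fy ?gx ?gy.
move=> z [[uz vz _ _ _] _]; rewrite /lex_le -(pt_fg z).
have [->|fz] := eqVneq (f z) u; last first.
  apply/orP; left; rewrite /corner_pt /=.
  by apply: ltr_leD; rewrite ?ltr_pM2l ?ler_pM2l // lt_neqAle eq_sym fz.
have [->|gz] := eqVneq (g z) v; first by rewrite eqxx lexx orbT.
apply/orP; left; rewrite /corner_pt /=.
by rewrite ltrD2l ltr_pM2l // lt_neqAle eq_sym gz.
Qed.

(** Two linear forms minimal at [e] are constant along any segment of [c] through [e] by [conv_min],
    and independent forms then shrink it to a point. All vertices other than the corner are
    certified in this way, by two active constraints; negative coefficients stand for upper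
    bounds. *)
Lemma fg_vertex (c : set (R * R)) e a1 a2 b1 b2 : a1 * b2 - a2 * b1 != 0 -> c e ->
  (forall z, c z -> a1 * f e + a2 * g e <= a1 * f z + a2 * g z) ->
  (forall z, c z -> b1 * f e + b2 * g e <= b1 * f z + b2 * g z) -> vertex c e.
Proof.
move=> ab ce amin bmin; split => // x y t cx cy t01 E.
have [Ef Eg] := fg_conv t x y; rewrite -E in Ef Eg.
have [|ax ay] := conv_min (amin _ cx) (amin _ cy) t01; first by rewrite Ef Eg; ring.
have [|bx bY] := conv_min (bmin _ cx) (bmin _ cy) t01; first by rewrite Ef Eg; ring.
have dx : a1 * (f x - f y) + a2 * (g x - g y) = 0 by lra.
have dy : b1 * (f x - f y) + b2 * (g x - g y) = 0 by lra.
apply: fg_inj; apply/eqP; rewrite -subr_eq0; apply/eqP; apply: (mulfI ab);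
  rewrite mulr0.
  transitivity (b2 * (a1 * (f x - f y) + a2 * (g x - g y)) -
                a2 * (b1 * (f x - f y) + b2 * (g x - g y))); first by ring.
  by rewrite dx dy !mulr0 subrr.
transitivity (a1 * (b1 * (f x - f y) + b2 * (g x - g y)) -
              b1 * (a1 * (f x - f y) + a2 * (g x - g y))); first by ring.
by rewrite dx dy !mulr0 subrr.
Qed.

Variable L : set (R * R).
(** [Q] is arbitrary so that one hypothesis serves both for [y != 0] (no line through the point) and
    for [0 <= y] (same side). In the products, the signs by which [f], [g], [h] may differ from
    [offset] cancel. *)
Hypothesis lines_fgh : forall z x (Q : R -> Prop),
  (forall l, L l -> Q (offset l z * offset l x)) <->
  [/\ forall d, F d -> Q ((f z - d) * (f x - d)),
      forall d, G d -> Q ((g z - d) * (g x - d)) &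
      forall d, H d -> Q ((h z - d) * (h x - d))].

Lemma side_next D (y : R) u t : u < y -> D u -> (forall d, D d -> u < d -> y < d) ->
  (forall d, D d -> 0 <= (t - d) * (y - d)) <->
  (u <= t /\ forall d, D d -> u < d -> t <= d).
Proof.
move=> uy Du yD; split=> [tD|[ut tD] d Dd].
  split=> [|d Dd ud]; first by have := tD _ Du; rewrite pmulr_lge0 ?subr_gt0 // subr_ge0.
  by have := tD _ Dd; rewrite nmulr_lge0 ?subr_lt0 ?subr_le0 //; exact: yD.
have [ud|du] := ltP u d.
  by rewrite nmulr_lge0 ?subr_lt0 ?subr_le0; [exact: tD|exact: yD].
by rewrite mulr_ge0 ?subr_ge0 //; [exact: le_trans ut|exact/ltW/(le_lt_trans du)].
Qed.

(** The point [x] is a witness strictly inside the cell. It is used in both directions: with [x]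
    close to a given corner, to see that [corner_cell] is a cell, and with [x] a point of a given
    cell, to see that this cell has a corner. *)
Lemma csameside_corner u v x : F u -> G v -> u < f x -> v < g x ->
  (forall d, F d -> u < d -> f x < d) -> (forall d, G d -> v < d -> g x < d) ->
  (forall d, H d -> (lam * u + mu * v < d -> h x < d) /\
                    (d <= lam * u + mu * v -> d < h x)) ->
  (forall l, L l -> offset l x != 0) /\ csameside L x = corner_cell u v.
Proof.
move=> Fu Gv ux vx Fx Gx Hx; split.
  suff E : forall l, L l -> offset l x * offset l x != 0.
    by move=> l /E; rewrite mulf_eq0 orbb.
  apply/(lines_fgh x x (fun y => y != 0)); split=> d Dd; rewrite mulf_eq0 orbb subr_eq0.
  - by have [/(Fx _ Dd)/lt_eqF ->|/le_lt_trans/(_ ux)/gt_eqF ->] := ltP u d.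
  - by have [/(Gx _ Dd)/lt_eqF ->|/le_lt_trans/(_ vx)/gt_eqF ->] := ltP v d.
  - have [Hx1 Hx2] := Hx _ Dd.
    by have [/Hx1/lt_eqF ->|/Hx2/gt_eqF ->] := ltP (lam * u + mu * v) d.
apply/seteqP; split=> z.
  move=> /(lines_fgh z x (fun y => 0 <= y))[/(side_next _ ux Fu Fx)[uz zF]].
  move=> /(side_next _ vx Gv Gx)[vz zG] zH; split => // d Hd.
  have [Hx1 Hx2] := Hx _ Hd; have H0 := zH _ Hd.
  by split=> [/Hx1 xd|/Hx2 xd]; [move: H0|move: H0];
    [rewrite nmulr_lge0 ?subr_lt0 // subr_le0|rewrite pmulr_lge0 ?subr_gt0 // subr_ge0].
move=> [uz vz zF zG zH]; apply/(lines_fgh z x (fun y => 0 <= y)); split.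
- exact/(side_next _ ux Fu Fx).
- exact/(side_next _ vx Gv Gx).
- move=> d Hd; have [Hx1 Hx2] := Hx _ Hd; have [z1 z2] := zH _ Hd.
  have [td|dt] := ltP (lam * u + mu * v) d.
    by rewrite nmulr_lge0 ?subr_lt0 ?subr_le0; [exact: z1|exact: Hx1].
  by rewrite pmulr_lge0 ?subr_gt0 ?subr_ge0; [exact: z2|exact: Hx2].
Qed.

Hypothesis spreadF : spread F.
Hypothesis spreadG : spread G.
Hypothesis spreadH : spread H.

Lemma cells_corner u v : F u -> G v -> ~ H (lam * u + mu * v) ->
  cells L (corner_cell u v).
Proof.
set t := lam * u + mu * v => Fu Gv nHt.
have [u' [Fu' uu' u'min]] := spread_next u spreadF.
have [v' [Gv' vv' v'min]] := spread_next v spreadG.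
have [a [b [Ha Hb aw tb ab]]] := spread_gap t spreadH.
have {aw}at_ : a < t by rewrite lt_neqAle aw andbT; apply/eqP => at_; rewrite -at_ in nHt.
(* The witness will be the corner moved by [e] in both coordinates. There [h] differs from [t] by
   [(lam + mu) * e], at most [K * e] in absolute value; the [+ 1] keeps [K] positive. *)
pose K := `|lam + mu| + 1.
have K0 : 0 < K by rewrite ltr_wpDl.
have : \forall e \near (0 : R)^'+, [/\ 0 < e, e < u' - u, e < v' - v &
     e < (t - a) / K /\ e < (b - t) / K].
  near=> e; split; [|near: e; apply: nbhs_right_lt; lra..|].
    by near: e; exact: nbhs_right_gt.
  by split; near: e; apply: nbhs_right_lt; rewrite divr_gt0 // subr_gt0.
case/filter_ex => e [e0 eu ev [ea eb]].
rewrite ltr_pdivlMr // in ea; rewrite ltr_pdivlMr // in eb.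
have le1 : (lam + mu) * e <= K * e.
  by apply: ler_wpM2r; [exact: ltW|rewrite /K; have := ler_norm (lam + mu); lra].
have le2 : - (lam + mu) * e <= K * e.
  by apply: ler_wpM2r; [exact: ltW|rewrite /K -normrN; have := ler_norm (- (lam + mu)); lra].
have hx : h (corner_pt (u + e) (v + e)) = t + (lam + mu) * e.
  by rewrite hE f_pt g_pt /t; ring.
have [|||||xL <-] := @csameside_corner u v (corner_pt (u + e) (v + e)) Fu Gv;
  rewrite ?f_pt ?g_pt ?hx; [lra|lra|..].
- by move=> d Fd /(u'min _ Fd); lra.
- by move=> d Gd /(v'min _ Gd); lra.
- by move=> d /ab ?; rewrite -/t; split=> ?; lra.
by apply/cellsP; exists (corner_pt (u + e) (v + e)).
Unshelve. all: end_near. Qed.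

Hypothesis det_neq0 : rho * tau' - rho' * tau != 0.

Lemma corner_cell_next u v u' v' a b :
  F u' -> u < u' -> (forall d, F d -> u < d -> u' <= d) ->
  G v' -> v < v' -> (forall d, G d -> v < d -> v' <= d) ->
  H a -> H b -> a <= lam * u + mu * v -> lam * u + mu * v < b ->
  (forall d, H d -> d <= a \/ b <= d) ->
  corner_cell u v = [set z | [/\ u <= f z <= u', v <= g z <= v' &
                               a <= lam * f z + mu * g z <= b]].
Proof.
move=> Fu' uu' Fmin Gv' vv' Gmin Ha Hb at_ tb ab; apply/seteqP; split=> z.
  move=> [uz vz zF zG zH]; split; apply/andP; split => //.
  - exact: zF.
  - exact: zG.
  - by rewrite -hE; exact: (zH _ Ha).2.
  - by rewrite -hE; exact: (zH _ Hb).1.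
move=> [/andP[uz zu'] /andP[vz zv'] /andP[az zb]]; split => //.
- by move=> d Fd /(Fmin _ Fd); exact: le_trans.
- by move=> d Gd /(Gmin _ Gd); exact: le_trans.
- by move=> d /ab; rewrite hE; case=> ?; split=> ?; lra.
Qed.

(** In the coordinates [(f, g)] the cell is the right triangle [u <= f], [v <= g], [f + g <= e] with
    legs [l]. Inside it [f <= e - v] and [g <= e - u], so the later lines of [F] and [G] do not cut
    it. *)
Lemma corner_triangle u v e : lam = 1 -> mu = 1 ->
  H e -> u + v < e -> (forall d, H d -> u + v < d -> e <= d) ->
  (forall d, F d -> u < d -> e - v <= d) -> (forall d, G d -> v < d -> e - u <= d) ->
  triangle (corner_cell u v).
Proof.
move=> l1 m1 He te Hmin Fmin Gmin; pose l := e - (u + v).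
have l0 : 0 < l by rewrite subr_gt0.
exists (corner_pt u v), (corner_pt (u + l) v), (corner_pt u (v + l)); split.
  rewrite /corner_pt /= -subr_eq0.
  rewrite (_ : _ - _ = (rho * tau' - rho' * tau) * l ^+ 2); last by ring.
  by rewrite mulf_eq0 negb_or det_neq0 expf_neq0 // gt_eqF.
have conv r s t : r + s + t = 1 ->
    r *: corner_pt u v + s *: corner_pt (u + l) v + t *: corner_pt u (v + l) =
    corner_pt (u + s * l) (v + t * l).
  move=> rst; have -> : r = 1 - s - t by lra.
  by rewrite /corner_pt; congr pair => /=; rewrite -![_ *: _]/(_ * _); ring.
apply/seteqP; split=> z.
  rewrite /corner_cell l1 m1 !mul1r => -[uz vz _ _ zH].
  have zb : f z + g z <= e by have := (zH _ He).1 te; rewrite hE l1 m1 !mul1r.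
  exists (1 - (f z - u) / l - (g z - v) / l), ((f z - u) / l), ((g z - v) / l).
  rewrite conv; last by ring.
  rewrite !divfK ?gt_eqF // ![_ + (_ - _)]addrC !subrK pt_fg; split => //.
  - rewrite -addrA -opprD -mulrDl subr_ge0 ler_pdivrMr // mul1r /l; lra.
  - by rewrite divr_ge0 // ?subr_ge0 // ltW.
  - by rewrite divr_ge0 // ?subr_ge0 // ltW.
  - by ring.
move=> [r [s [t [r0 s0 t0 rst ->]]]]; rewrite conv //.
have sl : 0 <= s * l by rewrite mulr_ge0 // ltW.
have tl : 0 <= t * l by rewrite mulr_ge0 // ltW.
have stl : s * l + t * l <= l by rewrite -mulrDl; apply: ler_piMl; [exact: ltW|lra].
rewrite /corner_cell /= hE f_pt g_pt l1 m1 !mul1r; rewrite /l in sl tl stl *.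
split; [lra|lra|by move=> d Fd /(Fmin _ Fd); lra|by move=> d Gd /(Gmin _ Gd); lra|].
by move=> d Hd; split=> [/(Hmin _ Hd)|]; lra.
Qed.

Lemma min_exists (x y : R) : exists k, [/\ k <= x, k <= y & k = x \/ k = y].
Proof. by have [xy|/ltW xy] := leP x y; [exists x|exists y]; split => //; [left|right]. Qed.

Lemma corner_pt_eq u v u' v' :
  (corner_pt u v == corner_pt u' v') = (u == u') && (v == v').
Proof.
apply/eqP/andP => [E|[/eqP -> /eqP -> //]].
by split; apply/eqP; [rewrite -(f_pt u v) E f_pt|rewrite -(g_pt u v) E g_pt].
Qed.

(** Since a line of [F] comes before the next line of [H], the cell is still open above [(u', v)].
    Besides [(u, v)] and [(u', v)], it has as vertices the upper ends [(u, k)] and [(u', m)] of its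
    edges [f = u] and [f = u'], each capped by whichever of [G] and [H] comes first. *)
Lemma corner_not_triangle_add u v d : lam = 1 -> mu = 1 ->
  F d -> u < d -> (forall e, H e -> u + v < e -> d - u < e - (u + v)) ->
  ~ triangle (corner_cell u v).
Proof.
move=> l1 m1 Fd ud Hd.
have [u' [Fu' uu' u'min]] := spread_next u spreadF.
have [v' [Gv' vv' v'min]] := spread_next v spreadG.
have [a [b [Ha Hb at_ tb ab]]] := spread_gap (u + v) spreadH.
have cE : corner_cell u v = [set z | [/\ u <= f z <= u', v <= g z <= v' &
                               a <= f z + g z <= b]].
  by rewrite (@corner_cell_next u v u' v' a b) ?l1 ?m1 ?mul1r //; under eq_set do rewrite !mul1r.
have u'b : u' - u < b - (u + v).
  by apply: le_lt_trans (Hd _ Hb tb); rewrite lerD2r; exact: u'min.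
have [k [k1 k2 k12]] := min_exists v' (b - u).
have [m [m1' m2' m12]] := min_exists v' (b - u').
have vk : v < k by case: k12 => ->; lra.
have vm : v < m by case: m12 => ->; lra.
apply: (@four_vertices_not_triangle _ _ (corner_pt u v) (corner_pt u' v)
  (corner_pt u k) (corner_pt u' m)).
- rewrite /= !inE !corner_pt_eq ?(lt_eqF uu') ?(gt_eqF uu') ?(lt_eqF vk) ?(lt_eqF vm).
  by rewrite ?(gt_eqF vk) ?(gt_eqF vm) ?andbF.
- by case: (corner_cell_lexmin u v).
- apply: (@fg_vertex _ _ (-1) 0 0 1); first by rewrite mulr0 subr0 mulr1 oppr_eq0 oner_neq0.
  + by rewrite cE /= f_pt g_pt; split; apply/andP; split; lra.
  + by move=> z; rewrite cE f_pt g_pt => -[/andP[? ?] /andP[? ?] /andP[? ?]]; lra.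
  + by move=> z; rewrite cE f_pt g_pt => -[/andP[? ?] /andP[? ?] /andP[? ?]]; lra.
- have ck : corner_cell u v (corner_pt u k).
    by rewrite cE /= f_pt g_pt; split; apply/andP; split; lra.
  case: k12 => kE; [apply: (@fg_vertex _ _ 1 0 0 (-1))|apply: (@fg_vertex _ _ 1 0 (-1) (-1))] => //;
    try (by apply/eqP; lra);
    by move=> z; rewrite cE f_pt g_pt => -[/andP[? ?] /andP[? ?] /andP[? ?]]; lra.
- have cm : corner_cell u v (corner_pt u' m).
    by rewrite cE /= f_pt g_pt; split; apply/andP; split; lra.
  case: m12 => mE; [apply: (@fg_vertex _ _ (-1) 0 0 (-1))|apply: (@fg_vertex _ _ (-1) 0 (-1) (-1))] => //;
    try (by apply/eqP; lra);
    by move=> z; rewrite cE f_pt g_pt => -[/andP[? ?] /andP[? ?] /andP[? ?]]; lra.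
Qed.

(** For [h = g - f] the corner lies strictly inside a strip of [H], along which [f] and [g] increase
    together, so no line of [H] closes the wedge. The four vertices are the corner, the far ends
    [(k, v)] and [(u, m)] of its two edges, and [(k', m')], where the maxima of [f] and of [g] are
    attained simultaneously. *)
Lemma corner_not_triangle_sub u v : lam = -1 -> mu = 1 -> ~ H (v - u) ->
  ~ triangle (corner_cell u v).
Proof.
move=> l1 m1 nHt.
have [u' [Fu' uu' u'min]] := spread_next u spreadF.
have [v' [Gv' vv' v'min]] := spread_next v spreadG.
have [a [b [Ha Hb aw tb ab]]] := spread_gap (v - u) spreadH.
have {aw}at_ : a < v - u.
  by rewrite lt_neqAle aw andbT; apply/eqP => at_; rewrite -at_ in nHt.
have cE : corner_cell u v = [set z | [/\ u <= f z <= u', v <= g z <= v' &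
                               a <= g z - f z <= b]].
  have tE : lam * u + mu * v = v - u by rewrite l1 m1; ring.
  rewrite (@corner_cell_next u v u' v' a b) ?tE //; last exact: ltW.
  by apply: eq_set => z; rewrite l1 m1 mul1r mulN1r (addrC _ (g z)).
have [k [k1 k2 k12]] := min_exists u' (v - a).
have [m [m1' m2' m12]] := min_exists v' (u + b).
have [k' [k1' k2' k12']] := min_exists u' (v' - a).
have [m' [m1'' m2'' m12']] := min_exists v' (u' + b).
have uk : u < k by case: k12 => ->; lra.
have vm : v < m by case: m12 => ->; lra.
have uk' : u < k' by case: k12' => ->; lra.
have vm' : v < m' by case: m12' => ->; lra.
apply: (@four_vertices_not_triangle _ _ (corner_pt u v) (corner_pt k v)
  (corner_pt u m) (corner_pt k' m')).
- rewrite /= !inE !corner_pt_eq ?(lt_eqF uk) ?(gt_eqF uk) ?(lt_eqF vm) ?(gt_eqF vm).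
  by rewrite ?(lt_eqF uk') ?(lt_eqF vm') ?andbF.
- by case: (corner_cell_lexmin u v).
- have ck : corner_cell u v (corner_pt k v).
    by rewrite cE /= f_pt g_pt; split; apply/andP; split; lra.
  case: k12 => kE; [apply: (@fg_vertex _ _ 0 1 (-1) 0)|apply: (@fg_vertex _ _ 0 1 (-1) 1)] => //;
    try (by apply/eqP; lra);
    by move=> z; rewrite cE f_pt g_pt => -[/andP[? ?] /andP[? ?] /andP[? ?]]; lra.
- have cm : corner_cell u v (corner_pt u m).
    by rewrite cE /= f_pt g_pt; split; apply/andP; split; lra.
  case: m12 => mE; [apply: (@fg_vertex _ _ 1 0 0 (-1))|apply: (@fg_vertex _ _ 1 0 1 (-1))] => //;
    try (by apply/eqP; lra);
    by move=> z; rewrite cE f_pt g_pt => -[/andP[? ?] /andP[? ?] /andP[? ?]]; lra.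
- apply: (@fg_vertex _ _ (-1) 0 0 (-1)).
  + by apply/eqP; lra.
  + by rewrite cE /= f_pt g_pt; case: k12' => ?; case: m12' => ?; split; apply/andP; split; lra.
  + by move=> z; rewrite cE f_pt g_pt => -[/andP[? ?] /andP[? ?] /andP[? ?]]; case: k12' => ?; lra.
  + by move=> z; rewrite cE f_pt g_pt => -[/andP[? ?] /andP[? ?] /andP[? ?]]; case: m12' => ?; lra.
Qed.

End Corner.

(** * The three directions *)

Section Trigo.
Context {R : realType}.

(** The triple angle formula at [pi / 3] gives [4 c^3 - 3 c + 1 = 0], that is
    [(c + 1) (2 c - 1)^2 = 0], and [c > 0]. *)
Lemma cos_pi3 : cos (pi / 3 : R) = 1 / 2.
Proof.
have pi0 := pi_gt0 R; set c := cos _.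
have c0 : 0 < c by apply: cos_gt0_pihalf; lra.
have s0 : sin (pi / 3 : R) ^+ 2 = 1 - c ^+ 2 by exact: sin2cos2.
have : cos (pi / 3 *+ 2 + pi / 3 : R) = -1 by rewrite -cospi; congr cos; rewrite mulr2n; lra.
rewrite cosD cos_mulr2n sin_mulr2n -/c => E.
have {}E : (c + 1) * (2 * c - 1) ^+ 2 = 0.
  transitivity ((c ^+ 2 *+ 2 - 1) * c - c * sin (pi / 3) *+ 2 * sin (pi / 3) + 1).
    rewrite (_ : c * _ *+ 2 * _ = 2 * c * sin (pi / 3 : R) ^+ 2); last by ring.
    by rewrite s0; ring.
  by rewrite E; ring.
move/eqP: E; rewrite mulf_eq0 expf_eq0 /= => /orP[/eqP|/eqP]; lra.
Qed.

Lemma cos_2pi3 : cos (2 * pi / 3 : R) = - (1 / 2).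
Proof.
have -> : 2 * pi / 3 = pi - pi / 3 :> R by lra.
by rewrite cosB cospi sinpi cos_pi3; lra.
Qed.

Lemma sin_2pi3 : sin (2 * pi / 3 : R) = sin (pi / 3).
Proof.
have -> : 2 * pi / 3 = pi - pi / 3 :> R by lra.
by rewrite sinB cospi sinpi; lra.
Qed.

Lemma sin_pi3_gt0 : 0 < sin (pi / 3 : R).
Proof. by have pi0 := pi_gt0 R; apply: sin_gt0_pi; lra. Qed.

End Trigo.

(** * Coordinates adapted to two of the three directions *)

Section Frames.
Context {R : realType}.
Implicit Types (L : set (R * R)).

Local Notation s := (sin (pi / 3 : R)).

Definition distances (dir : R * R) L : set R := [set x | L (dir.1, dir.2 * x)].

Definition three_directions L :=
  forall l, L l -> [\/ l.1 = 0, l.1 = pi / 3 | l.1 = 2 * pi / 3].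

(* Two directions F and G and the remaining one H, each given by an angle and a
   sign e, together with the linear forms f, g, h such that the line (angle, d)
   is the level set f = e * d. The signs and the order of F and G are chosen so
   that the cell to the right of a crossing of F and G lies in the quadrant where
   f and g increase. *)
Record frame := Frame {
  fr_f : R * R -> R; fr_g : R * R -> R; fr_h : R * R -> R;
  fr_F : R * R; fr_G : R * R; fr_H : R * R;
  fr_rho : R; fr_tau : R; fr_rho' : R; fr_tau' : R; fr_lam : R; fr_mu : R;
  fr_pt := corner_pt fr_rho fr_tau fr_rho' fr_tau';
  fr_f_pt : forall u v, fr_f (fr_pt u v) = u;
  fr_g_pt : forall u v, fr_g (fr_pt u v) = v;
  fr_pt_fg : forall z, fr_pt (fr_f z) (fr_g z) = z;
  fr_hE : forall z, fr_h z = fr_lam * fr_f z + fr_mu * fr_g z;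
  fr_rho_gt0 : 0 < fr_rho;
  fr_tau_gt0 : 0 < fr_tau;
  fr_det_neq0 : fr_rho * fr_tau' - fr_rho' * fr_tau != 0;
  fr_lines : forall L z x (Q : R -> Prop), three_directions L ->
    (forall l, L l -> Q (offset l z * offset l x)) <->
    [/\ forall d, distances fr_F L d -> Q ((fr_f z - d) * (fr_f x - d)),
        forall d, distances fr_G L d -> Q ((fr_g z - d) * (fr_g x - d)) &
        forall d, distances fr_H L d -> Q ((fr_h z - d) * (fr_h x - d))] }.

Definition fr_cell (k : frame) L :=
  corner_cell (fr_f k) (fr_g k) (fr_h k) (distances (fr_F k) L) (distances (fr_G k) L)
    (distances (fr_H k) L) (fr_lam k) (fr_mu k).

Lemma offset_0 a (z : R * R) : offset (0, a) z = z.2 - a.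
Proof. by rewrite /offset /= sin0 cos0; ring. Qed.

Lemma offset_pi3 a (z : R * R) : offset (pi / 3, a) z = - (s * z.1 - z.2 / 2 + a).
Proof. by rewrite /offset /= cos_pi3; field. Qed.

Lemma offset_2pi3 a (z : R * R) : offset (2 * pi / 3, a) z = - (s * z.1 + z.2 / 2 + a).
Proof. by rewrite /offset /= cos_2pi3 sin_2pi3; field. Qed.


Definition dir_form (dir : R * R) (f : R * R -> R) := dir.2 * dir.2 = 1 /\
  exists2 e, e * e = 1 & forall d z, offset (dir.1, dir.2 * d) z = e * (f z - d).

Lemma dir_form_lines dir f L z x (Q : R -> Prop) : dir_form dir f ->
  (forall d, distances dir L d -> Q ((f z - d) * (f x - d))) <->
  (forall a, L (dir.1, a) -> Q (offset (dir.1, a) z * offset (dir.1, a) x)).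
Proof.
move=> [dd [e ee fE]].
have E d : offset (dir.1, dir.2 * d) z * offset (dir.1, dir.2 * d) x =
    (f z - d) * (f x - d) by rewrite !fE mulrACA ee mul1r.
split=> [fQ a La|LQ d Ld]; last by rewrite -E; exact: LQ.
have aE : a = dir.2 * (dir.2 * a) by rewrite mulrA dd mul1r.
by rewrite aE E; apply: fQ; rewrite /distances /= -aE.
Qed.

Lemma lines_dir_form f g h F G H L z x (Q : R -> Prop) :
  dir_form F f -> dir_form G g -> dir_form H h ->
  (forall l, L l -> [\/ l.1 = F.1, l.1 = G.1 | l.1 = H.1]) ->
  (forall l, L l -> Q (offset l z * offset l x)) <->
  [/\ forall d, distances F L d -> Q ((f z - d) * (f x - d)),
      forall d, distances G L d -> Q ((g z - d) * (g x - d)) &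
      forall d, distances H L d -> Q ((h z - d) * (h x - d))].
Proof.
move=> Ff Gg Hh LE; rewrite (propext (dir_form_lines L z x Q Ff)) (propext (dir_form_lines L z x Q Gg)).
rewrite (propext (dir_form_lines L z x Q Hh)).
split=> [LQ|[FQ GQ HQ] [t a] Lta]; first by split=> a /LQ.
by have /= tE := LE _ Lta; case: tE Lta => ->; [exact: FQ|exact: GQ|exact: HQ].
Qed.

Definition height (z : R * R) : R := z.2.
Definition left_dist (z : R * R) : R := s * z.1 - z.2 / 2.
Definition right_dist (z : R * R) : R := s * z.1 + z.2 / 2.

Lemma dir_form_height e : e * e = 1 -> dir_form (0, e) (fun z => e * height z).
Proof.
move=> ee; split=> //; exists e => // d z.
by rewrite offset_0 mulrBr mulrA ee mul1r.
Qed.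

Lemma dir_form_left : dir_form (pi / 3, -1) left_dist.
Proof.
split; first by rewrite mulrNN mulr1.
exists (-1) => [|d z]; first by rewrite mulrNN mulr1.
by rewrite offset_pi3 /left_dist /=; ring.
Qed.

Lemma dir_form_right : dir_form (2 * pi / 3, -1) right_dist.
Proof.
split; first by rewrite mulrNN mulr1.
exists (-1) => [|d z]; first by rewrite mulrNN mulr1.
by rewrite offset_2pi3 /right_dist /=; ring.
Qed.

Lemma s_neq0 : s != 0. Proof. exact/lt0r_neq0/sin_pi3_gt0. Qed.

Let s0 := s_neq0.


(** The coefficients invert [(f, g)]: here [z.2 = u] and [s * z.1 - z.2 / 2 = v] give
    [z.1 = (u / 2 + v) / s]. [frame02] reverses the height, since its wedge opens to the right below
    the horizontal line. There and here [h = f + g], so a line of the third direction can close the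
    wedge; in [frame12] [h = g - f]. *)
Program Definition frame01 : frame := @Frame (fun z => 1 * height z) left_dist right_dist
  (0, 1) (pi / 3, -1) (2 * pi / 3, -1)
  (1 / (2 * s)) (1 / s) 1 0 1 1 _ _ _ _ _ _ _ _.
Next Obligation. by move=> u v; rewrite /corner_pt /height /=; field. Qed.
Next Obligation. by move=> u v; rewrite /corner_pt /left_dist /=; field; exact: s0. Qed.
Next Obligation.
by case=> x y; rewrite /corner_pt /height /left_dist /=; congr pair; field.
Qed.
Next Obligation. by move=> z; rewrite /left_dist /right_dist /height; field. Qed.
Next Obligation. by rewrite divr_gt0 ?mulr_gt0 ?sin_pi3_gt0. Qed.
Next Obligation. by rewrite divr_gt0 ?sin_pi3_gt0. Qed.
Next Obligation. by rewrite mulr0 sub0r !mul1r oppr_eq0 invr_neq0. Qed.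
Next Obligation.
move=> L z x Q L3; apply: (@lines_dir_form (fun z => 1 * height z)) => //.
- by apply: dir_form_height; rewrite mulr1.
- exact: dir_form_left.
- exact: dir_form_right.
Qed.

Program Definition frame02 : frame := @Frame (fun z => -1 * height z) right_dist left_dist
  (0, -1) (2 * pi / 3, -1) (pi / 3, -1)
  (1 / (2 * s)) (1 / s) (-1) 0 1 1 _ _ _ _ _ _ _ _.
Next Obligation. by move=> u v; rewrite /corner_pt /height /=; field. Qed.
Next Obligation. by move=> u v; rewrite /corner_pt /right_dist /=; field; exact: s0. Qed.
Next Obligation.
by case=> x y; rewrite /corner_pt /height /right_dist /=; congr pair; field.
Qed.
Next Obligation. by move=> z; rewrite /left_dist /right_dist /height; field. Qed.
Next Obligation. by rewrite divr_gt0 ?mulr_gt0 ?sin_pi3_gt0. Qed.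
Next Obligation. by rewrite divr_gt0 ?sin_pi3_gt0. Qed.
Next Obligation. by rewrite mulr0 sub0r mulN1r opprK mul1r invr_neq0. Qed.
Next Obligation.
move=> L z x Q L3; apply: (@lines_dir_form (fun z => -1 * height z)) => //.
- by apply: dir_form_height; rewrite mulrNN mulr1.
- exact: dir_form_right.
- exact: dir_form_left.
- by move=> l /L3[]; [constructor 1|constructor 3|constructor 2].
Qed.

Program Definition frame12 : frame := @Frame left_dist right_dist (fun z => 1 * height z)
  (pi / 3, -1) (2 * pi / 3, -1) (0, 1)
  (1 / (2 * s)) (1 / (2 * s)) (-1) 1 (-1) 1 _ _ _ _ _ _ _ _.
Next Obligation. by move=> u v; rewrite /corner_pt /left_dist /=; field; exact: s0. Qed.
Next Obligation. by move=> u v; rewrite /corner_pt /right_dist /=; field; exact: s0. Qed.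
Next Obligation.
by case=> x y; rewrite /corner_pt /left_dist /right_dist /=; congr pair; field.
Qed.
Next Obligation. by move=> z; rewrite /left_dist /right_dist /height; field. Qed.
Next Obligation. by rewrite divr_gt0 ?mulr_gt0 ?sin_pi3_gt0. Qed.
Next Obligation. by rewrite divr_gt0 ?mulr_gt0 ?sin_pi3_gt0. Qed.
Next Obligation.
rewrite (_ : _ - _ = s^-1); first by rewrite invr_neq0.
by field.
Qed.
Next Obligation.
move=> L z x Q L3; apply: (@lines_dir_form _ _ (fun z => 1 * height z)) => //.
- exact: dir_form_left.
- exact: dir_form_right.
- by apply: dir_form_height; rewrite mulr1.
- by move=> l /L3[]; [constructor 3|constructor 1|constructor 2].
Qed.

Definition good L := [/\ three_directions L, spread (distances (0, 1) L),
  spread (distances (pi / 3, -1) L) & spread (distances (2 * pi / 3, -1) L)].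

Definition frames := [:: frame01; frame02; frame12].

Lemma good_frame L k : good L -> List.In k frames ->
  [/\ spread (distances (fr_F k) L), spread (distances (fr_G k) L) &
      spread (distances (fr_H k) L)].
Proof.
move=> [_ s1 s2 s3] [<-|[<-|[<-|[]]]] //; split => //=.
have -> : distances (0, -1) L = [set x | distances (0, 1) L (- x)].
  by apply/seteqP; split=> x; rewrite /distances /= !mul1r ?mulN1r.
exact: spreadN.
Qed.

(** The point [x] lies in a gap of each direction. The lines [left_dist = a1] and [right_dist = a2]
    bound the cell on the left and cross at height [a2 - a1]. If this height is in []a0, b0[], the
    crossing is the corner; if it is too low or too high, the corner is where the bottom line meets
    the first of them, or the top line the second. *)
Lemma cells_fr_cell L c : good L -> cells L c ->
  exists k u v, [/\ List.In k frames, distances (fr_F k) L u, distances (fr_G k) L v &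
    c = fr_cell k L u v].
Proof.
move=> [L3 S0 S1 S2] /cellsP [x xL cE].
have [a0 [b0 [Da0 Db0 a0x xb0 ab0]]] := spread_gap (1 * height x) S0.
have [a1 [b1 [Da1 Db1 a1x xb1 ab1]]] := spread_gap (left_dist x) S1.
have [a2 [b2 [Da2 Db2 a2x xb2 ab2]]] := spread_gap (right_dist x) S2.
have [N0 N1 N2] : [/\ forall d, distances (0, 1) L d -> 1 * height x != d,
   forall d, distances (pi / 3, -1) L d -> left_dist x != d &
   forall d, distances (2 * pi / 3, -1) L d -> right_dist x != d].
  have : forall l, L l -> offset l x * offset l x != 0.
    by move=> l /xL; rewrite mulf_eq0 orbb.
  move=> /(fr_lines frame01 x x (fun y => y != 0) L3)[/= H0 H1 H2].
  by split=> d; [move=> /H0|move=> /H1|move=> /H2];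
    rewrite mulf_eq0 orbb subr_eq0.
have {}a0x : a0 < 1 * height x by rewrite lt_neqAle a0x andbT eq_sym N0.
have {}a1x : a1 < left_dist x by rewrite lt_neqAle a1x andbT eq_sym N1.
have {}a2x : a2 < right_dist x by rewrite lt_neqAle a2x andbT eq_sym N2.
have hlr : right_dist x = 1 * height x + left_dist x.
  by rewrite /right_dist /left_dist /height; lra.
have [t0|t0] := leP (a2 - a1) a0.
  exists frame01, a0, a1; split => //; first by left.
  rewrite cE; apply: (csameside_corner (fun z x Q => fr_lines frame01 z x Q L3) _ _ _ _ _ _ _).2 => //=.
  - by move=> d /ab0[]; lra.
  - by move=> d /ab1[]; lra.
  - by move=> d /ab2 ?; split; lra.
have [t1|t1] := ltP (a2 - a1) b0.
  exists frame12, a1, a2; split => //; first by right; right; left.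
  rewrite cE; apply: (csameside_corner (fun z x Q => fr_lines frame12 z x Q L3) _ _ _ _ _ _ _).2 => //=.
  - by move=> d /ab1[]; lra.
  - by move=> d /ab2[]; lra.
  - by move=> d /ab0 ?; split; lra.
have Nb0 : distances (0, -1) L (- b0) by move: Db0; rewrite /distances /= mul1r mulN1r opprK.
exists frame02, (- b0), a2; split => //; first by right; left.
rewrite cE; apply: (csameside_corner (fun z x Q => fr_lines frame02 z x Q L3) _ _ _ _ _ _ _).2 => //=.
- by lra.
- move=> d Dd; have Dd' : distances (0, 1) L (- d).
    by move: Dd; rewrite /distances /= mul1r mulN1r.
  by case: (ab0 _ Dd'); lra.
- by move=> d /ab2[]; lra.
- by move=> d /ab1 ?; split; lra.
Qed.

End Frames.

(** * Counting cells *)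

Section Counting.
Context {R : realType} {T : choiceType}.
Implicit Types A B : set T.

Lemma counting_ge_size (s : seq T) A : uniq s -> (forall x, x \in s -> A x) ->
  ((size s)%:R%:E <= counting A :> \bar R)%E.
Proof.
move=> us sA; rewrite /counting; case: asboolP => [fA|_]; last exact: leey.
rewrite lee_fin ler_nat; apply: uniq_leq_size => // x /sA Ax.
by rewrite -[_ \in _]/(x \in fset_set A) in_fset_set //; exact: mem_set.
Qed.

Lemma counting_le_size (s : seq T) A : (forall x, A x -> x \in s) ->
  (counting A <= (size s)%:R%:E :> \bar R)%E.
Proof.
move=> As; have fA : finite_set A by apply: sub_finite_set (finite_seq s) => x /As.
rewrite /counting asboolT // lee_fin ler_nat; apply: uniq_leq_size => [|x].
  exact: fset_uniq.
by rewrite -[_ \in _]/(x \in fset_set A) in_fset_set // => /set_mem /As.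
Qed.

Lemma counting_le A B : A `<=` B -> (counting A <= counting B :> \bar R)%E.
Proof.
move=> AB; rewrite /counting; case: (asboolP (finite_set B)) => [fB|_]; last exact: leey.
have fA := sub_finite_set AB fB.
by rewrite asboolT // lee_fin ler_nat; apply: fsubset_leq_card; rewrite -fset_set_sub.
Qed.

Lemma counting_ge0 A : (0 <= counting A :> \bar R)%E.
Proof. by rewrite /counting; case: asboolP => // _; exact: leey. Qed.

Lemma counting_setU_le A B : (counting (A `|` B) <= counting A + counting B :> \bar R)%E.
Proof.
rewrite /counting; case: (asboolP (finite_set A)) => [fA|_]; last first.
  by rewrite addye ?leey // gt_eqF // (lt_le_trans _ (counting_ge0 B)) // ltNy0.
case: (asboolP (finite_set B)) => [fB|_]; last by rewrite addey ?leey.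
rewrite asboolT; last by rewrite finite_setU.
rewrite -EFinD -natrD lee_fin ler_nat fset_setU // cardfsU.
exact: leq_subr.
Qed.

Lemma counting_le_sum (I : Type) (r : seq I) A (B : I -> set T) :
  (forall x, A x -> exists2 i, List.In i r & B i x) ->
  (counting A <= \sum_(i <- r) counting (B i) :> \bar R)%E.
Proof.
elim: r A => [|i r IH] A AB.
  rewrite big_nil /counting (_ : A = set0) ?asboolT ?fset_set0 //.
  by rewrite -subset0 => x /AB[].
rewrite big_cons; apply: (@le_trans _ _ (counting (B i) + counting (A `\` B i))%E).
  apply: le_trans (counting_setU_le _ _); apply: counting_le => x Ax.
  by have [|] := pselect (B i x); [left|right].
apply: leeD => //; apply: IH => x [/AB[j [<-//|jr Bj] _]].
by exists j.
Qed.

Lemma counting_image_le (U V : choiceType) (B : set U) (C : set V) (c : U * V -> T) A :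
  finite_set B -> finite_set C -> A `<=` c @` (B `*` C) ->
  (counting A <= counting B * counting C :> \bar R)%E.
Proof.
move=> fB fC AE; rewrite {2 3}/counting !asboolT // -EFinM -natrM.
rewrite -(size_allpairs (fun x y => c (x, y))).
apply: counting_le_size => x /AE[[y z] /= [By Cz] <-].
apply/allpairsP; exists (y, z); split => //.
  by rewrite -[_ \in _]/(y \in fset_set B) in_fset_set //; exact: mem_set.
by rewrite -[_ \in _]/(z \in fset_set C) in_fset_set //; exact: mem_set.
Qed.

End Counting.

(** * Lower bounds: boxes containing the leftmost vertex of a cell *)

Section Boxes.
Context {R : realType}.
Implicit Types (L : set (R * R)) (A : set (set (R * R))) (k : @frame R).

Lemma lexmin_unique (c : set (R * R)) m m' :
  lexmin_vertex c m -> lexmin_vertex c m' -> m = m'.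
Proof.
move=> [vm mmin] [vm' m'min].
have := mmin _ vm'; have := m'min _ vm.
case: m m' {vm vm' mmin m'min} => [a b] [a' b']; rewrite /lex_le /=.
move=> /orP[a'a|/andP[/eqP -> b'b]] /orP[aa'|/andP[/eqP aa' bb']].
- by have := lt_trans a'a aa'; rewrite ltxx.
- by rewrite aa' ltxx in a'a.
- by rewrite ltxx in aa'.
- by congr pair; apply/eqP; rewrite eq_le b'b bb'.
Qed.

Definition unit_square (m : R * R) := 0 <= m.1 <= 1 /\ 0 <= m.2 <= 1.

(** Keeping off the third direction makes crossings of different frames distinct, and is what
    [cells_corner] requires. *)
Definition generic_corner k L (m : R * R) := [/\ distances (fr_F k) L (fr_f k m),
  distances (fr_G k) L (fr_g k m) & ~ distances (fr_H k) L (fr_h k m)].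

Definition in_box (e : R) (b : R * R) (u v : R) := b.1 <= u < b.1 + e /\ b.2 <= v < b.2 + e.

Definition corner_box k L A (e : R) (b : R * R) := exists m,
  [/\ in_box e b (fr_f k m) (fr_g k m), generic_corner k L m, unit_square m &
      A [set z - m | z in fr_cell k L (fr_f k m) (fr_g k m)]].

Definition separated_boxes (e : R) (bs : seq (R * R)) := uniq bs /\
  forall b b', b \in bs -> b' \in bs ->
  forall u v, in_box e b u v -> in_box e b' u v -> b = b'.

Lemma fr_cell_lexmin k L m :
  lexmin_vertex (fr_cell k L (fr_f k m) (fr_g k m)) m.
Proof.
have := corner_cell_lexmin (distances (fr_F k) L) (distances (fr_G k) L)
  (distances (fr_H k) L) (@fr_f_pt _ k) (@fr_g_pt _ k) (@fr_pt_fg _ k)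
  (@fr_hE _ k) (fr_rho_gt0 k) (fr_tau_gt0 k) (fr_f k m) (fr_g k m).
by rewrite -[corner_pt _ _ _ _ _ _]/(fr_pt k _ _) fr_pt_fg.
Qed.

(** One cell is chosen for each box with a suitable corner. A cell determines its leftmost vertex
    and separated boxes share no point, so distinct boxes give distinct cells. *)
Lemma marked_boxes k L A e bs : good L -> List.In k frames -> separated_boxes e bs ->
  exists s, [/\ size s = size [seq b <- bs | `[< corner_box k L A e b >]], uniq s &
    forall c, c \in s -> marked_cells L A c /\
      exists2 m, lexmin_vertex c m & generic_corner k L m].
Proof.
move=> gL kf [ubs sep].
have [sF sG sH] := good_frame gL kf.
have [L3 _ _ _] := gL.
pose P b c := corner_box k L A e b -> marked_cells L A c /\
   exists m, [/\ lexmin_vertex c m, generic_corner k L m & in_box e b (fr_f k m) (fr_g k m)].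
have /choice[c cP] : forall b, exists c, P b c.
  move=> b; have [[m [bm gm um Am]]|nb] := pselect (corner_box k L A e b); last first.
    by exists set0 => /nb.
  exists (fr_cell k L (fr_f k m) (fr_g k m)) => _; have lm := fr_cell_lexmin k L m.
  have [Fm Gm Hm] := gm; split; last by exists m.
  split; last by exists m; have [um1 um2] := um.
  apply: (cells_corner (@fr_f_pt _ k) (@fr_g_pt _ k) (@fr_hE _ k)) => //.
    by move=> z x Q; exact: fr_lines.
  by rewrite -fr_hE.
exists [seq c b | b <- bs & `[< corner_box k L A e b >]]; split.
- by rewrite size_map.
- rewrite map_inj_in_uniq ?filter_uniq // => b b'.
  rewrite !mem_filter => /andP[/asboolP /cP[_ [m [lm gm bm]]] bbs].
  move=> /andP[/asboolP /cP[_ [m' [lm' gm' bm']]] b'bs] cc'.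
  rewrite cc' in lm; have E := lexmin_unique lm lm'; subst m'.
  exact: sep bm bm'.
- move=> _ /mapP[b + ->]; rewrite mem_filter => /andP[/asboolP /cP[mc [m [lm gm _]]] _].
  by split => //; exists m.
Qed.

(** No cell is counted for two frames: a generic corner lies on lines of exactly two directions, and
    these identify the frame. *)
Lemma counting_boxes L A e b0 b1 b2 : good L ->
  separated_boxes e b0 -> separated_boxes e b1 -> separated_boxes e b2 ->
  ((size [seq b <- b0 | `[< corner_box frame01 L A e b >]] +
    size [seq b <- b1 | `[< corner_box frame02 L A e b >]] +
    size [seq b <- b2 | `[< corner_box frame12 L A e b >]])%:R%:E <=
   counting (marked_cells L A) :> \bar R)%E.
Proof.
move=> gL sb0 sb1 sb2.
have [|s0 [<- us0 s0P]] := @marked_boxes frame01 L A e b0 gL _ sb0; first by left.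
have [|s1 [<- us1 s1P]] := @marked_boxes frame02 L A e b1 gL _ sb1; first by right; left.
have [|s2 [<- us2 s2P]] := @marked_boxes frame12 L A e b2 gL _ sb2.
  by right; right; left.
rewrite -!size_cat; apply: counting_ge_size.
  rewrite !cat_uniq us0 us1 us2 /= !andbT; apply/andP; split; apply/hasPn => c.
    move=> /s1P[_ [m lm [_ G _]]]; apply/negP => /s0P[_ [m' lm' [_ _ H]]].
    by rewrite (lexmin_unique lm lm') in G.
  move=> /s2P[_ [m lm [F G _]]]; rewrite mem_cat; apply/norP; split; apply/negP.
    by move=> /s0P[_ [m' lm' [_ _ H]]]; rewrite (lexmin_unique lm lm') in G.
  by move=> /s1P[_ [m' lm' [_ _ H]]]; rewrite (lexmin_unique lm lm') in F.
by move=> c; rewrite !mem_cat -orbA => /or3P[/s0P[]|/s1P[]|/s2P[]].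
Qed.

Definition hit (dir : R * R) (lo hi : R) L := exists2 d, distances dir L d & lo <= d < hi.

Lemma fr_corner k L e b u v : in_box e b u v -> distances (fr_F k) L u ->
  distances (fr_G k) L v -> ~ distances (fr_H k) L (fr_lam k * u + fr_mu k * v) ->
  let m := fr_pt k u v in
  [/\ fr_f k m = u, fr_g k m = v, in_box e b (fr_f k m) (fr_g k m) & generic_corner k L m].
Proof.
move=> b12 Fu Gv nH m; rewrite /m /generic_corner fr_hE fr_f_pt fr_g_pt.
by split.
Qed.

Lemma triangle_box k L e b (l : nat) : good L -> List.In k frames ->
  fr_lam k = 1 -> fr_mu k = 1 -> 0 < e ->
  (forall u v, in_box e b u v -> unit_square (fr_pt k u v)) ->
  hit (fr_F k) b.1 (b.1 + e) L -> hit (fr_G k) b.2 (b.2 + e) L ->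
  hit (fr_H k) (b.1 + b.2 + l.+2%:R * e) (b.1 + b.2 + l.+3%:R * e) L ->
  ~ hit (fr_F k) (b.1 + e) (b.1 + l.+4%:R * e) L ->
  ~ hit (fr_G k) (b.2 + e) (b.2 + l.+4%:R * e) L ->
  ~ hit (fr_H k) (b.1 + b.2) (b.1 + b.2 + l.+2%:R * e) L ->
  corner_box k L (@triangle R) e b.
Proof.
move=> gL kf lk mk e0 sq; case: b sq => x y /= sq.
rewrite -!natr1.
move=> [u0 Fu0 /andP[xu0 u0x]] [v0 Gv0 /andP[yv0 v0y]] [c Hc /andP[c1 c2]] nF nG nH.
have [sF sG sH] := good_frame gL kf.
(* The box may be hit several times. Taking the last lines of [F] and [G] in it puts all later ones
   beyond the box, where the emptiness hypotheses apply. *)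
have [u [Fu ux umax]] := spread_prev (x + e) sF.
have [v [Gv vy vmax]] := spread_prev (y + e) sG.
have xu : x <= u by apply: le_trans xu0 _; exact: umax.
have yv : y <= v by apply: le_trans yv0 _; exact: vmax.
have le0 : 0 <= l%:R * e by rewrite mulr_ge0 // ltW.
have nHuv : ~ distances (fr_H k) L (fr_lam k * u + fr_mu k * v).
  rewrite lk mk !mul1r => Huv; apply: nH; exists (u + v) => //; lra.
have [t [Ht uvt tmin]] := spread_next (u + v) sH.
have bb : in_box e (x, y) u v by split; apply/andP; split.
have [fE gE bm gm] := fr_corner bb Fu Gv nHuv.
exists (fr_pt k u v); split => //; first exact: sq.
have tc : t <= c by apply: tmin => //; lra.
rewrite fE gE; apply: triangle_translate.
apply: (corner_triangle (@fr_f_pt _ k) (@fr_g_pt _ k) (@fr_pt_fg _ k) (@fr_hE _ k)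
  (fr_det_neq0 k) lk mk Ht uvt tmin).
- move=> d Fd ud; have xd : x + e <= d.
    by rewrite leNgt; apply/negP => /(umax _ Fd); rewrite leNgt ud.
  rewrite leNgt; apply/negP => dt; apply: nF; exists d => //; lra.
- move=> d Gd vd; have yd : y + e <= d.
    by rewrite leNgt; apply/negP => /(vmax _ Gd); rewrite leNgt vd.
  rewrite leNgt; apply/negP => dt; apply: nG; exists d => //; lra.
Qed.

Lemma triangle_untranslate (c : set (R * R)) m :
  triangle [set z - m | z in c] -> triangle c.
Proof.
move=> /(triangle_translate m); congr triangle; apply/seteqP; split=> z.
  by move=> [_ [y cy <-] <-]; rewrite subrK.
by move=> cz; exists (z - m); rewrite ?subrK //; exists z.
Qed.

Lemma nontriangle_box_F k L e b (l : nat) : good L -> List.In k frames ->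
  fr_lam k = 1 -> fr_mu k = 1 -> 0 < e ->
  (forall u v, in_box e b u v -> unit_square (fr_pt k u v)) ->
  hit (fr_F k) b.1 (b.1 + e) L -> hit (fr_G k) b.2 (b.2 + e) L ->
  hit (fr_F k) (b.1 + l.+1%:R * e) (b.1 + l.+2%:R * e) L ->
  ~ hit (fr_H k) (b.1 + b.2) (b.1 + b.2 + l.+4%:R * e) L ->
  corner_box k L (~` @triangle R) e b.
Proof.
move=> gL kf lk mk e0 sq; case: b sq => x y /= sq.
rewrite -!natr1.
move=> [u Fu /andP[xu ux]] [v Gv /andP[yv vy]] [c Fc /andP[c1 c2]] nH.
have [sF sG sH] := good_frame gL kf.
have le0 : 0 <= l%:R * e by rewrite mulr_ge0 // ltW.
have nHuv : ~ distances (fr_H k) L (fr_lam k * u + fr_mu k * v).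
  rewrite lk mk !mul1r => Huv; apply: nH; exists (u + v) => //; lra.
have bb : in_box e (x, y) u v by split; apply/andP; split.
have [fE gE bm gm] := fr_corner bb Fu Gv nHuv.
exists (fr_pt k u v); split => //; first exact: sq.
rewrite fE gE => /triangle_untranslate.
apply: (corner_not_triangle_add (@fr_f_pt _ k) (@fr_g_pt _ k) (@fr_pt_fg _ k)
  (@fr_hE _ k) (fr_rho_gt0 k) (fr_tau_gt0 k) sF sG sH lk mk Fc); first by lra.
move=> d Hd uvd; rewrite ltNge; apply/negP => dc; apply: nH; exists d => //; lra.
Qed.

Lemma nontriangle_box_G k L e b (l : nat) : good L -> List.In k frames ->
  fr_lam k = 1 -> fr_mu k = 1 -> 0 < e ->
  (forall u v, in_box e b u v -> unit_square (fr_pt k u v)) ->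
  hit (fr_F k) b.1 (b.1 + e) L -> hit (fr_G k) b.2 (b.2 + e) L ->
  hit (fr_G k) (b.2 + l.+1%:R * e) (b.2 + l.+2%:R * e) L ->
  ~ hit (fr_H k) (b.1 + b.2) (b.1 + b.2 + l.+4%:R * e) L ->
  corner_box k L (~` @triangle R) e b.
Proof.
move=> gL kf lk mk e0 sq; case: b sq => x y /= sq.
rewrite -!natr1.
move=> [u Fu /andP[xu ux]] [v Gv /andP[yv vy]] [c Gc /andP[c1 c2]] nH.
have [sF sG sH] := good_frame gL kf.
have le0 : 0 <= l%:R * e by rewrite mulr_ge0 // ltW.
have nHuv : ~ distances (fr_H k) L (fr_lam k * u + fr_mu k * v).
  rewrite lk mk !mul1r => Huv; apply: nH; exists (u + v) => //; lra.
have bb : in_box e (x, y) u v by split; apply/andP; split.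
have [fE gE bm gm] := fr_corner bb Fu Gv nHuv.
exists (fr_pt k u v); split => //; first exact: sq.
rewrite fE gE => /triangle_untranslate.
(* Exchanging [f] and [g] reduces the claim to the case where [F] is hit first. *)
have swap : fr_cell k L u v = corner_cell (fr_g k) (fr_f k) (fr_h k)
    (distances (fr_G k) L) (distances (fr_F k) L) (distances (fr_H k) L)
    (fr_mu k) (fr_lam k) v u.
  by apply/seteqP; split=> z [? ? ? ? Hz]; split => //; move: Hz; rewrite addrC.
have ptE a a' : corner_pt (fr_tau k) (fr_rho k) (fr_tau' k) (fr_rho' k) a a' =
    fr_pt k a' a by rewrite /fr_pt /corner_pt; congr pair; rewrite addrC.
rewrite swap; apply: (@corner_not_triangle_add _ _ _ _ _ _ _
  (fr_tau k) (fr_rho k) (fr_tau' k) (fr_rho' k) _ _ _ _ _ _ _ _ sG sF sH _ _ c) => //.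
- by move=> a a'; rewrite ptE fr_g_pt.
- by move=> a a'; rewrite ptE fr_f_pt.
- by move=> z; rewrite ptE fr_pt_fg.
- by move=> z; rewrite fr_hE addrC.
- exact: fr_tau_gt0.
- exact: fr_rho_gt0.
- by lra.
move=> d Hd uvd; rewrite ltNge; apply/negP => dc; apply: nH; exists d => //; lra.
Qed.

(** On the box [v - u] stays strictly within [e] of [b.2 - b.1], so the empty strip of [H] makes the
    crossing generic, as [corner_not_triangle_sub] demands. *)
Lemma nontriangle_box_sub k L e b : good L -> List.In k frames ->
  fr_lam k = -1 -> fr_mu k = 1 -> 0 < e ->
  (forall u v, in_box e b u v -> unit_square (fr_pt k u v)) ->
  hit (fr_F k) b.1 (b.1 + e) L -> hit (fr_G k) b.2 (b.2 + e) L ->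
  ~ hit (fr_H k) (b.2 - b.1 - e) (b.2 - b.1 + e) L ->
  corner_box k L (~` @triangle R) e b.
Proof.
move=> gL kf lk mk e0 sq; case: b sq => x y /= sq.
move=> [u Fu /andP[xu ux]] [v Gv /andP[yv vy]] nH.
have [sF sG sH] := good_frame gL kf.
have nHuv' : ~ distances (fr_H k) L (v - u).
  move=> Huv; apply: nH; exists (v - u) => //; lra.
have nHuv : ~ distances (fr_H k) L (fr_lam k * u + fr_mu k * v).
  by rewrite lk mk mul1r mulN1r addrC.
have bb : in_box e (x, y) u v by split; apply/andP; split.
have [fE gE bm gm] := fr_corner bb Fu Gv nHuv.
exists (fr_pt k u v); split => //; first exact: sq.
rewrite fE gE => /triangle_untranslate.
exact: (corner_not_triangle_sub (@fr_f_pt _ k) (@fr_g_pt _ k) (@fr_pt_fg _ k)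
  (@fr_hE _ k) (fr_rho_gt0 k) (fr_tau_gt0 k) sF sG sH lk mk nHuv').
Qed.

End Boxes.

(** * Upper bound: pairs of lines crossing in the unit square *)

Section Rectangles.
Context {R : realType}.
Implicit Types (L : set (R * R)) (A : set (set (R * R))) (k : @frame R).

Definition rect (dir : R * R) (lo hi : R) : set (R * R) :=
  [set l | l.1 = dir.1 /\ lo <= dir.2 * l.2 < hi].

Lemma hitE dir lo hi L : dir.2 * dir.2 = 1 ->
  hit dir lo hi L <-> L `&` rect dir lo hi !=set0.
Proof.
move=> dd; split=> [[x Lx xlh]|[[t y] [Lty [/= tE ylh]]]].
  by exists (dir.1, dir.2 * x); split => //; split => //=; rewrite mulrA dd mul1r.
by exists (dir.2 * y); rewrite // /distances /= mulrA dd mul1r -tE.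
Qed.

Lemma finite_rect dir lo hi L : dir.2 * dir.2 = 1 ->
  (forall N : nat, finite_set (distances dir L `&` `[- N%:R, N%:R])) ->
  finite_set (L `&` rect dir lo hi).
Proof.
move=> dd fL.
pose N := (maxn (Num.truncn `|lo|) (Num.truncn `|hi|)).+1.
have loN : `|lo| <= N%:R.
  by apply/ltW/(lt_le_trans (truncnS_gt _)); rewrite ler_nat ltnS leq_maxl.
have hiN : `|hi| <= N%:R.
  by apply/ltW/(lt_le_trans (truncnS_gt _)); rewrite ler_nat ltnS leq_maxr.
apply: sub_finite_set (finite_image (fun x => (dir.1, dir.2 * x)) (fL N)).
move=> [t y] [Lty [/= tE /andP[loy yhi]]]; exists (dir.2 * y); last first.
  by rewrite mulrA dd mul1r -tE.
split; first by rewrite /distances /= mulrA dd mul1r -tE.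
by move: loN hiN; rewrite !ler_norml /= in_itv /=; lra.
Qed.

Lemma fr_dir_unit k : List.In k frames ->
  [/\ (fr_F k).2 * (fr_F k).2 = 1, (fr_G k).2 * (fr_G k).2 = 1 &
      (fr_H k).2 * (fr_H k).2 = 1].
Proof. by case=> [<-|[<-|[<-|[]]]]; split; rewrite /= ?mulr1 ?mulrNN ?mulr1. Qed.

(** A marked cell is the image of a pair of lines, of directions [F] and [G] of some frame, whose
    crossing lies in the unit square and hence in a covering rectangle. Pairs counted twice only
    increase the bound. *)
Lemma marked_cells_le L A (rs : frame -> seq ((R * R) * (R * R))) : good L ->
  (forall k, List.In k frames -> forall u v, unit_square (fr_pt k u v) ->
    exists2 r, List.In r (rs k) &
      r.1.1 <= u < r.1.2 /\ r.2.1 <= v < r.2.2) ->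
  (counting (marked_cells L A) <= \sum_(k <- frames) \sum_(r <- rs k)
     counting (L `&` rect (fr_F k) r.1.1 r.1.2) *
     counting (L `&` rect (fr_G k) r.2.1 r.2.2) :> \bar R)%E.
Proof.
move=> gL cov.
pose B k (r : (R * R) * (R * R)) := (fun ll : (R * R) * (R * R) =>
  fr_cell k L ((fr_F k).2 * ll.1.2) ((fr_G k).2 * ll.2.2)) @`
  ((L `&` rect (fr_F k) r.1.1 r.1.2) `*` (L `&` rect (fr_G k) r.2.1 r.2.2)).
pose C k := [set c | List.In k frames /\ exists2 r, List.In r (rs k) & B k r c].
apply: le_trans (counting_le_sum (r := frames) (B := C) _) _.
  move=> c [/(cells_fr_cell gL)[k [u [v [kf Fu Gv cE]]]] [m [cm m1 m2 _]]].
  have [dF dG _] := fr_dir_unit kf.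
  exists k => //; split => //.
  have mE : m = fr_pt k u v.
    apply: (lexmin_unique cm); rewrite cE.
    by have := fr_cell_lexmin k L (fr_pt k u v); rewrite fr_f_pt fr_g_pt.
  have um : unit_square (fr_pt k u v) by rewrite -mE; split.
  have [r rk [ru rv]] := cov _ kf u v um.
  exists r => //; exists (((fr_F k).1, (fr_F k).2 * u), ((fr_G k).1, (fr_G k).2 * v)).
    by split; split => //; split => //=; rewrite mulrA ?dF ?dG mul1r.
  by rewrite /= !mulrA dF dG !mul1r.
apply: lee_sum => k _.
have [kf|nkf] := pselect (List.In k frames); last first.
  rewrite /counting [C k](_ : _ = set0) ?asboolT ?fset_set0 //.
    by rewrite sume_ge0 // => r _; rewrite mule_ge0 // counting_ge0.
  by rewrite -subset0 => c [].
apply: (le_trans (counting_le_sum (r := rs k) (B := B k) _)); first by move=> c [].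
have [dF dG _] := fr_dir_unit kf.
have [[sF _] [sG _] _] := good_frame gL kf.
apply: lee_sum => r _; apply: (counting_image_le _ _ (@subset_refl _ _)).
  exact: finite_rect.
exact: finite_rect.
Qed.

End Rectangles.

(** * The Poisson process *)

Section LowerIntegral.
Context d (T : measurableType d) (R : realType) (P : {measure set T -> \bar R}).
Implicit Types f g k : T -> \bar R.
Import HBNNSimple.
Local Open Scope ereal_scope.

Lemma le_lower_integral f g : (forall x, 0 <= f x) -> (forall x, f x <= g x) ->
  \int[P]_x f x <= \int[P]_x g x.
Proof.
move=> f0 fg; have g0 x : 0 <= g x by exact: le_trans (fg x).
rewrite !ge0_integralTE //; apply: ereal_sup_le => _ [h hf <-].
by exists h => // x; exact: le_trans (fg x).
Qed.

(** The exceptional null set can be removed from the integral of [f], which is measurable; after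
    that the comparison is pointwise. *)
Lemma ae_le_lower_integral f g : measurable_fun setT f -> (forall x, 0 <= f x) ->
  (forall x, 0 <= g x) -> (\forall x \ae P, f x <= g x) ->
  \int[P]_x f x <= \int[P]_x g x.
Proof.
move=> mf f0 g0 [N [mN N0 fgN]].
rewrite (ge0_negligible_integral _ _ _ _ N0) // setTD integral_mkcond.
apply: le_lower_integral => x; first exact: erestrict_ge0.
rewrite patchE; case: ifPn => // /set_mem Nx.
by rewrite leNgt; apply/negP => gf; apply/Nx/fgN => /=; apply/negP; rewrite -ltNge.
Qed.

(** For each simple [h <= f] one has [k + h <= g] almost everywhere, between measurable functions;
    the supremum over [h] gives the claim. The case of an infinite right-hand side is set aside so
    that the integral of [k] can be subtracted. *)
Lemma ae_lower_integralD_le f g k : measurable_fun setT k -> measurable_fun setT g ->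
  (forall x, 0 <= k x) -> (forall x, 0 <= f x) -> (forall x, 0 <= g x) ->
  (\forall x \ae P, k x + f x <= g x) ->
  \int[P]_x k x + \int[P]_x f x <= \int[P]_x g x.
Proof.
move=> mk mg k0 f0 g0 kfg.
have kg : \int[P]_x k x <= \int[P]_x g x.
  apply: ae_ge0_le_integral => //; apply: filterS kfg => x kfgx _.
  by apply: le_trans kfgx; rewrite leeDl.
have [->|/eqP goo] := eqVneq (\int[P]_x g x) +oo; first exact: leey.
have kfin : \int[P]_x k x \is a fin_num.
  rewrite ge0_fin_numE ?integral_ge0 //; apply: (le_lt_trans kg).
  by rewrite lt_neqAle leey andbT; apply/eqP.
rewrite -leeBrDl // [leLHS]ge0_integralTE //; apply: ge_ereal_sup => _ [h hf <-].
rewrite leeBrDl // -integralT_nnsfun -ge0_integralD //; last 2 first.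
- by move=> x _; rewrite lee_fin.
- exact/measurable_EFinP.
apply: ae_ge0_le_integral => //.
- by move=> x _; rewrite adde_ge0 // lee_fin.
- by apply: emeasurable_funD => //; exact/measurable_EFinP.
apply: filterS kfg => x kfgx _.
by apply: le_trans kfgx; rewrite leeD2l.
Qed.

End LowerIntegral.

Section PoissonLaw.
Context {R : realType}.

Lemma series_exp_coeff_le (x : R) n : 0 <= x -> \sum_(k < n) exp_coeff x k <= expR x.
Proof.
move=> x0; have := @nondecreasing_cvgn_le R (series (exp_coeff x)).
move=> /(_ _ (is_cvg_series_exp_coeff x) n); rewrite /series /= big_mkord; apply.
by apply: nondecreasing_series => k _ _; exact: exp_coeff_ge0.
Qed.

Lemma poisson_mass (x : R) : 0 <= x ->
  (\sum_(k <oo) (x ^+ k / k`!%:R * expR (- x))%:E = 1)%E.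
Proof.
move=> x0; rewrite [RHS](_ : _ = (expR (- x))%:E * (expR x)%:E)%E; last first.
  by rewrite -EFinM expRN mulVf ?gt_eqF ?expR_gt0.
under eq_eseriesr do rewrite EFinM muleC.
rewrite nneseriesZl /=; last by move=> n _; rewrite lee_fin exp_coeff_ge0.
congr *%E; rewrite /expR -EFin_lim; last exact: is_cvg_series_exp_coeff.
by apply/congr_lim/funext => n /=; rewrite /series /= -sumEFin.
Qed.

Lemma poisson_mean_le (x : R) : 0 <= x ->
  (\sum_(k <oo) (k%:R * (x ^+ k / k`!%:R * expR (- x)))%:E <= x%:E)%E.
Proof.
move=> x0; apply: lime_le.
  apply: is_cvg_nneseries => n _ _; rewrite lee_fin !mulr_ge0 ?expR_ge0 //.
  by rewrite exprn_ge0.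
apply: nearW => -[|n]; first by rewrite big_nil lee_fin.
rewrite sumEFin lee_fin big_mkord big_ord_recl mul0r add0r.
have E k : k.+1%:R * (x ^+ k.+1 / k.+1`!%:R * expR (- x)) = x * expR (- x) * exp_coeff x k.
  rewrite /exp_coeff /= factS natrM exprS.
  have k0 : k.+1%:R != 0 :> R by [].
  have f0 : k`!%:R != 0 :> R by rewrite pnatr_eq0 -lt0n fact_gt0.
  by field; rewrite f0 /=.
under eq_bigr do rewrite E.
rewrite -mulr_sumr -[leRHS](_ : x * expR (- x) * expR x = x).
  by rewrite ler_wpM2l ?mulr_ge0 ?expR_ge0 // series_exp_coeff_le.
by rewrite -mulrA expRN mulVf ?mulr1 // gt_eqF ?expR_gt0.
Qed.

End PoissonLaw.

Section Process.
Context {R : realType} {dT : measure_display} {T : measurableType dT}.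
Context (P : probability T R) (p q : R) (pq : admissible p q) (X : T -> set (R * R)).
Hypothesis hX : poisson_line_process P 1%:pos (G3 pq) X.

Local Notation Lambda := (line_intensity 1%:pos (G3 pq)).

(** The horizontal direction occurs with both signs because [frame02] measures heights downwards. *)
Definition directions : seq (R * R) :=
  [:: (0, 1); (0, -1); (pi / 3, -1); (2 * pi / 3, -1)].

Definition weight (dir : R * R) : R :=
  if dir.1 == 0 then p else if dir.1 == pi / 3 then q else 1 - p - q.

Lemma weight_gt0 dir : 0 < weight dir.
Proof.
have [/andP[p0 p1] /andP[q0 q1] /andP[_ pq1]] := and3P pq.
by rewrite /weight; case: ifP => // _; case: ifP => // _; lra.
Qed.

Lemma directionsP dir : dir \in directions -> dir.2 = 1 \/ dir.2 = -1.
Proof. by rewrite !inE => /or4P[] /eqP -> /=; [left|right|right|right]. Qed.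

Lemma directions_sqr dir : dir \in directions -> dir.2 * dir.2 = 1.
Proof. by move=> /directionsP[] ->; rewrite ?mulrNN mulr1. Qed.

Lemma G3_direction dir : dir \in directions ->
  G3 pq [set dir.1 : measurableTypeR R] = (weight dir)%:E.
Proof.
have pi0 := pi_gt0 R.
have ind (x y : R) : dirac (x : measurableTypeR R) [set y : measurableTypeR R] = (x == y)%:R%:E :> \bar R.
  rewrite diracE; congr (_%:R%:E); congr nat_of_bool.
  by apply/idP/eqP => [/set_mem //|->]; exact/mem_set.
have n1 : (pi / 3 == 0 :> R) = false by apply/eqP; lra.
have n2 : (2 * pi / 3 == 0 :> R) = false by apply/eqP; lra.
have n3 : (2 * pi / 3 == pi / 3 :> R) = false by apply/eqP; lra.
have n4 : (0 == pi / 3 :> R) = false by rewrite eq_sym.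
have n5 : (0 == 2 * pi / 3 :> R) = false by rewrite eq_sym.
have n6 : (pi / 3 == 2 * pi / 3 :> R) = false by rewrite eq_sym.
rewrite !inE /weight => /or4P[] /eqP -> /=;
  rewrite /G3 !ind !(eqxx, n1, n2, n3, n4, n5, n6) /= -!EFinM -!EFinD; congr EFin; ring.
Qed.

Lemma rectE dir lo hi : dir \in directions ->
  rect dir lo hi = [set dir.1] `*` (if dir.2 == 1 then `[lo, hi[%classic else `]- hi, - lo]%classic).
Proof.
move=> /directionsP dd; apply/seteqP; split=> -[t y]; rewrite /rect /=.
  case: dd => ->; rewrite ?eqxx => -[-> /andP[loy yhi]]; split => //=.
    by rewrite in_itv /=; lra.
  by rewrite (_ : (-1 == 1 :> R) = false) /= ?in_itv /=; [lra|apply/eqP; lra].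
case: dd => ->; rewrite ?eqxx => -[->]; first by rewrite /= in_itv /= mul1r.
rewrite (_ : (-1 == 1 :> R) = false) /= ?in_itv /=; last by apply/eqP; lra.
by move=> ?; split => //; lra.
Qed.

Lemma measurable_rect dir lo hi : dir \in directions ->
  measurable (rect dir lo hi : set (measurableTypeR R * measurableTypeR R)).
Proof.
move=> dd; rewrite rectE //; apply: measurableX; first exact: measurable_set1.
by case: ifP.
Qed.

Lemma intensity_rect dir lo hi : dir \in directions -> lo <= hi ->
  Lambda (rect dir lo hi) = (weight dir * (hi - lo))%:E.
Proof.
move=> dd lohi.
rewrite -[LHS]/(1%:E * (G3 pq \x (@lebesgue_measure R)) (rect dir lo hi))%E mul1e rectE //.
rewrite product_measure1E; [|exact: measurable_set1|by case: ifP].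
rewrite /= G3_direction // EFinM; congr (_ * _)%E.
have [lohi'|hilo] := ltP lo hi.
  by case: ifP => _; rewrite lebesgue_measure_itv /= lte_fin ?ltrN2 lohi' -EFinD;
    congr EFin; lra.
have -> : lo = hi by apply/eqP; rewrite eq_le lohi hilo.
by rewrite subrr; case: ifP => _; rewrite lebesgue_measure_itv /= lte_fin ltxx.
Qed.

Lemma counting_eq0 (U : choiceType) (A : set U) : counting A = 0%E :> \bar R <-> A = set0.
Proof.
split=> [A0|->]; last by rewrite /counting asboolT // fset_set0.
rewrite -subset0 => x Ax.
have := @counting_ge_size R U [:: x] A; rewrite A0 lee_fin lern0 /=.
by case/(_ isT _)/notF => y; rewrite inE => /eqP ->.
Qed.

Lemma npoints_hit dir lo hi w : dir \in directions ->
  npoints X (rect dir lo hi) w = 0%E :> \bar R <-> ~ hit dir lo hi (X w).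
Proof.
move=> dd; rewrite (propext (hitE lo hi (X w) (directions_sqr dd))) /npoints.
rewrite (propext (counting_eq0 _)); split=> [-> [x []] //|nS].
by rewrite -subset0 => x Sx; apply: nS; exists x.
Qed.

Let elt := (((R * R) * (R * R)) * bool)%type.
Implicit Types (pat : seq elt) (e : elt).

Definition pattern pat : set T :=
  [set w | forall e, e \in pat -> if e.2 then hit e.1.1 e.1.2.1 e.1.2.2 (X w)
                                  else ~ hit e.1.1 e.1.2.1 e.1.2.2 (X w)].

(** A Boolean condition that makes two strips disjoint. For equal angles the signs must agree too,
    so that both intervals refer to the same orientation. *)
Definition apart e e' := (e.1.1.1 != e'.1.1.1) ||
  (e.1.1 == e'.1.1) && ((e.1.2.2 <= e'.1.2.1) || (e'.1.2.2 <= e.1.2.1)).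

Definition pattern_weight e : R := let x := weight e.1.1 * (e.1.2.2 - e.1.2.1) in
  if e.2 then 1 - expR (- x) else expR (- x).

Definition valid_pattern pat :=
  all (fun e => (e.1.1 \in directions) && (e.1.2.1 <= e.1.2.2)) pat && pairwise apart pat.

(** The strips are disjoint, so [npoints_independent] applies to the events that a count is zero or
    nonzero, of probabilities [exp (- x)] and [1 - exp (- x)] for a mean [x]. *)
Lemma pattern_probability pat : valid_pattern pat ->
  measurable (pattern pat) /\ P (pattern pat) = (\prod_(e <- pat) pattern_weight e)%:E.
Proof.
move=> /andP[/allP val /(pairwiseP ((0, 0), (0, 0), true)) ap].
set e0 : elt := ((0, 0), (0, 0), true) in ap.
have [_ _ [mN pN _ iN]] := hX.
pose el (i : 'I_(size pat)) := nth e0 pat i.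
have elP i : el i \in pat by rewrite mem_nth.
have dirP i : (el i).1.1 \in directions by case/andP: (val _ (elP i)).
pose B (i : 'I_(size pat)) := rect (el i).1.1 (el i).1.2.1 (el i).1.2.2.
pose A (i : 'I_(size pat)) : set (\bar R) := if (el i).2 then ~` [set 0%E] else [set 0%E].
have mA i : measurable (A i).
  by rewrite /A; case: ifP => _; [apply: measurableC|]; exact: emeasurable_set1.
have mB i : measurable (B i : set (measurableTypeR R * measurableTypeR R)).
  exact: measurable_rect.
have AE i w : A i (npoints X (B i) w) <->
    if (el i).2 then hit (el i).1.1 (el i).1.2.1 (el i).1.2.2 (X w)
    else ~ hit (el i).1.1 (el i).1.2.1 (el i).1.2.2 (X w).
  rewrite /A; case: ifP => _; rewrite /= (propext (npoints_hit _ _ _ (dirP i))) //.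
  by split=> [/contrapT|h] //; exact.
have patE : pattern pat = \bigcap_(i in setT) [set w | A i (npoints X (B i) w)].
  apply/seteqP; split=> w /=.
    by move=> pw i _; apply/AE; apply: pw.
  move=> pw e epat; have ilt : (index e pat < size pat)%N by rewrite index_mem.
  by have /AE := pw (Ordinal ilt) I; rewrite /el /= nth_index.
have mAB i : measurable [set w | A i (npoints X (B i) w)].
  by rewrite -[X in measurable X]setTI; exact: mN.
split; first by rewrite patE; apply: fin_bigcap_measurable => //; exact: finite_finset.
rewrite patE iN //; last first.
  apply/trivIsetP => i j _ _ ij; rewrite -subset0 => l [].
  wlog ltij : i j ij / (i < j)%N.
    move=> H li lj; move: (ij); rewrite neq_ltn => /orP[lt_ij|lt_ji].
      exact: (H i j).
    by apply: (H j i) => //; rewrite eq_sym.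
  have := ap i j (ltn_ord i) (ltn_ord j) ltij; rewrite -/(el i) -/(el j) /apart.
  move=> /orP[dij|/andP[/eqP dij lohi]] [li1 /andP[li2 li3]] [lj1 /andP[lj2 lj3]].
    by move: dij; rewrite -li1 -lj1 eqxx.
  rewrite dij in li2 li3; case/orP: lohi => [/(lt_le_trans li3)|/(lt_le_trans lj3)].
    by rewrite ltNge lj2.
  by rewrite ltNge li2.
rewrite (big_nth e0) big_mkord -prodEFin; apply: eq_bigr => i _.
have /andP[_ lohi] := val _ (elP i).
have L := intensity_rect (dirP i) lohi.
have P0 : P [set w | npoints X (B i) w = 0%E :> \bar R] =
    (expR (- (weight (el i).1.1 * ((el i).1.2.2 - (el i).1.2.1))))%:E.
  have := @pN (B i) 0%N (mB i); rewrite /B L ltry => /(_ isT).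
  by rewrite /= expr0 fact0 divr1 mul1r.
rewrite /pattern_weight -/(el i) /A; case: ifP => _ //.
rewrite -[[set _ | _]]/(~` [set w | npoints X (B i) w = 0%E :> \bar R]).
rewrite probability_setC ?P0 //.
rewrite -[X in measurable X]setTI.
exact: (mN _ (mB i) measurableT _ (emeasurable_set1 _)).
Qed.

Lemma prob1_ae (A : set T) : measurable A -> P A = 1%E -> \forall w \ae P, A w.
Proof.
move=> mA PA; exists (~` A); split => //; first exact: measurableC.
by rewrite probability_setC // PA subee.
Qed.

Lemma measurable_npoints_eq (B : set (measurableTypeR R * measurableTypeR R)) (x : \bar R) :
  measurable B -> measurable [set w | npoints X B w = x].
Proof.
move=> mB; have [_ _ [mN _ _ _]] := hX.
rewrite -[X in measurable X]setTI.
exact: (mN _ mB measurableT _ (emeasurable_set1 _)).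
Qed.

(** A count may be [+oo], but the Poisson probabilities of its finite values already add up to 1. *)
Lemma ae_npoints_nat (B : set (measurableTypeR R * measurableTypeR R)) (x : R) :
  measurable B -> 0 <= x -> Lambda B = x%:E ->
  \forall w \ae P, exists k : nat, npoints X B w = k%:R%:E :> \bar R.
Proof.
move=> mB x0 BE; have [_ _ [_ pN _ _]] := hX.
have mE k := measurable_npoints_eq (k%:R%:E) mB.
have PE k : P [set w | npoints X B w = k%:R%:E :> \bar R] =
    (x ^+ k / k`!%:R * expR (- x))%:E by rewrite pN // BE // ltry.
have : P (\bigcup_k [set w | npoints X B w = k%:R%:E :> \bar R]) = 1%E.
  rewrite measure_bigcup //; last first.
    apply/trivIsetP => i j _ _ ij; rewrite -subset0 => w [/= E1 E2].
    by move: E2; rewrite E1 => -[/eqP]; rewrite eqr_nat (negbTE ij).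
  rewrite -[RHS](poisson_mass x0).
  apply: congr_lim; apply/funext => n; apply: eq_big => k; first by rewrite in_setT.
  by move=> _; exact: PE.
move=> /prob1_ae -/(_ (bigcup_measurable (fun k _ => mE k))).
by apply: filterS => w [k _ kE]; exists k.
Qed.

Lemma ae_infinite (I : set (measurableTypeR R)) dir : dir \in directions -> measurable I ->
  lebesgue_measure I = +oo%E -> \forall w \ae P, exists2 y, I y & X w (dir.1, y).
Proof.
move=> dd mI I_oo; have [_ _ [_ _ iN _]] := hX.
pose B : set (measurableTypeR R * measurableTypeR R) := [set dir.1] `*` I.
have mB : measurable B by apply: measurableX => //; exact: measurable_set1.
have : Lambda B = +oo%E.
  rewrite -[LHS]/(1%:E * (G3 pq \x (@lebesgue_measure R)) B)%E mul1e.
  rewrite product_measure1E ; [|exact: measurable_set1|exact: mI].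
  rewrite [X in (X * _)%E](G3_direction dd) [X in (_ * X)%E]I_oo gt0_muley //.
  by rewrite lte_fin weight_gt0.
move=> /(iN _ mB) /(prob1_ae (measurable_npoints_eq _ mB)).
apply: filterS => w; rewrite /npoints => NB.
have /set0P[[t' y] [Xty [/= tE Iy]]] : X w `&` B != set0.
  by apply/eqP => /(counting_eq0 _); rewrite NB.
by exists y => //; rewrite -tE.
Qed.

Lemma ae_three_directions : \forall w \ae P, three_directions (X w).
Proof.
have pi0 := pi_gt0 R.
have [_ _ [_ pN _ _]] := hX.
pose D : set (measurableTypeR R) := ~` ([set 0] `|` [set pi / 3] `|` [set 2 * pi / 3]).
have mD : measurable D.
  by apply: measurableC; apply: measurableU; [apply: measurableU|]; exact: measurable_set1.
pose B : set (measurableTypeR R * measurableTypeR R) := D `*` setT.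
have mB : measurable B by apply: measurableX => //; exact: measurableT.
have B0 : Lambda B = 0%E.
  rewrite -[LHS]/(1%:E * (G3 pq \x (@lebesgue_measure R)) B)%E mul1e.
  rewrite product_measure1E // [X in (X * _)%E](_ : _ = 0%E) ?mul0e //.
  rewrite /= /G3 !diracE !memNset ?mule0 ?adde0 //; apply.
  - by right.
  - by left; right.
  - by left; left.
have PB : P [set w | npoints X B w = 0%:R%:E :> \bar R] = 1%E.
  by rewrite pN // B0 ?ltry //= expr0 fact0 divr1 mul1r oppr0 expR0.
apply: filterS (prob1_ae (measurable_npoints_eq _ mB) PB) => w.
move=> /counting_eq0 XB [t y] Xty /=.
have : ~ D t by move=> Dt; have : (X w `&` B) (t, y) by []; rewrite XB.
by move=> /contrapT[[->|->]|->]; [constructor 1|constructor 2|constructor 3].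
Qed.

Lemma ae_spread dir : dir \in directions -> \forall w \ae P, spread (distances dir (X w)).
Proof.
move=> dd; have d2 := directions_sqr dd.
have fin : \forall w \ae P, forall N : nat,
    finite_set (distances dir (X w) `&` `[- N%:R, N%:R]).
  apply/ae_foralln => N.
  (* Strips are half-open, so the closed interval up to [N] is enclosed in a strip that ends at
     [N + 1]. *)
  have lohi : (- N%:R : R) <= N.+1%:R.
    by rewrite -natr1; have := ler0n R N; lra.
  have x0 : 0 <= weight dir * (N.+1%:R - - N%:R).
    by rewrite mulr_ge0 ?subr_ge0 // ltW // weight_gt0.
  have := ae_npoints_nat (measurable_rect (- N%:R) N.+1%:R dd) x0 (intensity_rect dd lohi).
  apply: filterS => w [k]; rewrite /npoints /counting; case: asboolP => // fX _.
  apply: sub_finite_set (finite_image (fun l => dir.2 * l.2) fX) => x [Dx].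
  rewrite /= in_itv /= => /andP[x1 x2]; exists (dir.1, dir.2 * x) => /=.
    split => //; split => //=; rewrite mulrA d2 mul1r x1 /=.
    by apply: (le_lt_trans x2); rewrite ltr_nat.
  by rewrite mulrA d2 mul1r.
(* Half-lines beyond [N + 1] turn weak bounds into the strict ones of [spread]; being of infinite
   length, they almost surely contain a point. *)
have unb : \forall w \ae P, forall N : nat,
    (exists2 y, N.+1%:R <= y & X w (dir.1, y)) /\
    (exists2 y, y <= - N.+1%:R & X w (dir.1, y)).
  apply/ae_foralln => N.
  have := @ae_infinite `[(N.+1%:R : R), +oo[%classic dir dd.
  rewrite lebesgue_measure_itv /= ltry => /(_ _ erefl) H1.
  have := @ae_infinite `]-oo, (- N.+1%:R : R)]%classic dir dd.
  rewrite lebesgue_measure_itv /= ltNyr => /(_ _ erefl) H2.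
  apply: filterS2 (H1 _) (H2 _) => // w [y yN Xy] [z zN Xz].
  by split; [exists y|exists z] => //; move: yN zN; rewrite /= !in_itv /= ?andbT.
apply: filterS2 fin unb => w finw unbw; split => // N.
have [[y yN Xy] [z zN Xz]] := unbw N; rewrite -natr1 in yN zN.
have [d1|d1] := directionsP dd; split.
- by exists y; rewrite /distances /= ?d1 ?mul1r //; lra.
- by exists z; rewrite /distances /= ?d1 ?mul1r //; lra.
- by exists (- z); rewrite /distances /= ?d1 ?mulN1r ?opprK //; lra.
- by exists (- y); rewrite /distances /= ?d1 ?mulN1r ?opprK //; lra.
Qed.

Lemma ae_good : \forall w \ae P, good (X w).
Proof.
have s0 : \forall w \ae P, spread (distances (0, 1) (X w)).
  by apply: ae_spread; rewrite !inE eqxx.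
have s1 : \forall w \ae P, spread (distances (pi / 3, -1) (X w)).
  by apply: ae_spread; rewrite !inE eqxx !orbT.
have s2 : \forall w \ae P, spread (distances (2 * pi / 3, -1) (X w)).
  by apply: ae_spread; rewrite !inE eqxx !orbT.
apply: filterS (filterI (filterI ae_three_directions s0) (filterI s1 s2)).
by move=> w [[? ?] [? ?]]; split.
Qed.

Lemma npoints_ge0 (B : set (R * R)) w : (0 <= npoints X B w :> \bar R)%E.
Proof. exact: counting_ge0. Qed.

Lemma measurable_npoints dir lo hi : dir \in directions ->
  measurable_fun setT (npoints X (rect dir lo hi) : T -> \bar R).
Proof. by move=> dd; have [_ _ [mN _ _ _]] := hX; apply: mN; exact: measurable_rect. Qed.

(** Almost surely the product is at most its expansion over the events [E k l]. Different angles
    give disjoint strips, so [E k l] has the product of two Poisson masses as probability, and the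
    double series splits into two Poisson means. *)
Lemma mean_npoints_prod dir dir' lo hi lo' hi' :
  dir \in directions -> dir' \in directions -> dir.1 != dir'.1 ->
  lo <= hi -> lo' <= hi' ->
  (\int[P]_w (npoints X (rect dir lo hi) w * npoints X (rect dir' lo' hi') w) <=
   ((weight dir * (hi - lo)) * (weight dir' * (hi' - lo')))%:E)%E.
Proof.
move=> dd dd' neq lohi lohi'.
set B := rect dir lo hi; set B' := rect dir' lo' hi'.
set x := weight dir * _; set x' := weight dir' * _.
have x0 : 0 <= x by rewrite mulr_ge0 ?subr_ge0 // ltW // weight_gt0.
have x'0 : 0 <= x' by rewrite mulr_ge0 ?subr_ge0 // ltW // weight_gt0.
have mB : measurable (B : set (measurableTypeR R * measurableTypeR R)) by exact: measurable_rect.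
have mB' : measurable (B' : set (measurableTypeR R * measurableTypeR R)) by exact: measurable_rect.
have [_ _ [_ pN _ iN]] := hX.
pose E k l : set T := [set w | npoints X B w = k%:R%:E :> \bar R] `&`
                      [set w | npoints X B' w = l%:R%:E :> \bar R].
have mE k l : measurable (E k l) by apply: measurableI; exact: measurable_npoints_eq.
pose pmf (y : R) k := y ^+ k / k`!%:R * expR (- y).
have pmf_ge0 y k : 0 <= y -> 0 <= pmf y k.
  by move=> y0; rewrite mulr_ge0 ?expR_ge0 // divr_ge0 // exprn_ge0.
have PE k l : P (E k l) = (pmf x k * pmf x' l)%:E.
  pose BB (i : 'I_2) := if i == ord0 then B else B'.
  pose AA (i : 'I_2) : set (\bar R) := if i == ord0 then [set k%:R%:E] else [set l%:R%:E].
  have -> : E k l = \bigcap_(i in setT) [set w | AA i (npoints X (BB i) w)].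
    apply/seteqP; split=> w.
      by move=> [? ?] i _; rewrite /= /AA /BB; case: ifP.
    by move=> Ew; split; [exact: (Ew ord0 I)|exact: (Ew (lift ord0 ord0) I)].
  rewrite iN.
  - rewrite big_ord_recl big_ord1 /BB /AA /=.
    by rewrite !pN // ?intensity_rect ?ltry // -EFinM.
  - by move=> i; rewrite /BB; case: ifP.
  - apply/trivIsetP => i j _ _ ij; rewrite -subset0 => -[t y]; rewrite /BB.
    case: (unliftP ord0 i) ij => [i' ->|->]; case: (unliftP ord0 j) => [j' ->|->] /=;
      rewrite ?(ord1 i') ?(ord1 j') ?eqxx //.
      by move=> _ [[/= tE _] [/= tE' _]]; move: neq; rewrite -tE -tE' eqxx.
    by move=> _ [[/= tE _] [/= tE' _]]; move: neq; rewrite -tE -tE' eqxx.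
  - by move=> i; rewrite /AA; case: ifP => _; exact: emeasurable_set1.
pose F w := (\sum_(k <oo) \sum_(l <oo) (k%:R * l%:R)%:E * (\1_(E k l) w)%:E)%E : \bar R.
have f0 k l w : (0 <= (k%:R * l%:R)%:E * (\1_(E k l) w)%:E :> \bar R)%E.
  by rewrite mule_ge0 // lee_fin ?mulr_ge0.
have mf k l : measurable_fun setT (fun w => (k%:R * l%:R)%:E * (\1_(E k l) w)%:E)%E.
  by apply: measurable_funeM; apply/measurable_EFinP; exact: measurable_indic.
have g0 k w : (0 <= \sum_(l <oo) (k%:R * l%:R)%:E * (\1_(E k l) w)%:E :> \bar R)%E.
  by apply: nneseries_ge0 => l _ _; exact: f0.
have mg k : measurable_fun setT (fun w => \sum_(l <oo) (k%:R * l%:R)%:E * (\1_(E k l) w)%:E)%E.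
  by apply: ge0_emeasurable_sum => // l w _ _; exact: f0.
apply: (@le_trans _ _ (\int[P]_w F w)%E).
  apply: ae_le_lower_integral.
  - by apply: emeasurable_funM; exact: measurable_npoints.
  - by move=> w; rewrite mule_ge0 ?npoints_ge0.
  - by move=> w; apply: nneseries_ge0 => k _ _; exact: g0.
  apply: filterS2 (ae_npoints_nat mB x0 (intensity_rect dd lohi))
                  (ae_npoints_nat mB' x'0 (intensity_rect dd' lohi')) => w [k kE] [l lE].
  rewrite kE lE; apply: (@le_trans _ _ (\sum_(l <oo) (k%:R * l%:R)%:E * (\1_(E k l) w)%:E)%E).
    apply: le_trans (nneseries_lim_ge l.+1 _); last by move=> ? _ _; exact: f0.
    rewrite big_nat_recr //= indicE mem_set; last by split.
    by rewrite mule1 -EFinM leeDr // sume_ge0.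
  apply: le_trans (nneseries_lim_ge k.+1 _); last by move=> ? _ _; exact: g0.
  by rewrite big_nat_recr //= leeDr // sume_ge0.
rewrite integral_nneseries //.
have IE k : (\int[P]_w \sum_(l <oo) (k%:R * l%:R)%:E * (\1_(E k l) w)%:E =
    (k%:R * pmf x k)%:E * \sum_(l <oo) (l%:R * pmf x' l)%:E)%E.
  rewrite integral_nneseries // -nneseriesZl; last first.
    by move=> l _; rewrite lee_fin mulr_ge0 // pmf_ge0.
  apply: eq_eseriesr => l _.
  rewrite ge0_integralZl_EFin //; last by apply/measurable_EFinP; exact: measurable_indic.
  by rewrite integral_indic // setIT [X in (_ * X)%E](PE k l) -!EFinM; congr EFin; ring.
under eq_eseriesr do rewrite IE.
apply: (@le_trans _ _ (\sum_(k <oo) (x'%:E * (k%:R * pmf x k)%:E))%E).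
  apply: lee_nneseries => k _ //.
    rewrite mule_ge0 //; first by rewrite lee_fin mulr_ge0 // pmf_ge0.
    by apply: nneseries_ge0 => l _ _; rewrite lee_fin mulr_ge0 // pmf_ge0.
  rewrite muleC; apply: lee_wpmul2r; first by rewrite lee_fin mulr_ge0 // pmf_ge0.
  exact: poisson_mean_le.
rewrite nneseriesZl; last by move=> k _; rewrite lee_fin mulr_ge0 // pmf_ge0.
have x0E : (0 <= x'%:E)%E by rewrite lee_fin.
rewrite (mulrC x) EFinM; exact: (lee_wpmul2l x0E (poisson_mean_le x0)).
Qed.

End Process.

(** * Grids in the unit square *)

Section Grids.
Context {R : realType}.
Local Notation s := (sin (pi / 3 : R)).

Lemma grid_inj (e : R) (i j : int) u : 0 < e ->
  i%:~R * e <= u < i%:~R * e + e -> j%:~R * e <= u < j%:~R * e + e -> i = j.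
Proof.
move=> e0 /andP[iu ui] /andP[ju uj].
have ij : (i%:~R < j%:~R + 1 :> R) by rewrite -(ltr_pM2r e0) mulrDl mul1r; lra.
have ji : (j%:~R < i%:~R + 1 :> R) by rewrite -(ltr_pM2r e0) mulrDl mul1r; lra.
by move: ij ji; rewrite -!(intrD _ _ 1) !ltr_int; lia.
Qed.

Lemma separated_allpairs (e : R) (x y : nat -> nat -> R) (r t : seq nat) :
  uniq r -> uniq t ->
  (forall i i' j j' u v, x i j <= u < x i j + e -> x i' j' <= u < x i' j' + e ->
    y i j <= v < y i j + e -> y i' j' <= v < y i' j' + e -> i = i' /\ j = j') ->
  0 < e -> separated_boxes e [seq (x i j, y i j) | i <- r, j <- t].
Proof.
move=> ur ut inj e0; split.
  apply: allpairs_uniq => // -[i j] [i' j'] _ _ /= [xE yE].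
  have xx : x i j <= x i j < x i j + e by rewrite lexx ltrDl.
  have yy : y i j <= y i j < y i j + e by rewrite lexx ltrDl.
  by have [||-> ->] := inj i i' j j' (x i j) (y i j) xx _ yy; rewrite // -?xE -?yE.
move=> b b' /allpairsP[[i j] [_ _ ->]] /allpairsP[[i' j'] [_ _ ->]] u v [/= xu yv] [/= xu' yv'].
by have [-> ->] := inj _ _ _ _ _ _ xu xu' yv yv'.
Qed.

Lemma sum_iota_const (a m : nat) (c : R) : \sum_(i <- iota a m) c = m%:R * c.
Proof.
elim: m a => [|m IH] a; first by rewrite big_nil mul0r.
by rewrite big_cons IH -natr1; ring.
Qed.

Variables (n : nat).
Hypothesis n_gt0 : (0 < n)%N.
Local Notation e := (n%:R^-1 : R).

Lemma mesh_gt0 : 0 < e. Proof. by rewrite invr_gt0 ltr0n. Qed.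
Lemma mesh_mul : n%:R * e = 1. Proof. by rewrite divff // pnatr_eq0 -lt0n. Qed.
Lemma s_le1 : s <= 1. Proof. exact: sin_le1. Qed.

(** The number of whole rows of height [e] in [[0, s]], the range of [s * z.1] on the unit
    square. *)
Let M := Num.truncn (s * n%:R).

Lemma rows_le : M%:R * e <= s.
Proof.
apply: (@le_trans _ _ (s * n%:R * e)); last by rewrite -mulrA mesh_mul mulr1.
rewrite ler_wpM2r ?(ltW mesh_gt0) // truncn_le.
by rewrite mulr_ge0 // ltW // sin_pi3_gt0.
Qed.

Lemma rows_gt : s < M%:R * e + e.
Proof.
apply: (@le_lt_trans _ _ (s * n%:R * e)); first by rewrite -mulrA mesh_mul mulr1.
by rewrite -[X in _ + X]mul1r -mulrDl ltr_pM2r ?mesh_gt0 // natr1 truncnS_gt.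
Qed.

(** In the coordinates [(u, u / 2 + v)] the square is a rectangle of sides 1 and [s], and the grid
    is sheared accordingly. A box of row [j] has [u / 2 + v] between [j * e] and [(j + 3 / 2) * e],
    so the top row is dropped; with the rounding of [s] this costs less than [2 * e] of area. The
    constant 4 is shared with [frame12]. *)
Lemma boxes_add (k : frame) (x0 : R) :
  (forall u v, x0 <= u <= x0 + 1 -> 0 <= u / 2 + v <= s -> unit_square (fr_pt k u v)) ->
  exists bs, [/\ separated_boxes e bs,
    forall b, b \in bs -> forall u v, in_box e b u v -> unit_square (fr_pt k u v) &
    s - 4 * e <= (size bs)%:R * e ^+ 2].
Proof.
move=> sq; have e0 := mesh_gt0; have ne := mesh_mul; have Ms := rows_le.
have sM := rows_gt; have s1 := s_le1.
exists [seq (x0 + i%:R * e, j%:R * e - (x0 + i%:R * e) / 2) | i <- iota 0 n, j <- iota 0 M.-1].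
split.
- apply: (@separated_allpairs _ (fun i j => _) (fun i j => _)); rewrite ?iota_uniq //.
  move=> i i' j j' u v iu iu' jv jv'.
  have ii : i = i' by apply: (can_inj absz_nat); apply: (@grid_inj e i i' (u - x0) e0); rewrite -!pmulrn; lra.
  split => //; subst i'.
  by apply: (can_inj absz_nat); apply: (@grid_inj e j j' (v + (x0 + i%:R * e) / 2) e0); rewrite -!pmulrn; lra.
- move=> _ /allpairsP[[i j] [+ + ->]] u v [/= iu jv].
  rewrite !mem_iota /= !add0n => iN jM.
  have ie : (i%:R + 1) * e <= 1.
    by rewrite -[leRHS]ne ler_pM2r // natr1 ler_nat.
  have je : (j%:R + 2) * e <= s.
    apply: le_trans Ms; rewrite ler_pM2r // -natrD ler_nat; lia.
  have ie0 : 0 <= i%:R * e by rewrite mulr_ge0 // ltW.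
  have je0 : 0 <= j%:R * e by rewrite mulr_ge0 // ltW.
  by apply: sq; lra.
rewrite size_allpairs !size_iota natrM expr2 mulrACA ne mul1r.
have : (M%:R - 1) * e <= M.-1%:R * e.
  by rewrite ler_pM2r // lerBlDr natr1 ler_nat; lia.
lra.
Qed.

Lemma boxes_frame01 : exists bs, [/\ separated_boxes e bs,
    forall b, b \in bs -> forall u v, in_box e b u v -> unit_square (fr_pt frame01 u v) &
    s - 4 * e <= (size bs)%:R * e ^+ 2].
Proof.
apply: (@boxes_add _ 0) => // u v /andP[u0 u1] /andP[w0 w1]; split => /=; last by lra.
have -> : 1 / (2 * s) * u + 1 / s * v = (u / 2 + v) / s by have sn0 := @s_neq0 R; field.
apply/andP; split; first by apply: divr_ge0 => //; exact/ltW/sin_pi3_gt0.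
by rewrite ler_pdivrMr ?sin_pi3_gt0 // mul1r.
Qed.

Lemma boxes_frame02 : exists bs, [/\ separated_boxes e bs,
    forall b, b \in bs -> forall u v, in_box e b u v -> unit_square (fr_pt frame02 u v) &
    s - 4 * e <= (size bs)%:R * e ^+ 2].
Proof.
apply: (@boxes_add _ (-1)) => // u v /andP[u0 u1] /andP[w0 w1]; split => /=; last by lra.
have -> : 1 / (2 * s) * u + 1 / s * v = (u / 2 + v) / s by have sn0 := @s_neq0 R; field.
apply/andP; split; first by apply: divr_ge0 => //; exact/ltW/sin_pi3_gt0.
by rewrite ler_pdivrMr ?sin_pi3_gt0 // mul1r.
Qed.

(* For directions pi / 3 and 2 pi / 3 the unit square becomes 0 <= u + v <= 2 s,
   0 <= v - u <= 1, which is covered by the grid boxes (i - floor (j / 2),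
   i + ceil (j / 2)): there v - u is about j e and u + v about 2 i e. *)
Lemma halves (j : nat) : exists o : nat, [/\ uphalf j = (j./2 + o)%N,
  j = (j./2 + uphalf j)%N & (o <= 1)%N].
Proof.
exists (odd j); split; last by case: odd.
  by rewrite uphalf_half addnC.
by rewrite uphalf_half addnCA addnn odd_double_half.
Qed.

Lemma boxes_frame12 : exists bs, [/\ separated_boxes e bs,
    forall b, b \in bs -> forall u v, in_box e b u v -> unit_square (fr_pt frame12 u v) &
    s - 4 * e <= (size bs)%:R * e ^+ 2].
Proof.
have e0 := mesh_gt0; have ne := mesh_mul; have Ms := rows_le.
have sM := rows_gt; have s1 := s_le1; have s0 := @sin_pi3_gt0 R.
(* On box [(i, j)] the difference [v - u] is within [e] of [j * e], hence [0 < j < n], and [u + v]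
   is less than [(2 * i + 3) * e], hence the bound [i + 2 <= M]. *)
exists [seq ((i%:Z - j./2%:Z)%:~R * e, (i%:Z + (uphalf j)%:Z)%:~R * e) |
   i <- iota 0 M.-1, j <- iota 1 n.-1].
split.
- apply: (@separated_allpairs _ (fun i j => _) (fun i j => _)); rewrite ?iota_uniq //.
  move=> i i' j j' u v iu iu' jv jv'.
  have E1 := grid_inj e0 iu iu'; have E2 := grid_inj e0 jv jv'.
  have [_ [_ hj _]] := halves j; have [_ [_ hj' _]] := halves j'.
  have jj : j = j'.
    rewrite hj hj'; move: E1 E2; clear; move: j./2 (uphalf j) j'./2 (uphalf j').
    by move=> a b c d; lia.
  by subst j'; split => //; move: E2 => /addIr [].
- move=> _ /allpairsP[[i j] [+ + ->]] u v [iu jv].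
  rewrite !mem_iota /= !add0n => iN jM.
  rewrite /= !intrD mulrNz -!pmulrn in iu jv.
  have jn : (j < n)%N by move: jM n_gt0; clear; lia.
  have j1 : (0 < j)%N by move: jM; clear; lia.
  have i2 : (i + 2 <= M)%N by move: iN; clear; lia.
  have [ o [ho hj o1]] := halves j.
  have je : (j%:R + 1) * e <= 1 by rewrite -[leRHS]ne ler_pM2r // natr1 ler_nat.
  have je1 : 1 * e <= j%:R * e by rewrite ler_pM2r // ler1n.
  have ie : (i%:R + 2) * e <= s.
    apply: le_trans Ms; rewrite ler_pM2r // -natrD ler_nat; exact: i2.
  have ie0 : 0 <= i%:R * e by rewrite mulr_ge0 // ltW.
  have oe : o%:R * e <= e by rewrite -[leRHS]mul1r ler_pM2r // lern1.
  have oe0 : 0 <= o%:R * e by rewrite mulr_ge0 // ltW.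
  have hjR : j%:R = j./2%:R + (uphalf j)%:R :> R by rewrite -natrD -hj.
  have hoR : (uphalf j)%:R = j./2%:R + o%:R :> R by rewrite ho natrD.
  rewrite hjR hoR in je je1; rewrite hoR in jv.
  split; rewrite /=; last by lra.
  have -> : 1 / (2 * s) * u + 1 / (2 * s) * v = (u + v) / (2 * s).
    by have sn0 := @s_neq0 R; field.
  have s2 : 0 < 2 * s by rewrite mulr_gt0.
  apply/andP; split; first by apply: divr_ge0; [lra|exact: ltW].
  by rewrite ler_pdivrMr // mul1r; lra.
rewrite size_allpairs !size_iota natrM expr2 mulrACA.
have M1 : (M%:R - 1) * e <= M.-1%:R * e.
  by rewrite ler_pM2r // lerBlDr natr1 ler_nat leqSpred.
have N1 : n.-1%:R * e = 1 - e.
  have : (n.-1%:R + 1) * e = 1 by rewrite natr1 prednK.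
  by rewrite mulrDl mul1r; lra.
have M2 : M.-1%:R * e <= 1.
  by apply: le_trans s1; apply: le_trans Ms; rewrite ler_pM2r // ler_nat leq_pred.
rewrite N1; have : M.-1%:R * e * e <= 1 * e by rewrite ler_pM2r.
rewrite mulrBr mulr1; lra.
Qed.

Definition covers (k : @frame R) (rs : seq ((R * R) * (R * R))) :=
  [/\ forall r, r \in rs -> r.1.1 <= r.1.2 /\ r.2.1 <= r.2.2,
      forall u v, unit_square (fr_pt k u v) -> exists2 r, r \in rs &
        r.1.1 <= u < r.1.2 /\ r.2.1 <= v < r.2.2 &
      \sum_(r <- rs) (r.1.2 - r.1.1) * (r.2.2 - r.2.1) <= s + 7 * e].

(** One tall rectangle per column of width [e] is enough, since the means are bilinear in the side
    lengths. Its height is [s], plus [e / 2] for the variation of [u / 2], plus a margin [e] for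
    half-openness; the column of index [n] catches [u = x0 + 1]. The constant 7 is generous and also
    serves [frame12]. *)
Lemma cover_add (k : frame) (x0 : R) :
  (forall u v, unit_square (fr_pt k u v) -> x0 <= u <= x0 + 1 /\ 0 <= u / 2 + v <= s) ->
  exists rs, covers k rs.
Proof.
move=> sq; have e0 := mesh_gt0; have ne := mesh_mul; have s1 := s_le1.
have s0 := @sin_pi3_gt0 R.
pose x (i : nat) := x0 + i%:R * e.
exists [seq ((x i, x i + e), (- (x i + e) / 2, s - x i / 2 + e)) | i <- iota 0 n.+1].
split.
- by move=> _ /mapP[i _ ->] /=; lra.
- move=> u v /sq[/andP[u0 u1] /andP[w0 w1]].
  have ux0 : 0 <= (u - x0) * n%:R by rewrite mulr_ge0 // subr_ge0.
  pose i := Num.truncn ((u - x0) * n%:R).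
  have uE : u - x0 = (u - x0) * n%:R * e by rewrite -mulrA ne mulr1.
  have iu : i%:R * e <= u - x0 by rewrite uE ler_pM2r // truncn_le.
  have ui : u - x0 < (i%:R + 1) * e by rewrite [ltLHS]uE ltr_pM2r // natr1 truncnS_gt.
  exists ((x i, x i + e), (- (x i + e) / 2, s - x i / 2 + e)).
    apply: map_f; rewrite mem_iota /= add0n ltnS.
    have : i%:R * e <= n%:R * e by rewrite ne; lra.
    by rewrite ler_pM2r // ler_nat.
  by rewrite /= /x; lra.
rewrite big_map (eq_bigr (fun=> e * (s + 3 / 2 * e))); last by move=> i _ /=; lra.
rewrite sum_iota_const mulrA -natr1 mulrDl ne mul1r.
have e1 : e <= 1 by rewrite -[leRHS]ne -[leLHS]mul1r ler_pM2r // ler1n.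
have se : s * e <= e by rewrite -[leRHS]mul1r ler_pM2r.
have ee : e * e <= e by rewrite -[leRHS]mul1r ler_pM2r.
lra.
Qed.

Lemma unit_square_add u v (y : R) : unit_square (1 / (2 * s) * u + 1 / s * v, y) ->
  0 <= u / 2 + v <= s /\ 0 <= y <= 1.
Proof.
have s0 := @sin_pi3_gt0 R; have sn0 := @s_neq0 R.
move=> [/= /andP[x0 x1] ->]; split => //.
have E : 1 / (2 * s) * u + 1 / s * v = (u / 2 + v) / s by field.
rewrite E in x0 x1; rewrite ler_pdivrMr // mul1r in x1.
by rewrite x1 andbT; move: x0; rewrite pmulr_lge0 // invr_gt0.
Qed.

Lemma cover_frame01 : exists rs, covers frame01 rs.
Proof. by apply: (@cover_add _ 0) => u v /unit_square_add[-> /= y01]; split => //; lra. Qed.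

Lemma cover_frame02 : exists rs, covers frame02 rs.
Proof. by apply: (@cover_add _ (-1)) => u v /unit_square_add[-> /= y01]; split => //; lra. Qed.

Lemma cover_frame12 : exists rs, covers frame12 rs.
Proof.
have e0 := mesh_gt0; have ne := mesh_mul; have Ms := rows_le.
have sM := rows_gt; have s1 := s_le1; have s0 := @sin_pi3_gt0 R; have sn0 := @s_neq0 R.
(* The box of [(u, v)] has corner [(a * e, b * e)] with integers [a], [b]; then [j = b - a] and
   [a + b] determines [i]. Since [u + v >= 0] still allows [a + b = -1], [i] is shifted by 1 to
   remain natural. *)
pose x (i j : nat) : R := (i%:Z - 1 - j./2%:Z)%:~R * e.
pose y (i j : nat) : R := (i%:Z - 1 + (uphalf j)%:Z)%:~R * e.
exists [seq ((x i j, x i j + e), (y i j, y i j + e)) | i <- iota 0 M.+2, j <- iota 0 n.+1].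
split.
- by move=> _ /allpairsP[[i j] [_ _ ->]] /=; lra.
- move=> u v [/= xb yb].
  have E : 1 / (2 * s) * u + 1 / (2 * s) * v = (u + v) / (2 * s) by field.
  have s2 : 0 < 2 * s by rewrite mulr_gt0.
  have {}xb : 0 <= u + v <= 2 * s.
    move: xb; rewrite E => /andP[x0 x1]; rewrite ler_pdivrMr // mul1r in x1.
    by rewrite x1 andbT; move: x0; rewrite pmulr_lge0 // invr_gt0.
  have fl (t : R) : exists a : int, a%:~R * e <= t < a%:~R * e + e.
    have tE : t * n%:R * e = t by rewrite -mulrA ne mulr1.
    exists (Num.floor (t * n%:R)); have := floor_itv (t * n%:R).
    move: (Num.floor _) => f; rewrite intrD => /andP[f0 f1]; apply/andP; split.
      by rewrite -[leRHS]tE ler_pM2r.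
    by rewrite -[ltLHS]tE -[X in _ + X]mul1r -mulrDl ltr_pM2r.
  have [a /andP[au ua]] := fl u; have [b /andP[bv vb]] := fl v.
  have ab0 : -1 < b - a.
    by rewrite -(ltr_int R) intrB -(ltr_pM2r e0) mulrBl; lra.
  have abn : b - a < n%:Z + 1.
    by rewrite -(ltr_int R) intrB intrD -pmulrn -(ltr_pM2r e0) mulrBl mulrDl ne; lra.
  have sum0 : -2 < a + b.
    by rewrite -(ltr_int R) intrD -(ltr_pM2r e0) mulrDl; lra.
  have sum1 : a + b < 2 * (M%:Z + 1).
    by rewrite -(ltr_int R) intrM !intrD -pmulrn -(ltr_pM2r e0) mulrDl -mulrA mulrDl mul1r; lra.
  pose j := `|b - a|%N.
  have jE : j%:Z = b - a by rewrite /j gez0_abs //; move: ab0; clear; lia.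
  have [ o [ho hj o1]] := halves j.
  have [i iE] : exists i : nat, i%:Z = a + j./2%:Z + 1.
    exists (absz (a + j./2%:Z + 1)); rewrite gez0_abs //.
    move: jE ho hj o1 sum0; clear; move: j (j./2) (uphalf j) => J A B; lia.
  have xE : x i j = a%:~R * e by rewrite /x iE; congr (_%:~R * _); ring.
  have yE : y i j = b%:~R * e.
    rewrite /y iE; congr (_%:~R * _).
    move: jE hj; clear; move: j (j./2) (uphalf j) => J A B; lia.
  exists ((x i j, x i j + e), (y i j, y i j + e)).
    have iM : i \in iota 0 M.+2.
      rewrite mem_iota /=.
      by move: iE jE ho hj o1 sum1; clear; move: (M) j (j./2) (uphalf j) => K J A B; lia.
    have jn : j \in iota 0 n.+1 by rewrite mem_iota /=; move: jE abn; clear; lia.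
    exact: (allpairs_f (fun i j => ((x i j, x i j + e), (y i j, y i j + e))) iM jn).
  by rewrite /= xE yE au ua bv vb.
rewrite big_allpairs_dep.
rewrite (eq_bigr (fun=> \sum_(j <- iota 0 n.+1) e * e)); last first.
  by move=> i _; apply: eq_bigr => j _ /=; rewrite addrC addKr addrC addKr.
rewrite !sum_iota_const.
have -> : M.+2%:R * (n.+1%:R * (e * e)) = (M%:R * e + 2 * e) * (n%:R * e + e).
  by rewrite -(addn2 M) -(addn1 n) !natrD; ring.
rewrite ne.
have e1 : e <= 1 by rewrite -[leRHS]ne -[leLHS]mul1r ler_pM2r // ler1n.
have se : M%:R * e * e <= e.
  by rewrite -[leRHS]mul1r ler_pM2r //; apply: le_trans s1.
have ee : e * e <= e by rewrite -[leRHS]mul1r ler_pM2r.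
lra.
Qed.

End Grids.

(** * Grid events *)

Section Patterns.
Context {R : realType} (p q : R) (pq : admissible p q).
Implicit Types (k : @frame R) (e : R) (b : R * R) (l : nat).

Local Notation "dir `in ( lo , hi )" := ((dir, (lo, hi)), true) (at level 50).
Local Notation "dir `out ( lo , hi )" := ((dir, (lo, hi)), false) (at level 50).

(* On a box of side e at (x, y), the crossing has h = f + g in an interval of
   length 2 e starting at x + y. So if H is first hit in the cell l + 2 after
   x + y, at distance at most (l + 3) e from the crossing, while F and G are not
   hit before the cell l + 4, then H is met first. *)
Definition triangle_pattern k e b l : seq ((R * R) * (R * R) * bool) :=
  [:: fr_F k `in (b.1, b.1 + e); fr_G k `in (b.2, b.2 + e);
      fr_H k `in (b.1 + b.2 + l.+2%:R * e, b.1 + b.2 + l.+3%:R * e);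
      fr_F k `out (b.1 + e, b.1 + l.+4%:R * e); fr_G k `out (b.2 + e, b.2 + l.+4%:R * e);
      fr_H k `out (b.1 + b.2, b.1 + b.2 + l.+2%:R * e)].

(* Here F (if f) or G (otherwise) is hit in the cell l + 1, at distance less than
   (l + 2) e, and H is not hit before the cell l + 4. Emptiness of the cells of F
   and G before that only makes the patterns for distinct (f, l) exclusive. *)
Definition nontriangle_pattern k e b (f : bool) l : seq ((R * R) * (R * R) * bool) :=
  [:: fr_F k `in (b.1, b.1 + e); fr_G k `in (b.2, b.2 + e);
      (if f then fr_F k `in (b.1 + l.+1%:R * e, b.1 + l.+2%:R * e)
       else fr_G k `in (b.2 + l.+1%:R * e, b.2 + l.+2%:R * e));
      fr_F k `out (b.1 + e, b.1 + (l.+1 + ~~ f)%:R * e);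
      fr_G k `out (b.2 + e, b.2 + (l.+1 + f)%:R * e);
      fr_H k `out (b.1 + b.2, b.1 + b.2 + l.+4%:R * e)].

Definition sub_pattern k e b : seq ((R * R) * (R * R) * bool) :=
  [:: fr_F k `in (b.1, b.1 + e); fr_G k `in (b.2, b.2 + e);
      fr_H k `out (b.2 - b.1 - e, b.2 - b.1 + e)].

Lemma fr_directions k : List.In k frames ->
  [/\ fr_F k \in @directions R, fr_G k \in @directions R & fr_H k \in @directions R].
Proof. by case=> [<-|[<-|[<-|[]]]]; split; rewrite !inE eqxx ?orbT. Qed.

Lemma fr_distinct k : List.In k frames ->
  [/\ (fr_F k).1 != (fr_G k).1, (fr_F k).1 != (fr_H k).1 & (fr_G k).1 != (fr_H k).1].
Proof.
have pi0 := pi_gt0 R.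
by case=> [<-|[<-|[<-|[]]]]; split; apply/eqP => /=; lra.
Qed.

Lemma weights01 : [/\ weight p q (fr_F (@frame01 R)) = p, weight p q (fr_G (@frame01 R)) = q &
  weight p q (fr_H (@frame01 R)) = 1 - p - q].
Proof.
have pi0 := pi_gt0 R; rewrite /weight /= eqxx.
have -> : (pi / 3 == 0 :> R) = false by apply/eqP; lra.
have -> : (2 * pi / 3 == 0 :> R) = false by apply/eqP; lra.
have -> : (2 * pi / 3 == pi / 3 :> R) = false by apply/eqP; lra.
by rewrite eqxx.
Qed.

Lemma fr_weights k : List.In k frames ->
  weight p q (fr_F k) + weight p q (fr_G k) + weight p q (fr_H k) = 1.
Proof.
have [w0 w1 w2] := weights01.
by case=> [<-|[<-|[<-|[]]]]; move: w0 w1 w2; rewrite /weight /=; lra.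
Qed.

(** For a Poisson count of mean [x], exactly one point is no more likely than at least one;
    analytically this is [1 + x <= exp x]. *)
Lemma mul_expRN_le (x : R) : x * expR (- x) <= 1 - expR (- x).
Proof.
have := expR_ge1Dx x; rewrite -(ler_pM2r (expR_gt0 (- x))).
by rewrite -expRD subrr expR0 mulrDl mul1r; lra.
Qed.

(** Each hit is bounded below by the event of exactly one point, so that all six exponentials
    combine into one. *)
Lemma pattern_weight3 (x1 x2 x3 y1 y2 y3 z : R) : 0 <= x1 -> 0 <= x2 -> 0 <= x3 ->
  x1 + x2 + x3 + y1 + y2 + y3 <= z ->
  x1 * x2 * x3 * expR (- z) <= (1 - expR (- x1)) * ((1 - expR (- x2)) * ((1 - expR (- x3)) *
    (expR (- y1) * (expR (- y2) * expR (- y3))))).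
Proof.
move=> x10 x20 x30 xyz.
apply: (@le_trans _ _ ((x1 * expR (- x1)) * ((x2 * expR (- x2)) * ((x3 * expR (- x3)) *
    (expR (- y1) * (expR (- y2) * expR (- y3))))))).
  rewrite (_ : _ * (_ * _) = x1 * x2 * x3 * (expR (- x1) * expR (- x2) * expR (- x3) *
    expR (- y1) * expR (- y2) * expR (- y3))); last by ring.
  rewrite ler_wpM2l ?mulr_ge0 // -!expRD ler_expR; lra.
have E1 := expR_ge0 (- x1); have E2 := expR_ge0 (- x2); have E3 := expR_ge0 (- x3).
have := expR_ge0 (- y1); have := expR_ge0 (- y2); have := expR_ge0 (- y3).
by move=> ? ? ?; do ?[apply: ler_pM; rewrite ?mul_expRN_le ?mulr_ge0 //].
Qed.

(** A Riemann sum of mesh [e] for the integral of [exp (- t)] over the half-line; multiplied by the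
    weight of a direction, it tends to the probability that this direction comes first. The [n * n]
    terms reach up to [t = n], where the tail [exp (- n)] is below [e], and the offset 6 costs the
    factor [r ^+ 6 >= 1 - 6 * e]. *)
Lemma sum_expR_ge (n : nat) (e : R) : (0 < n)%N -> e = n%:R^-1 ->
  1 - 7 * e <= e * \sum_(l < n * n) expR (- (l.+4.+2%:R * e)) :> R.
Proof.
move=> n0 eE; have e0 : 0 < e by rewrite eE invr_gt0 ltr0n.
have ne : n%:R * e = 1 by rewrite eE divff // pnatr_eq0 -lt0n.
pose r := expR (- e).
have r0 : 0 < r := expR_gt0 _.
have E l : expR (- (l.+4.+2%:R * e)) = r ^+ 6 * r ^+ l.
  by rewrite -exprD /r -expRM_natl mulrN.
under eq_bigr do rewrite E.
rewrite -mulr_sumr.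
have r1 : 1 - r <= e by have := expR_ge1Dx (- e); rewrite -/r; lra.
have S0 : 0 <= \sum_(l < n * n) r ^+ l by rewrite sumr_ge0 // => l _; rewrite exprn_ge0 // ltW.
have geo : (1 - r) * \sum_(l < n * n) r ^+ l = 1 - r ^+ (n * n).
  by rewrite -{2}(expr1n _ (n * n)) subrXX; congr (_ * _); apply: eq_bigr => l _; rewrite expr1n mul1r.
have rn : r ^+ (n * n) <= e.
  rewrite /r -expRM_natl natrM mulrN -mulrA ne mulr1 expRN [leRHS]eE lef_pV2 ?posrE ?expR_gt0 ?ltr0n //.
  by have := expR_ge1Dx (n%:R : R); lra.
have r6 : 1 - 6 * e <= r ^+ 6.
  by rewrite /r -expRM_natl; have := expR_ge1Dx (6%:R * - e); lra.
have eS : 1 - e <= e * \sum_(l < n * n) r ^+ l.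
  apply: (@le_trans _ _ ((1 - r) * \sum_(l < n * n) r ^+ l)); first by rewrite geo; lra.
  by rewrite ler_wpM2r.
rewrite mulrCA.
have r60 : 0 <= r ^+ 6 by rewrite exprn_ge0 // ltW.
(* If [7 * e > 1] the left side is negative; otherwise [1 - 6 * e] is nonnegative and the two lower
   bounds can be multiplied. *)
have [e7|e7] := leP (7 * e) 1; last first.
  apply: (@le_trans _ _ 0); first by lra.
  by rewrite !mulr_ge0 // ltW.
apply: (@le_trans _ _ ((1 - 6 * e) * (1 - e))); last by apply: ler_pM => //; lra.
have ee : 0 <= e * e by rewrite mulr_ge0 // ltW.
lra.
Qed.

End Patterns.

(** * Measurable lower bounds from exclusive patterns *)

Section Minorants.
Context {R : realType} {dT : measure_display} {T : measurableType dT}.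
Context (P : probability T R) (p q : R) (pq : admissible p q) (X : T -> set (R * R)).
Hypothesis hX : poisson_line_process P 1%:pos (G3 pq) X.
Implicit Types (k : @frame R) (e : R) (b : R * R) (l n : nat) (A : set (set (R * R))).

Local Notation wF k := (weight p q (fr_F k)).
Local Notation wG k := (weight p q (fr_G k)).
Local Notation wH k := (weight p q (fr_H k)).

Lemma pattern_cons el pat w : pattern X (el :: pat) w <->
  (if el.2 then hit el.1.1 el.1.2.1 el.1.2.2 (X w) else ~ hit el.1.1 el.1.2.1 el.1.2.2 (X w)) /\
  pattern X pat w.
Proof.
split=> [pw|[elw pw] e'].
  by split=> [|e' e'pat]; apply: pw; rewrite inE ?eqxx // e'pat orbT.
by rewrite inE => /predU1P[-> //|]; exact: pw.
Qed.

Lemma hit_sub dir (lo hi lo' hi' : R) L : lo' <= lo -> hi <= hi' ->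
  hit dir lo hi L -> hit dir lo' hi' L.
Proof.
move=> lolo hihi [d Dd /andP[lod dhi]]; exists d => //.
by rewrite (le_trans lolo lod) (lt_le_trans dhi hihi).
Qed.

Lemma apart_neq (el el' : (R * R) * (R * R) * bool) : el.1.1.1 != el'.1.1.1 -> apart el el'.
Proof. by move=> neq; rewrite /apart neq. Qed.

Lemma apart_le (el el' : (R * R) * (R * R) * bool) : el.1.1 = el'.1.1 ->
  el.1.2.2 <= el'.1.2.1 \/ el'.1.2.2 <= el.1.2.1 -> apart el el'.
Proof.
case: el el' => [[d [a b]] f] [[d' [a' b']] f'] /= -> [] le.
  by rewrite /apart /= !eqxx le.
by rewrite /apart /= !eqxx le orbT.
Qed.

Lemma valid_triangle k e b l : List.In k frames -> 0 < e ->
  valid_pattern (triangle_pattern k e b l).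
Proof.
move=> kf e0; have [dF dG dH] := fr_directions kf; have [FG FH GH] := fr_distinct kf.
have le0 : 0 <= l%:R * e by rewrite mulr_ge0 // ltW.
rewrite /valid_pattern /triangle_pattern; apply/andP; split.
  by rewrite /= dF dG dH -!natr1 /= ?andbT; do ?[apply/andP; split]; lra.
by rewrite /= ?andbT; do ?[apply/andP; split];
  solve [exact: apart_neq | (rewrite apart_neq // eq_sym //)
   | (apply: apart_le => //=; rewrite -!natr1; lra)].
Qed.

Lemma valid_nontriangle k e b f l : List.In k frames -> 0 < e ->
  valid_pattern (nontriangle_pattern k e b f l).
Proof.
move=> kf e0; have [dF dG dH] := fr_directions kf; have [FG FH GH] := fr_distinct kf.
have le0 : 0 <= l%:R * e by rewrite mulr_ge0 // ltW.
case: f; rewrite /valid_pattern /nontriangle_pattern /= ?addn0 ?addn1; apply/andP; split.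
- by rewrite /= dF dG dH -!natr1 /= ?andbT; do ?[apply/andP; split]; lra.
- by rewrite /= ?andbT; do ?[apply/andP; split];
  solve [exact: apart_neq | (rewrite apart_neq // eq_sym //)
   | (apply: apart_le => //=; rewrite -!natr1; lra)].
- by rewrite /= dF dG dH -!natr1 /= ?andbT; do ?[apply/andP; split]; lra.
- by rewrite /= ?andbT; do ?[apply/andP; split];
  solve [exact: apart_neq | (rewrite apart_neq // eq_sym //)
   | (apply: apart_le => //=; rewrite -!natr1; lra)].
Qed.

Lemma valid_sub k e b : List.In k frames -> 0 < e -> valid_pattern (sub_pattern k e b).
Proof.
move=> kf e0; have [dF dG dH] := fr_directions kf; have [FG FH GH] := fr_distinct kf.
rewrite /valid_pattern /sub_pattern; apply/andP; split.
  by rewrite /= dF dG dH /= ?andbT; do ?[apply/andP; split]; lra.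
by rewrite /= !apart_neq.
Qed.

(** In each direction the strips have total length at most [(l + 4) * e] and the weights add up to
    1, so the exponents add up to at most [(l + 4) * e]; the 6 leaves some slack. *)
Lemma triangle_probability_ge k e b l : List.In k frames -> 0 < e ->
  (((wF k * e) * (wG k * e) * (wH k * e) * expR (- (l.+4.+2%:R * e)))%:E <=
  P (pattern X (triangle_pattern k e b l)))%E.
Proof.
move=> kf e0; have [_ ->] := pattern_probability hX (valid_triangle b l kf e0).
have [a0 b0 c0] : [/\ 0 < wF k, 0 < wG k & 0 < wH k] by split; exact: weight_gt0.
have abc := fr_weights p q kf.
rewrite lee_fin /triangle_pattern !big_cons big_nil /pattern_weight /= mulr1.
have e0' := ltW e0; have le0 : 0 <= l%:R * e by rewrite mulr_ge0.
have -> : b.1 + e - b.1 = e by ring.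
have -> : b.2 + e - b.2 = e by ring.
have -> : b.1 + b.2 + l.+3%:R * e - (b.1 + b.2 + l.+2%:R * e) = e by rewrite -!natr1; ring.
have -> : b.1 + l.+4%:R * e - (b.1 + e) = l.+3%:R * e by rewrite -!natr1; ring.
have -> : b.2 + l.+4%:R * e - (b.2 + e) = l.+3%:R * e by rewrite -!natr1; ring.
have -> : b.1 + b.2 + l.+2%:R * e - (b.1 + b.2) = l.+2%:R * e by rewrite -!natr1; ring.
have ab1 : wF k * e + wG k * e <= e by rewrite -mulrDl -[leRHS]mul1r ler_wpM2r //; lra.
apply: pattern_weight3; rewrite ?mulr_ge0 ?ltW //.
have -> : wH k = 1 - wF k - wG k by lra.
have ae : 0 <= wF k * e by rewrite mulr_ge0 // ltW.
have be : 0 <= wG k * e by rewrite mulr_ge0 // ltW.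
rewrite -!natr1; lra.
Qed.

Lemma nontriangle_probability_ge k e b f l : List.In k frames -> 0 < e ->
  (((wF k * e) * (wG k * e) * ((if f then wF k else wG k) * e) *
    expR (- (l.+4.+2%:R * e)))%:E <=
  P (pattern X (nontriangle_pattern k e b f l)))%E.
Proof.
move=> kf e0; have [_ ->] := pattern_probability hX (valid_nontriangle b f l kf e0).
have [a0 b0 c0] : [/\ 0 < wF k, 0 < wG k & 0 < wH k] by split; exact: weight_gt0.
have abc := fr_weights p q kf.
rewrite lee_fin /nontriangle_pattern !big_cons big_nil /pattern_weight mulr1.
have e0' := ltW e0; have le0 : 0 <= l%:R * e by rewrite mulr_ge0.
have ae : 0 <= wF k * e by rewrite mulr_ge0 // ltW.
have be : 0 <= wG k * e by rewrite mulr_ge0 // ltW.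
have ale : 0 <= wF k * (l%:R * e) by rewrite mulr_ge0 // ltW.
have ble : 0 <= wG k * (l%:R * e) by rewrite mulr_ge0 // ltW.
have cE : wH k = 1 - wF k - wG k by lra.
have ab1 : wF k * e + wG k * e <= e by rewrite -mulrDl -[leRHS]mul1r ler_wpM2r //; lra.
have d1 : b.1 + e - b.1 = e by ring.
have d2 : b.2 + e - b.2 = e by ring.
have d6 : b.1 + b.2 + l.+4%:R * e - (b.1 + b.2) = l.+4%:R * e by rewrite -!natr1; ring.
case: f; rewrite /= ?addn0 ?addn1 d1 d2 d6.
  have -> : b.1 + l.+2%:R * e - (b.1 + l.+1%:R * e) = e by rewrite -!natr1; ring.
  have -> : b.1 + l.+1%:R * e - (b.1 + e) = l%:R * e by rewrite -!natr1; ring.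
  have -> : b.2 + l.+2%:R * e - (b.2 + e) = l.+1%:R * e by rewrite -!natr1; ring.
  apply: pattern_weight3; rewrite ?mulr_ge0 ?ltW //.
  by rewrite cE -!natr1; lra.
have -> : b.2 + l.+2%:R * e - (b.2 + l.+1%:R * e) = e by rewrite -!natr1; ring.
have -> : b.1 + l.+2%:R * e - (b.1 + e) = l.+1%:R * e by rewrite -!natr1; ring.
have -> : b.2 + l.+1%:R * e - (b.2 + e) = l%:R * e by rewrite -!natr1; ring.
apply: pattern_weight3; rewrite ?mulr_ge0 ?ltW //.
by rewrite cE -!natr1; lra.
Qed.

(** The exponents add up to at most [2 * e]; the weaker factor [1 - 7 * e] agrees with the one that
    [sum_expR_ge] gives for the other families. *)
Lemma sub_probability_ge k e b : List.In k frames -> 0 < e ->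
  (((wF k * e) * (wG k * e) * (1 - 7 * e))%:E <= P (pattern X (sub_pattern k e b)))%E.
Proof.
move=> kf e0; have [_ ->] := pattern_probability hX (valid_sub b kf e0).
have [a0 b0 c0] : [/\ 0 < wF k, 0 < wG k & 0 < wH k] by split; exact: weight_gt0.
have abc := fr_weights p q kf.
rewrite lee_fin /sub_pattern !big_cons big_nil /pattern_weight /= mulr1.
have e0' := ltW e0.
have ae : 0 <= wF k * e by rewrite mulr_ge0 // ltW.
have be : 0 <= wG k * e by rewrite mulr_ge0 // ltW.
have -> : b.1 + e - b.1 = e by ring.
have -> : b.2 + e - b.2 = e by ring.
have -> : b.2 - b.1 + e - (b.2 - b.1 - e) = 2 * e by ring.
apply: (@le_trans _ _ ((wF k * e * expR (- (wF k * e))) *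
   ((wG k * e * expR (- (wG k * e))) * expR (- (wH k * (2 * e)))))).
  rewrite [leRHS](_ : _ = wF k * e * (wG k * e) * (expR (- (wF k * e)) *
    expR (- (wG k * e)) * expR (- (wH k * (2 * e))))); last by ring.
  apply: ler_wpM2l; first exact: mulr_ge0.
  rewrite -!expRD; apply: le_trans (expR_ge1Dx _).
  have -> : wH k = 1 - wF k - wG k by lra.
  lra.
apply: ler_pM; [by rewrite mulr_ge0 ?expR_ge0|by rewrite mulr_ge0 ?expR_ge0 // mulr_ge0 ?expR_ge0|exact: mul_expRN_le|].
by apply: ler_pM; [rewrite mulr_ge0 ?expR_ge0|exact: expR_ge0|exact: mul_expRN_le|exact: lexx].
Qed.

(** The index records the first cell hit by [H]: a hit for [l < l'] falls in the strip that the
    pattern of [l'] keeps empty. *)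
Lemma triangle_pattern_inj k e b l l' w : 0 < e ->
  pattern X (triangle_pattern k e b l) w -> pattern X (triangle_pattern k e b l') w -> l = l'.
Proof.
move=> e0; wlog ll' : l l' / (l < l')%N.
  move=> H pl pl'; have [/H|/H E|//] := ltngtP l l'; first by apply.
  by apply/esym/E.
move=> /pattern_cons[_ /pattern_cons[_ /pattern_cons[/= Hl _]]].
do 5 (move=> /pattern_cons[_ ]); move=> /pattern_cons[/= nHl' _]; case: nHl'.
apply: hit_sub Hl; first by rewrite lerDl mulr_ge0 // ltW.
by rewrite lerD2l ler_pM2r // ler_nat.
Qed.

(** The index records the first cell after the box hit by [F] or [G], and by which one. The other
    direction must be empty up to and including that cell, so simultaneous hits belong to neither
    kind. *)
Lemma nontriangle_pattern_inj k e b f f' l l' w : 0 < e ->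
  pattern X (nontriangle_pattern k e b f l) w ->
  pattern X (nontriangle_pattern k e b f' l') w -> (f, l) = (f', l').
Proof.
move=> e0; wlog : f f' l l' / (l <= l')%N.
  move=> H pl pl'; have [/H|/ltnW/H E] := leqP l l'; first by apply.
  by apply/esym/E.
have hits (x : R) : x + e <= x + l.+1%:R * e.
  by rewrite lerD2l -[leLHS]mul1r ler_pM2r // ler1n.
have hits' (x : R) (m : nat) : (l.+2 <= m)%N -> x + l.+2%:R * e <= x + m%:R * e.
  by move=> lm; rewrite lerD2l ler_pM2r // ler_nat.
move=> ll' /pattern_cons[_ /pattern_cons[_ /pattern_cons[h1 /pattern_cons[/= h2 /pattern_cons[/= h3 _]]]]].
move=> /pattern_cons[_ /pattern_cons[_ /pattern_cons[h1' /pattern_cons[/= h2' /pattern_cons[/= h3' _]]]]].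
have [E|neq] := eqVneq (f, l) (f', l') => //; exfalso.
have {}neq : (l < l')%N \/ l = l' /\ f' = ~~ f.
  move: ll'; rewrite leq_eqVlt => /predU1P[ll'|]; [right|by left].
  by split => //; move: neq; rewrite ll'; case: f f' {h1 h2 h3 h1' h2' h3'} => -[]; rewrite ?eqxx.
case: f h1 h2 h3 neq => h1 h2 h3 neq.
  apply: h2'; apply: hit_sub h1 => //; apply: hits'.
  by case: neq => [|[-> ->]]; rewrite ?addn1 //; case: (f'); rewrite /= ?addn0 ?addn1; lia.
apply: h3'; apply: hit_sub h1 => //; apply: hits'.
by case: neq => [|[-> ->]]; rewrite ?addn1 //; case: (f'); rewrite /= ?addn0 ?addn1; lia.
Qed.

(** In each box, mutually exclusive patterns force a suitable corner and have total probability at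
    least [m]. Exclusivity lets their indicators be added without exceeding 1 per box. *)
Definition box_family k A e (I : finType) (pats : R * R -> I -> seq ((R * R) * (R * R) * bool))
    (bs : seq (R * R)) (m : R) :=
  [/\ separated_boxes e bs, forall b i, valid_pattern (pats b i),
      forall b i j w, pattern X (pats b i) w -> pattern X (pats b j) w -> i = j,
      forall b i w, good (X w) -> b \in bs -> pattern X (pats b i) w ->
        corner_box k (X w) A e b &
      forall b, (m%:E <= \sum_(i : I) P (pattern X (pats b i)))%E].

Lemma triangle_family k e n bs : List.In k frames -> fr_lam k = 1 -> fr_mu k = 1 ->
  (0 < n)%N -> e = n%:R^-1 -> separated_boxes e bs ->
  (forall b, b \in bs -> forall u v, in_box e b u v -> unit_square (fr_pt k u v)) ->
  @box_family k (@triangle R) e 'I_(n * n) (fun b i => triangle_pattern k e b i) bs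
    (wF k * wG k * wH k * e ^+ 2 * (1 - 7 * e)).
Proof.
move=> kf lk mk n0 eE sbs sq; have e0 : 0 < e by rewrite eE invr_gt0 ltr0n.
split => //.
- by move=> b i; exact: valid_triangle.
- by move=> b i j w pi pj; apply/val_inj/(triangle_pattern_inj e0 pi pj).
- move=> b i w gw bbs.
  move=> /pattern_cons[h1 /pattern_cons[h2 /pattern_cons[h3 /pattern_cons[h4]]]].
  move=> /pattern_cons[h5 /pattern_cons[h6 _]].
  exact: (triangle_box gw kf lk mk e0 (sq _ bbs) h1 h2 h3 h4 h5 h6).
move=> b; apply: (@le_trans _ _ (\sum_(i < n * n)
   ((wF k * e) * (wG k * e) * (wH k * e) * expR (- (i.+4.+2%:R * e)))%:E)%E); last first.
  by apply: lee_sum => i _; exact: triangle_probability_ge.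
rewrite sumEFin lee_fin -mulr_sumr.
rewrite [leRHS](_ : _ = wF k * wG k * wH k * e ^+ 2 *
  (e * \sum_(i < n * n) expR (- (i.+4.+2%:R * e)))); last by ring.
rewrite ler_wpM2l ?sum_expR_ge // !mulr_ge0 ?exprn_ge0 ?(ltW e0) // ltW // weight_gt0 //.
Qed.

Lemma nontriangle_family k e n bs : List.In k frames -> fr_lam k = 1 -> fr_mu k = 1 ->
  (0 < n)%N -> e = n%:R^-1 -> separated_boxes e bs ->
  (forall b, b \in bs -> forall u v, in_box e b u v -> unit_square (fr_pt k u v)) ->
  @box_family k (~` @triangle R) e (bool * 'I_(n * n))%type
    (fun b i => nontriangle_pattern k e b i.1 i.2) bs
    (wF k * wG k * (wF k + wG k) * e ^+ 2 * (1 - 7 * e)).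
Proof.
move=> kf lk mk n0 eE sbs sq; have e0 : 0 < e by rewrite eE invr_gt0 ltr0n.
split => //.
- by move=> b i; exact: valid_nontriangle.
- move=> b [f i] [g j] w pi pj; have [-> ij] := nontriangle_pattern_inj e0 pi pj.
  by congr pair; exact: val_inj.
- move=> b [f i] w gw bbs.
  move=> /pattern_cons[h1 /pattern_cons[h2 /pattern_cons[h3 /pattern_cons[_]]]].
  move=> /pattern_cons[_ /pattern_cons[h6 _]]; case: f h3 h6 => h3 h6.
    exact: (nontriangle_box_F gw kf lk mk e0 (sq _ bbs) h1 h2 h3 h6).
  exact: (nontriangle_box_G gw kf lk mk e0 (sq _ bbs) h1 h2 h3 h6).
move=> b; rewrite -(pair_bigA _ (fun f i => P (pattern X (nontriangle_pattern k e b f (nat_of_ord i))))) /=.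
apply: (@le_trans _ _ (\sum_(f : bool) \sum_(i < n * n)
   ((wF k * e) * (wG k * e) * ((if f then wF k else wG k) * e) *
    expR (- (i.+4.+2%:R * e)))%:E)%E); last first.
  by apply: lee_sum => f _; apply: lee_sum => i _; exact: nontriangle_probability_ge.
rewrite big_bool /= !sumEFin -EFinD lee_fin -!mulr_sumr.
rewrite [leRHS](_ : _ = wF k * wG k * (wF k + wG k) * e ^+ 2 *
  (e * \sum_(i < n * n) expR (- (i.+4.+2%:R * e)))); last by ring.
have [a0 b0] : 0 < wF k /\ 0 < wG k by split; exact: weight_gt0.
by rewrite ler_wpM2l ?sum_expR_ge // !mulr_ge0 ?addr_ge0 ?exprn_ge0 ?(ltW e0) // ltW.
Qed.

Lemma sub_family k e bs : List.In k frames -> fr_lam k = -1 -> fr_mu k = 1 ->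
  0 < e -> separated_boxes e bs ->
  (forall b, b \in bs -> forall u v, in_box e b u v -> unit_square (fr_pt k u v)) ->
  @box_family k (~` @triangle R) e 'I_1 (fun b i => sub_pattern k e b) bs
    (wF k * wG k * e ^+ 2 * (1 - 7 * e)).
Proof.
move=> kf lk mk e0 sbs sq; split => //.
- by move=> b i; exact: valid_sub.
- by move=> b i j w _ _; rewrite !ord1.
- move=> b i w gw bbs /pattern_cons[h1 /pattern_cons[h2 /pattern_cons[h3 _]]].
  exact: (nontriangle_box_sub gw kf lk mk e0 (sq _ bbs) h1 h2 h3).
move=> b; rewrite big_ord1; apply: le_trans (sub_probability_ge b kf e0).
by rewrite lee_fin le_eqVlt; apply/orP; left; apply/eqP; ring.
Qed.

(** Fills the slot of [frame12] in the count of triangles, to which its crossings contribute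
    nothing. *)
Lemma empty_family k A e : @box_family k A e 'I_0 (fun _ _ => [::]) [::] 0.
Proof. by split => //; [move=> b []|move=> b; rewrite big_ord0]. Qed.

Definition minorant (I : finType) (pats : R * R -> I -> seq ((R * R) * (R * R) * bool))
    (bs : seq (R * R)) (w : T) : \bar R :=
  (\sum_(b <- bs) \sum_(i : I) (\1_(pattern X (pats b i)) w)%:E)%E.

Lemma minorant_ge0 I pats bs w : (0 <= @minorant I pats bs w)%E.
Proof. by apply: sume_ge0 => b _; apply: sume_ge0 => i _; rewrite lee_fin. Qed.

Lemma measurable_minorant k A e I pats bs m : @box_family k A e I pats bs m ->
  measurable_fun setT (minorant pats bs).
Proof.
move=> [_ val _ _ _]; apply: emeasurable_sum => b; apply: emeasurable_sum => i.
apply/measurable_EFinP/measurable_indic.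
by have [] := pattern_probability hX (val b i).
Qed.

Lemma integral_minorant k A e I pats bs m : @box_family k A e I pats bs m ->
  (((size bs)%:R * m)%:E <= \int[P]_w minorant pats bs w)%E.
Proof.
move=> [_ val _ _ mP].
have mpat b i : measurable (pattern X (pats b i)).
  by have [] := pattern_probability hX (val b i).
have mind b i : measurable_fun setT (fun w => (\1_(pattern X (pats b i)) w)%:E : \bar R).
  by apply/measurable_EFinP; exact: measurable_indic.
rewrite ge0_integral_sum //; last 2 first.
- by move=> b; exact: emeasurable_sum.
- by move=> b w _; apply: sume_ge0 => i _; rewrite lee_fin.
rewrite -[size bs]sum1_size natr_sum mulr_suml -sumEFin.
apply: lee_sum => b _; rewrite mul1r; apply: le_trans (mP b) _.
rewrite ge0_integral_sum //.
by apply: lee_sum => i _; rewrite integral_indic // setIT.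
Qed.

Lemma minorant_le k A e I pats bs m w : @box_family k A e I pats bs m -> good (X w) ->
  (minorant pats bs w <= (size [seq b <- bs | `[< corner_box k (X w) A e b >]])%:R%:E)%E.
Proof.
move=> [_ _ inj box _] gw.
rewrite size_filter -sum1_count natr_sum -sumEFin big_mkcond /minorant.
rewrite big_seq [leRHS]big_seq; apply: lee_sum => b bbs.
have [[i pi]|npi] := pselect (exists i, pattern X (pats b i) w).
  rewrite (asboolT (box _ _ _ gw bbs pi)) (bigD1 i) //= big1 ?adde0.
    by rewrite lee_fin indicE; case: (_ \in _).
  move=> j ji; rewrite indicE memNset // => pj.
  by rewrite (inj _ _ _ _ pi pj) eqxx in ji.
rewrite big1 => [|i _]; first by case: ifP => _; rewrite lee_fin.
by rewrite indicE memNset // => pi; apply: npi; exists i.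
Qed.

Lemma families_minorant A e I0 I1 I2 pats0 pats1 pats2 bs0 bs1 bs2 m0 m1 m2 :
  @box_family frame01 A e I0 pats0 bs0 m0 -> @box_family frame02 A e I1 pats1 bs1 m1 ->
  @box_family frame12 A e I2 pats2 bs2 m2 ->
  exists g : T -> \bar R, [/\ measurable_fun setT g, forall w, (0 <= g w)%E,
    forall w, good (X w) -> (g w <= counting (marked_cells (X w) A))%E &
    (((size bs0)%:R * m0 + (size bs1)%:R * m1 + (size bs2)%:R * m2)%:E <= \int[P]_w g w)%E].
Proof.
move=> F0 F1 F2.
exists (fun w => minorant pats0 bs0 w + minorant pats1 bs1 w + minorant pats2 bs2 w)%E.
have mm0 := measurable_minorant F0; have mm1 := measurable_minorant F1.
have mm2 := measurable_minorant F2.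
have g0 := @minorant_ge0.
split.
- by apply: emeasurable_funD => //; exact: emeasurable_funD.
- by move=> w; rewrite !adde_ge0.
- move=> w gw; have [sb0 _ _ _ _] := F0; have [sb1 _ _ _ _] := F1; have [sb2 _ _ _ _] := F2.
  apply: le_trans (counting_boxes A gw sb0 sb1 sb2).
  rewrite !natrD !EFinD.
  by apply: leeD; [apply: leeD|]; [exact: minorant_le F0 gw|exact: minorant_le F1 gw|exact: minorant_le F2 gw].
rewrite ge0_integralD //; last 2 first.
- by move=> w _; rewrite adde_ge0.
- exact: emeasurable_funD.
rewrite ge0_integralD // !EFinD.
by apply: leeD; [apply: leeD|]; [exact: integral_minorant F0|exact: integral_minorant F1|exact: integral_minorant F2].
Qed.

End Minorants.

(** * Mean numbers of cells *)

Lemma counting_disjoint_le {R : realType} {T : choiceType} (A B C : set T) :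
  A `&` B = set0 -> A `|` B `<=` C ->
  (counting A + counting B <= counting C :> \bar R)%E.
Proof.
move=> AB0 ABC; rewrite {3}/counting; case: asboolP => [fC|_]; last exact: leey.
have fAB := sub_finite_set ABC fC.
have [fA fB] : finite_set A /\ finite_set B by move: fAB; rewrite finite_setU.
rewrite /counting !asboolT // -EFinD -natrD lee_fin ler_nat -cardfsUI.
rewrite -fset_setU // -fset_setI // AB0 fset_set0 cardfs0 addn0.
by apply: fsubset_leq_card; rewrite -fset_set_sub.
Qed.

Lemma mem_In (T : eqType) (x : T) (s : seq T) : x \in s -> List.In x s.
Proof. by elim: s => //= y s IH; rewrite inE => /predU1P[->|/IH]; [left|right]. Qed.

(** Estimates are available only for [n >= 7], where the factor [1 - 7 / n] of the minorants is
    nonnegative. *)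
Lemma le_of_sub_inv {R : realType} (x y C : R) :
  (forall n, (7 <= n)%N -> x - C * n%:R^-1 <= y) -> x <= y.
Proof.
move=> H; apply/ler_addgt0Pr => e e0.
pose n := maxn 7 (Num.truncn (C / e)).+1.
have n7 : (7 <= n)%N by rewrite leq_maxl.
have n0 : 0 < n%:R :> R by rewrite ltr0n (leq_trans _ n7).
have Cn : C / e < n%:R.
  by apply: (lt_le_trans (truncnS_gt _)); rewrite ler_nat leq_maxr.
rewrite ltr_pdivrMr // mulrC -ltr_pdivrMr // in Cn.
by have := H _ n7; move: Cn; lra.
Qed.

Lemma ge0_add3 d (T : measurableType d) (R : realType) (P : {measure set T -> \bar R})
    (f g h : T -> \bar R) : (forall x, 0 <= f x)%E -> (forall x, 0 <= g x)%E ->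
  (forall x, 0 <= h x)%E ->
  measurable_fun setT f -> measurable_fun setT g -> measurable_fun setT h ->
  measurable_fun setT (fun x => f x + g x + h x)%E /\
  (\int[P]_x (f x + g x + h x) = \int[P]_x f x + \int[P]_x g x + \int[P]_x h x)%E.
Proof.
move=> f0 g0 h0 mf mg mh; have mfg : measurable_fun setT (fun x => f x + g x)%E.
  exact: emeasurable_funD.
split; first exact: emeasurable_funD.
rewrite ge0_integralD // ?ge0_integralD // => x _.
by rewrite adde_ge0.
Qed.

Section Means.
Context {R : realType} {dT : measure_display} {T : measurableType dT}.
Context (P : probability T R) (p q : R) (pq : admissible p q) (X : T -> set (R * R)).
Hypothesis hX : poisson_line_process P 1%:pos (G3 pq) X.

Local Notation s := (sin (pi / 3 : R)).
Local Notation r := (1 - p - q).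
Local Notation pairs := (p * q + p * r + q * r).

Let pqr_gt0 : [/\ 0 < p, 0 < q & 0 < r].
Proof. by have [/andP[p0 p1] /andP[q0 q1] /andP[_ pq1]] := and3P pq; split; lra. Qed.

Lemma weights02 : [/\ weight p q (fr_F (@frame02 R)) = p, weight p q (fr_G (@frame02 R)) = r &
  weight p q (fr_H (@frame02 R)) = q].
Proof. by have [w0 w1 w2] := weights01 p q; split. Qed.

Lemma weights12 : [/\ weight p q (fr_F (@frame12 R)) = q, weight p q (fr_G (@frame12 R)) = r &
  weight p q (fr_H (@frame12 R)) = p].
Proof. by have [w0 w1 w2] := weights01 p q; split. Qed.

Let in01 : List.In (@frame01 R) frames. Proof. by left. Qed.
Let in02 : List.In (@frame02 R) frames. Proof. by right; left. Qed.
Let in12 : List.In (@frame12 R) frames. Proof. by right; right; left. Qed.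

Let pair_points (k : @frame R) (rs : seq ((R * R) * (R * R))) (w : T) : \bar R :=
  (\sum_(t <- rs) npoints X (rect (fr_F k) t.1.1 t.1.2) w *
                  npoints X (rect (fr_G k) t.2.1 t.2.2) w)%E.

Let pair_points_ge0 k rs w : (0 <= pair_points k rs w)%E.
Proof. by apply: sume_ge0 => t _; rewrite mule_ge0 ?npoints_ge0. Qed.

Let measurable_pair_points k rs : List.In k frames ->
  measurable_fun setT (pair_points k rs).
Proof.
move=> kf; have [dF dG _] := fr_directions kf.
by apply: emeasurable_sum => t; apply: emeasurable_funM; exact: (measurable_npoints hX).
Qed.

Let mean_pair_points n k rs : (0 < n)%N -> List.In k frames -> covers n k rs ->
  (\int[P]_w pair_points k rs w <=
   (weight p q (fr_F k) * weight p q (fr_G k) * (s + 7 * n%:R^-1))%:E)%E.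
Proof.
move=> n0 kf [rsle _ area]; have [dF dG _] := fr_directions kf.
have [FG _ _] := fr_distinct kf.
rewrite ge0_integral_sum //; last 2 first.
- by move=> t; apply: emeasurable_funM; exact: (measurable_npoints hX).
- by move=> t w _; rewrite mule_ge0 ?npoints_ge0.
apply: (@le_trans _ _ (\sum_(t <- rs) ((weight p q (fr_F k) * (t.1.2 - t.1.1)) *
  (weight p q (fr_G k) * (t.2.2 - t.2.1)))%:E)%E).
  rewrite big_seq [leRHS]big_seq; apply: lee_sum => t trs; have [t1 t2] := rsle _ trs.
  exact: (mean_npoints_prod hX).
rewrite sumEFin lee_fin (eq_bigr (fun t : (R * R) * (R * R) =>
  weight p q (fr_F k) * weight p q (fr_G k) * ((t.1.2 - t.1.1) * (t.2.2 - t.2.1)))); last first.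
  by move=> t _; ring.
by rewrite -mulr_sumr ler_wpM2l // mulr_ge0 // ltW // weight_gt0.
Qed.

(** The same [V] serves for every [A]: it counts crossings of pairs of lines, whatever the shape of
    their cells. *)
Lemma majorant n : (0 < n)%N -> exists V : T -> \bar R,
  [/\ measurable_fun setT V, forall w, (0 <= V w)%E,
   forall w A, good (X w) -> (counting (marked_cells (X w) A) <= V w)%E &
   (\int[P]_w V w <= (pairs * (s + 7 * n%:R^-1))%:E)%E].
Proof.
move=> n0.
have /choice[rs rsP] : forall k : @frame R, exists rs, List.In k frames -> covers n k rs.
  move=> k; have [kf|] := pselect (List.In k frames); last by exists [::].
  suff [rs rsP] : exists rs, covers n k rs by exists rs.
  case: kf => [<-|[<-|[<-|[]]]].
  - exact: cover_frame01.
  - exact: cover_frame02.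
  - exact: cover_frame12.
exists (fun w => pair_points frame01 (rs frame01) w + pair_points frame02 (rs frame02) w +
  pair_points frame12 (rs frame12) w)%E.
have m01 := measurable_pair_points (rs frame01) in01.
have m02 := measurable_pair_points (rs frame02) in02.
have m12 := measurable_pair_points (rs frame12) in12.
split.
- exact: (ge0_add3 P (pair_points_ge0 _ _) (pair_points_ge0 _ _) (pair_points_ge0 _ _) m01 m02 m12).1.
- by move=> w; rewrite !adde_ge0.
- move=> w A gw; apply: le_trans (@marked_cells_le _ _ A rs gw _) _.
    move=> k kf u v um; have [_ cov _] := rsP _ kf.
    by have [t trs tuv] := cov _ _ um; exists t => //; exact: mem_In.
  by rewrite /frames 3!big_cons big_nil adde0 addeA.
rewrite (ge0_add3 P (pair_points_ge0 _ _) (pair_points_ge0 _ _) (pair_points_ge0 _ _) m01 m02 m12).2 //.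
have [w0 w1 _] := weights01 p q; have [w2 w3 _] := weights02; have [w4 w5 _] := weights12.
rewrite (_ : pairs * _ = p * q * (s + 7 * n%:R^-1) + p * r * (s + 7 * n%:R^-1) +
  q * r * (s + 7 * n%:R^-1)); last by ring.
rewrite !EFinD; apply: leeD; [apply: leeD|].
- by have := mean_pair_points n0 in01 (rsP _ in01); rewrite w0 w1.
- by have := mean_pair_points n0 in02 (rsP _ in02); rewrite w2 w3.
- by have := mean_pair_points n0 in12 (rsP _ in12); rewrite w4 w5.
Qed.

(** The constant 11 is 4 from the area of the boxes plus 7 from the pattern probabilities:
    [(s - 4 * e) * (1 - 7 * e) >= s - 11 * e] because [s <= 1]. *)
Let mass_le (m e W : R) (N : nat) : 0 <= m -> 7 * e <= 1 -> 0 < e -> W = m * e ^+ 2 * (1 - 7 * e) ->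
  s - 4 * e <= N%:R * e ^+ 2 -> m * (s - 11 * e) <= N%:R * W.
Proof.
move=> m0 e7 e0 -> sN; have s1 := @s_le1 R.
rewrite (_ : _ * (_ * _) = m * ((N%:R * e ^+ 2) * (1 - 7 * e))); last by ring.
apply: ler_wpM2l => //; apply: (@le_trans _ _ ((s - 4 * e) * (1 - 7 * e))).
  have se : s * e <= e by rewrite -[leRHS]mul1r ler_wpM2r // ltW.
  have ee : 0 <= e * e by rewrite mulr_ge0 // ltW.
  lra.
by apply: ler_wpM2r => //; lra.
Qed.

Lemma triangle_minorant n : (7 <= n)%N -> exists g : T -> \bar R,
  [/\ measurable_fun setT g, forall w, (0 <= g w)%E,
   forall w, good (X w) -> (g w <= counting (marked_cells (X w) (@triangle R)))%E &
   ((2 * p * q * r * (s - 11 * n%:R^-1))%:E <= \int[P]_w g w)%E].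
Proof.
move=> n7; have n0 : (0 < n)%N by exact: leq_trans n7.
have e0 : 0 < n%:R^-1 :> R by rewrite invr_gt0 ltr0n.
have e7 : 7 * n%:R^-1 <= 1 :> R by rewrite ler_pdivrMr ?ltr0n // mul1r ler_nat.
have [bs0 [sep0 in0 size0]] := @boxes_frame01 R n n0.
have [bs1 [sep1 in1 size1]] := @boxes_frame02 R n n0.
have F0 := triangle_family hX in01 erefl erefl n0 erefl sep0 in0.
have F1 := triangle_family hX in02 erefl erefl n0 erefl sep1 in1.
have F2 := empty_family P X frame12 (@triangle R) n%:R^-1.
have [g [mg g0 gle gint]] := families_minorant hX F0 F1 F2.
exists g; split => //; apply: le_trans gint; rewrite lee_fin.
have [w0 w1 w2] := weights01 p q; have [w3 w4 w5] := weights02.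
have [p0 q0 r0] := pqr_gt0.
rewrite ?w0 ?w1 ?w2 ?w3 ?w4 ?w5 mulr0 addr0.
have pqr0 : 0 <= p * q * r by rewrite !mulr_ge0 // ltW.
have H0 := mass_le pqr0 e7 e0 erefl size0.
have H1 := mass_le pqr0 e7 e0 erefl size1.
rewrite [p * r * q]mulrAC; lra.
Qed.

Lemma nontriangle_minorant n : (7 <= n)%N -> exists g : T -> \bar R,
  [/\ measurable_fun setT g, forall w, (0 <= g w)%E,
   forall w, good (X w) -> (g w <= counting (marked_cells (X w) (~` @triangle R)))%E &
   (((pairs - 2 * p * q * r) * (s - 11 * n%:R^-1))%:E <= \int[P]_w g w)%E].
Proof.
move=> n7; have n0 : (0 < n)%N by exact: leq_trans n7.
have e0 : 0 < n%:R^-1 :> R by rewrite invr_gt0 ltr0n.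
have e7 : 7 * n%:R^-1 <= 1 :> R by rewrite ler_pdivrMr ?ltr0n // mul1r ler_nat.
have [bs0 [sep0 in0 size0]] := @boxes_frame01 R n n0.
have [bs1 [sep1 in1 size1]] := @boxes_frame02 R n n0.
have [bs2 [sep2 in2 size2]] := @boxes_frame12 R n n0.
have F0 := nontriangle_family hX in01 erefl erefl n0 erefl sep0 in0.
have F1 := nontriangle_family hX in02 erefl erefl n0 erefl sep1 in1.
have F2 := sub_family hX in12 erefl erefl e0 sep2 in2.
have [g [mg g0 gle gint]] := families_minorant hX F0 F1 F2.
exists g; split => //; apply: le_trans gint; rewrite lee_fin.
have [w0 w1 _] := weights01 p q; have [w3 w4 _] := weights02; have [w6 w7 _] := weights12.
have [p0 q0 r0] := pqr_gt0.
rewrite ?w0 ?w1 ?w3 ?w4 ?w6 ?w7.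
have [p0' q0' r0'] : [/\ 0 <= p, 0 <= q & 0 <= r] by split; exact: ltW.
have m0 : 0 <= p * q * (p + q) by apply: mulr_ge0; [exact: mulr_ge0|exact: addr_ge0].
have m1 : 0 <= p * r * (p + r) by apply: mulr_ge0; [exact: mulr_ge0|exact: addr_ge0].
have m2 : 0 <= q * r by exact: mulr_ge0.
have H0 := mass_le m0 e7 e0 erefl size0.
have H1 := mass_le m1 e7 e0 erefl size1.
have H2 := mass_le m2 e7 e0 erefl size2.
(* The complementary probabilities: [p + q = 1 - r] for [frame01], [p + r = 1 - q] for [frame02],
   and 1 for [frame12]. *)
rewrite [leLHS](_ : _ = p * q * (p + q) * (s - 11 * n%:R^-1) +
  p * r * (p + r) * (s - 11 * n%:R^-1) + q * r * (s - 11 * n%:R^-1)); last by ring.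
by apply: lerD; [apply: lerD|]; [exact: H0|exact: H1|exact: H2].
Qed.

Lemma mean_cells_ge0 A : (0 <= mean_cells P X A)%E.
Proof. by apply: integral_ge0 => w _; exact: counting_ge0. Qed.

Lemma mean_cells_fin A : mean_cells P X A \is a fin_num.
Proof.
have [V [mV V0 Vle Vint]] := majorant (ltn0Sn 0).
rewrite ge0_fin_numE ?mean_cells_ge0 //.
(* Adding the integral of 0 allows [ae_lower_integralD_le] to compare a nonmeasurable count with a
   measurable majorant that holds only almost everywhere. *)
suff H : (mean_cells P X A + 0 <= \int[P]_w V w)%E.
  by rewrite adde0 in H; apply: le_lt_trans H (le_lt_trans Vint (ltry _)).
rewrite addeC -[X in (X + _)%E](integral0 P setT).
apply: ae_lower_integralD_le => // [w|]; first exact: counting_ge0.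
by apply: filterS (ae_good hX) => w gw; rewrite add0e; exact: Vle.
Qed.

(** The second estimate acts as the upper bound for [t]: the nontriangles are replaced by their
    measurable minorant, the triangle count is kept as it is, and their sum stays below the majorant
    of all cells. The main terms leave [t <= 2 * p * q * r * s] up to a multiple of [1 / n]. *)
Lemma mean_cells_estimates n : (7 <= n)%N ->
  let t := fine (mean_cells P X (@triangle R)) in
  let a := fine (mean_cells P X setT) in
  [/\ 2 * p * q * r * (s - 11 * n%:R^-1) <= t,
      (pairs - 2 * p * q * r) * (s - 11 * n%:R^-1) + t <= pairs * (s + 7 * n%:R^-1),
      a <= pairs * (s + 7 * n%:R^-1) &
      pairs * (s - 11 * n%:R^-1) <= a].
Proof.
move=> n7 t a; have n0 : (0 < n)%N by exact: leq_trans n7.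
have tE : mean_cells P X (@triangle R) = t%:E by rewrite fineK // mean_cells_fin.
have aE : mean_cells P X setT = a%:E by rewrite fineK // mean_cells_fin.
have [V [mV V0 Vle Vint]] := majorant n0.
have [g [mg g0 gle gint]] := triangle_minorant n7.
have [f [mf f0 fle fint]] := nontriangle_minorant n7.
have disj L : (counting (marked_cells L (~` @triangle R)) +
    counting (marked_cells L (@triangle R)) <= counting (marked_cells L setT) :> \bar R)%E.
  apply: counting_disjoint_le.
    rewrite -subset0 => c [[_ [m [lm _ _ nt]]] [_ [m' [lm' _ _]]]].
    by rewrite -(lexmin_unique lm lm').
  by move=> c [|] [cc [m [lm m1 m2 _]]]; split => //; exists m.
have h1 : ((2 * p * q * r * (s - 11 * n%:R^-1))%:E <= t%:E)%E.
  rewrite -tE; apply: le_trans gint _; apply: ae_le_lower_integral => //.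
    by move=> w; exact: counting_ge0.
  by apply: filterS (ae_good hX) => w; exact: gle.
have h3 : (a%:E <= (pairs * (s + 7 * n%:R^-1))%:E)%E.
  apply: le_trans Vint; rewrite -aE -[leLHS]add0e -[X in (X + _)%E](integral0 P setT).
  apply: ae_lower_integralD_le => // [w|]; first exact: counting_ge0.
  by apply: filterS (ae_good hX) => w gw; rewrite add0e; exact: Vle.
have h2 : (((pairs - 2 * p * q * r) * (s - 11 * n%:R^-1))%:E + t%:E <=
    (pairs * (s + 7 * n%:R^-1))%:E)%E.
  rewrite -tE; apply: le_trans Vint; apply: le_trans (leeD2r _ fint) _.
  apply: ae_lower_integralD_le => // [w|]; first exact: counting_ge0.
  apply: filterS (ae_good hX) => w gw; apply: le_trans (Vle w setT gw).
  by apply: le_trans (disj (X w)); apply: leeD2r; exact: fle.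
have h4 : (((pairs - 2 * p * q * r) * (s - 11 * n%:R^-1))%:E +
    (2 * p * q * r * (s - 11 * n%:R^-1))%:E <= a%:E)%E.
  rewrite -aE; apply: le_trans (leeD fint gint) _; rewrite -ge0_integralD //.
  apply: ae_le_lower_integral.
  - exact: emeasurable_funD.
  - by move=> w; rewrite adde_ge0.
  - by move=> w; exact: counting_ge0.
  apply: filterS (ae_good hX) => w gw; apply: le_trans (disj (X w)).
  by apply: leeD; [exact: fle|exact: gle].
move: h1 h2 h3 h4; rewrite -!EFinD !lee_fin -mulrDl subrK => h1 h2 h3 h4.
by split.
Qed.

Lemma triangle_probabilityE :
  triangle_probability P X = 2 * p * q * r / (p + q - p ^+ 2 - q ^+ 2 - p * q).
Proof.
have [p0 q0 r0] := pqr_gt0; have s0 := @sin_pi3_gt0 R.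
set D := p + q - _ - _ - _; have DE : D = pairs by rewrite /D; ring.
have pairs0 : 0 < pairs by rewrite !addr_gt0 // mulr_gt0.
pose t := fine (mean_cells P X (@triangle R)).
pose a := fine (mean_cells P X setT).
have E n := @mean_cells_estimates n.
have aE : a = pairs * s.
  apply/eqP; rewrite eq_le; apply/andP; split.
    apply: (@le_of_sub_inv _ _ _ (pairs * 7)) => n n7; have [_ _ + _] := E n n7.
    by rewrite mulrDr mulrA lerBlDr.
  apply: (@le_of_sub_inv _ _ _ (pairs * 11)) => n n7; have [_ _ _] := E n n7.
  by rewrite mulrBr mulrA.
have tE : t = 2 * p * q * r * s.
  apply/eqP; rewrite eq_le; apply/andP; split.
    apply: (@le_of_sub_inv _ _ _ (pairs * 7 + (pairs - 2 * p * q * r) * 11)) => n n7.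
    by have [_ + _ _] := E n n7; rewrite -/t; lra.
  apply: (@le_of_sub_inv _ _ _ (2 * p * q * r * 11)) => n n7; have [+ _ _ _] := E n n7.
  by rewrite mulrBr mulrA.
rewrite /triangle_probability /typical_cell -/t -/a aE tE DE.
by rewrite -mulf_div divff ?mulr1 // gt_eqF.
Qed.

End Means.

Section Maximum.
Context {R : realType}.

Definition triangle_formula (p q : R) : R :=
  2 * p * q * (1 - p - q) / (p + q - p ^+ 2 - q ^+ 2 - p * q).

Lemma triangle_formula_third : triangle_formula (1 / 3) (1 / 3) = 2 / 9.
Proof.
rewrite /triangle_formula.
have -> : 1 / 3 + 1 / 3 - (1 / 3) ^+ 2 - (1 / 3) ^+ 2 - 1 / 3 * (1 / 3) = 1 / 3 :> R by field.
by field.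
Qed.

Lemma admissible_third : admissible (1 / 3 : R) (1 / 3).
Proof. by apply/and3P; split; apply/andP; split; lra. Qed.

(* With r = 1 - p - q, the difference 2/9 - p3 has the sign of
   (p + q + r) (p q + q r + r p) - 9 p q r = p (q - r)^2 + q (r - p)^2 + r (p - q)^2. *)
Lemma triangle_formula_le (p q : R) : admissible p q ->
  triangle_formula p q <= 2 / 9 /\
  (triangle_formula p q = 2 / 9 -> p = 1 / 3 /\ q = 1 / 3).
Proof.
move=> /and3P[/andP[p0 p1] /andP[q0 q1] /andP[_ pq1]].
pose r := 1 - p - q; have r0 : 0 < r by rewrite /r; lra.
have D0 : 0 < p + q - p ^+ 2 - q ^+ 2 - p * q.
  have -> : p + q - p ^+ 2 - q ^+ 2 - p * q = p * q + p * r + q * r by rewrite /r; ring.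
  by rewrite !addr_gt0 // mulr_gt0.
have S : p + q - p ^+ 2 - q ^+ 2 - p * q - 9 * (p * q * (1 - p - q)) =
    p * (q - r) ^+ 2 + q * (r - p) ^+ 2 + r * (p - q) ^+ 2 by rewrite /r; ring.
have a0 : 0 <= p * (q - r) ^+ 2 by rewrite mulr_ge0 ?sqr_ge0 // ltW.
have b0 : 0 <= q * (r - p) ^+ 2 by rewrite mulr_ge0 ?sqr_ge0 // ltW.
have c0 : 0 <= r * (p - q) ^+ 2 by rewrite mulr_ge0 ?sqr_ge0 // ltW.
rewrite /triangle_formula; split; first by rewrite ler_pdivrMr //; lra.
move=> /eqP; rewrite eqr_div ?(lt0r_neq0 D0) ?pnatr_eq0 // => /eqP E.
have sqr0 (x y : R) : 0 < x -> x * y ^+ 2 = 0 -> y = 0.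
  by move=> x0 /eqP; rewrite mulf_eq0 gt_eqF //= expf_eq0 /= => /eqP.
(* Equality makes the sum of squares in [S] vanish, hence each of its nonnegative terms. *)
have qr : q - r = 0 by apply: (sqr0 p) => //; lra.
have rp : r - p = 0 by apply: (sqr0 q) => //; lra.
by move: qr rp; rewrite /r; lra.
Qed.

End Maximum.

Theorem theorem1 (R : realType)
    (d : R -> R -> measure_display)
    (T : forall p q : R, measurableType (d p q))
    (P : forall p q : R, probability (T p q) R)
    (X : forall p q : R, T p q -> set (R * R))
    (hX : forall (p q : R) (pq : admissible p q),
        poisson_line_process (P p q) 1%:pos (G3 pq) (X p q)) :
  let p3 (p q : R) := triangle_probability (P p q) (X p q) in
  (forall p q : R, admissible p q ->
     p3 p q = 2 * p * q * (1 - p - q) / (p + q - p ^+ 2 - q ^+ 2 - p * q)) /\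
  (forall p q : R, admissible p q ->
     ((forall p' q' : R, admissible p' q' -> p3 p' q' <= p3 p q) <->
      p = 1 / 3 /\ q = 1 / 3)) /\
  p3 (1 / 3) (1 / 3) = 2 / 9.
Proof.
move=> p3.
have p3E p q : admissible p q -> p3 p q = triangle_formula p q.
  by move=> pq; exact: (triangle_probabilityE (hX p q pq)).
have third := @admissible_third R.
split; first exact: p3E.
split; last by rewrite p3E // triangle_formula_third.
move=> p q pq; split=> [pmax|[-> ->] p' q' pq'].
  have [le29 eq29] := triangle_formula_le pq; apply: eq29.
  apply/eqP; rewrite eq_le le29 /= -triangle_formula_third.
  by rewrite -!p3E //; exact: pmax.
rewrite !p3E // triangle_formula_third.
by have [] := triangle_formula_le pq'.
Qed.
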